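(* Let $V(z;t)$, $t\in[0,t_0]$, be a one-parameter family of real analytic functions such that (a) there is a domain $\Omega\subset\mathbb C$ with $\mathbb R\subset\Omega$ such that $V(z;t)$ is analytic on $\Omega\times[0,t_0]$; (b) $\lim_{|x|\to\infty}\frac{\min\{V(x;t):0\le t\le t_0\}}{\log|x|}=\infty$; (c) $V(z;t)$ is one-cut regular for $0<t\le t_0$; (d) $V(z;0)$ is one-cut singular and $h(a)\ne0$, $h(b)\ne0$, where $[a,b]$ is the support of the equilibrium measure of $V(z;0)$. Then the end-points $a(t),b(t)$ of the support of the equilibrium measure of $V(z;t)$ are analytic on $[0,t_0]$.
   Context: Equilibrium measure of $V$: minimizer of $-\iint\log|x-y|d\nu d\nu+\int Vd\nu$ over Borel probability measures on $\mathbb R$. $V$ is one-cut if the support is a single interval $[a,b]$; then the density is $\frac1{2\pi}h(x)\sqrt{(b-x)(x-a)}$ with $h$ real analytic. One-cut regular: moreover $h>0$ on $[a,b]$ and $\int\log|x-y|d\nu_{eq}(y)-V(x)/2<l$ strictly for $x\notin[a,b]$, $l$ the constant value of the left side on $[a,b]$; one-cut singular: one-cut but not regular. Analytic on $[0,t_0]$ means extending to a real analytic function on an open interval containing $[0,t_0]$. *)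

(* Defs.v *)
From mathcomp Require Import all_boot all_order all_algebra.
From mathcomp Require Import all_classical all_reals all_analysis.
Import Order.TTheory GRing.Theory Num.Theory numFieldNormedType.Exports.
From mathcomp Require Import complex.

Set Implicit Arguments.
Unset Strict Implicit.
Unset Printing Implicit Defensive.

Local Open Scope classical_set_scope.
Local Open Scope ring_scope.

Definition real_analytic_on (R : realType) (f : R -> R) (S : set R) : Prop :=
  forall x0, S x0 -> exists r : R, 0 < r /\ exists c : nat -> R,
    forall x, S x -> `|x - x0| < r ->
      (\sum_(k < N) c k * (x - x0) ^+ k) @[N --> \oo] --> f x.

Definition analytic_around (R : realType) (f : R -> R) (a b : R) : Prop :=
  exists c d : R, c < a /\ b < d /\ real_analytic_on f `]c, d[%classic.

Definition cvgC (R : realType) (u : nat -> R[i]) (w : R[i]) : Prop :=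
  forall e : R, 0 < e -> exists N0 : nat, forall N : nat, (N0 <= N)%N ->
    `|u N - w| < e%:C%C.

Definition c_open (R : realType) (Om : set R[i]) : Prop :=
  forall z, Om z -> exists e : R, 0 < e /\ forall w, `|w - z| < e%:C%C -> Om w.

Definition c_rel_open (R : realType) (Om A : set R[i]) : Prop :=
  A `<=` Om /\ forall z, A z -> exists e : R, 0 < e /\
    forall w, Om w -> `|w - z| < e%:C%C -> A w.

Definition c_connected (R : realType) (Om : set R[i]) : Prop :=
  forall A B : set R[i], c_rel_open Om A -> c_rel_open Om B ->
    A `&` B = set0 -> A `|` B = Om -> A = set0 \/ B = set0.

Definition c_domain (R : realType) (Om : set R[i]) : Prop :=
  Om !=set0 /\ c_open Om /\ c_connected Om.

Definition joint_analytic_on (R : realType) (W : R[i] -> R -> R[i])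
    (Om : set R[i]) (t0 : R) : Prop :=
  forall z0 s, Om z0 -> 0 <= s <= t0 ->
    exists r : R, 0 < r /\ exists c : nat -> nat -> R[i],
      (exists M : R, forall N : nat,
          \sum_(m < N) \sum_(n < N) `|c m n| * (r%:C%C) ^+ (m + n) <= M%:C%C) /\
      forall z t, Om z -> `|z - z0| < r%:C%C -> 0 <= t <= t0 -> `|t - s| < r ->
        cvgC (fun N => \sum_(m < N) \sum_(n < N)
                         c m n * (z - z0) ^+ m * ((t - s)%:C%C) ^+ n) (W z t).

Definition msupport (R : realType) (mu : probability R R) : set R :=
  [set x | forall e : R, 0 < e -> (0 < mu `](x - e)%R, (x + e)%R[%classic)%E].

Definition energy_kernel (R : realType) (V : R -> R) (x y : R) : \bar R :=
  if x == y then +oo%E else (- ln `|x - y| + V x / 2 + V y / 2)%:E.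

(* -∬ log|x-y| dnu dnu + ∫ V dnu *)
Definition energy (R : realType) (V : R -> R) (nu : probability R R) : \bar R :=
  (\int[nu]_x \int[nu]_y energy_kernel V x y)%E.

Definition is_equilibrium_measure (R : realType) (V : R -> R)
    (mu : probability R R) : Prop :=
  forall nu : probability R R, (energy V mu <= energy V nu)%E.

Definition log_potential (R : realType) (mu : probability R R) (x : R) : \bar R :=
  (\int[mu]_y (if y == x then -oo else (ln `|x - y|)%:E))%E.

Definition one_cut_shape (R : realType) (mu : probability R R)
    (a b : R) (h : R -> R) : Prop :=
  a < b /\ analytic_around h a b /\ msupport mu = `[a, b]%classic /\
  forall A : set R, measurable A ->
    mu A = (\int[lebesgue_measure]_(x in A `&` `[a, b]%classic)
              (1 / (2 * pi) * h x * Num.sqrt ((b - x) * (x - a)))%:E)%E.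

Definition one_cut (R : realType) (V : R -> R) : Prop :=
  exists (mu : probability R R) (a b : R) (h : R -> R),
    is_equilibrium_measure V mu /\ one_cut_shape mu a b h.

Definition one_cut_regular (R : realType) (V : R -> R) : Prop :=
  exists (mu : probability R R) (a b : R) (h : R -> R),
    is_equilibrium_measure V mu /\ one_cut_shape mu a b h /\
    (forall x, a <= x <= b -> 0 < h x) /\
    exists l : R,
      (forall x, a <= x <= b -> (log_potential mu x - (V x / 2)%:E = l%:E)%E) /\
      (forall x, ~ (a <= x <= b) -> (log_potential mu x - (V x / 2)%:E < l%:E)%E).

Definition one_cut_singular (R : realType) (V : R -> R) : Prop :=
  one_cut V /\ ~ one_cut_regular V.

(* Main.v *)
Require Import Defs.
From HB Require Import structures.
From mathcomp Require Import all_boot all_order all_algebra.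
From mathcomp Require Import all_classical all_reals all_analysis.
Import Order.TTheory GRing.Theory Num.Theory numFieldNormedType.Exports.
From mathcomp Require Import complex.
From mathcomp Require Import measurable_realfun.
From mathcomp Require Import ring lra.

Set Implicit Arguments.
Unset Strict Implicit.
Unset Printing Implicit Defensive.

Local Open Scope classical_set_scope.
Local Open Scope ring_scope.

(** For [c] real and [r > 0], let [F t c r] be the mean of [V (c + r * cos th) t / 2] over
    [th] in [[0, pi]], minus [ln (r / 2)] (minus the Mhaskar-Saff functional of the interval
    [[c - r, c + r]]).  The logarithmic potential of the arcsine distribution of an interval is
    constant on that interval and strictly smaller outside, with a square root gap.  Pairing it
    with the equilibrium measure shows that the centre and half-length of the support minimize
    [F t], and, as the density behaves like a square root at both endpoints ([h a], [h b] nonzero),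
    that [F t] grows at least quadratically when an endpoint is moved inwards.  The quadratic part
    of [F t] at the minimum is therefore positive definite, whether or not the density vanishes
    inside the support.  Any other minimizer would be an interval containing the support, and all
    the intervals in between would be minimizers too; so the minimizer is unique, hence continuous
    in [t], and it solves an analytic system with invertible linear part.

    Real-analyticity is handled with power series whose coefficients are bounded in a weighted
    l1 norm: this class is stable under pointwise limits, which gives both the expansion of [F]
    (a limit of Riemann sums) and that of the implicit function (a limit of polynomial iterates).
    Uniqueness of the equilibrium measure comes from positive definiteness of the logarithmic
    kernel, written as an integral of products of indicators of windows. *)

(** * Power series and implicit functions *)

(** All the information is one-sided, in two ways. Moving an endpoint inwards by [u] leaves a mass
    of order [u^(3/2)] outside the trial interval, where the arcsine potential drops by order
    [u^(1/2)]: the product is the quadratic growth. An outward move gives no such gain, only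
    minimality. But a quadratic form is even, so what inward moves prove on a half-plane of
    displacements holds on the opposite one, and the two endpoints together control every direction.
    The parameter is one-sided as well: at [0] and [t0] nothing is known beyond the interval. The
    implicit function argument therefore constructs no solution. It shows that wherever a small
    solution is given, here the minimizer, it is the sum of one fixed power series; that series then
    defines the extension past the ends of [[0, t0]]. *)

Lemma cvg_seq_sum (R : realType) (T I : Type) (F : set_system T) (FF : Filter F)
    (r : seq I) (f : I -> T -> R) (l : I -> R) :
  (forall i, f i x @[x --> F] --> l i) ->
  \sum_(i <- r) f i x @[x --> F] --> \sum_(i <- r) l i.
Proof.
move=> fl; elim: r => [|i r IH].
  by under eq_fun do rewrite big_nil; rewrite big_nil; exact: cvg_cst.
by under eq_fun do rewrite big_cons; rewrite big_cons; apply: cvgD.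
Qed.

(** Compactness of segments along a free ultrafilter. One [U] serves all bounded sequences at once,
    so that countably many coefficients converge together without extracting subsequences. *)
Lemma ultra_bounded (R : realType) : exists U : set_system nat,
  [/\ ProperFilter U, (\oo `<=` U) &
   forall u : nat -> R, (exists B : R, forall n, `|u n| <= B) -> cvg (u @ U)].
Proof.
have [U [UU Uoo]] := ultraFilterLemma (@eventually_filter).
exists U; split=> //; first exact: ultra_proper.
move=> u [B uB].
have [|p [_ clp]] := @segment_compact R (- B) B (u @ U) _.
  rewrite nbhs_simpl /=; apply: filterE => n /=.
  by rewrite in_itv /= -ler_norml.
apply/cvg_ex; exists p => A Ap; rewrite nbhs_simpl.
have [//|UnA] := in_ultra_setVsetC (u @^-1` A) UU.
by have [x [nAx Ax]] := clp (~` A) A UnA Ap.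
Qed.

(** * Weighted l1 families over an index set exhausted by finite boxes *)

Section boxes.
Context (R : realType) (I : eqType) (box : nat -> seq I) (deg : I -> nat).
Hypothesis box_uniq : forall N, uniq (box N).
Hypothesis box_sub : forall N N', (N <= N')%N -> {subset box N <= box N'}.
Hypothesis box_deg : forall N i, i \notin box N -> (N <= deg i)%N.
Hypothesis box_all : forall i, exists N, i \in box N.

(** The l1 norm at radius [rho], bounded through its partial sums. The boxes are abstract so that
    one and three variables share the proofs. *)
Definition wbound (f : I -> R) (rho M : R) :=
  forall N, \sum_(i <- box N) `|f i| * rho ^+ deg i <= M.
Definition psum (f e : I -> R) (N : nat) := \sum_(i <- box N) f i * e i.

Lemma wbound_coef f (rho M : R) i : 0 <= rho -> wbound f rho M -> `|f i| * rho ^+ deg i <= M.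
Proof.
move=> r0 fM; have [N iN] := box_all i; apply: le_trans (fM N).
rewrite (bigD1_seq i) //= lerDl sumr_ge0 // => j _.
by rewrite mulr_ge0 // exprn_ge0.
Qed.

Lemma sum_box_split (h : I -> R) N N' : (N <= N')%N ->
  \sum_(i <- box N') h i = \sum_(i <- box N) h i + \sum_(i <- box N' | i \notin box N) h i.
Proof.
move=> NN'; rewrite (bigID (mem (box N))) /=; congr (_ + _).
rewrite -big_filter; apply: perm_big; apply: uniq_perm => //.
  by rewrite filter_uniq.
move=> i; rewrite mem_filter; apply/andP/idP => [[]//|iN]; split=> //.
exact: (box_sub NN').
Qed.

(** A term outside box [N] has degree at least [N], so passing from radius [rho] to radius [s] gains
    the factor [(s / rho) ^+ N] on its share of the norm. The bound depends on [f] only through [M];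
    this uniformity is what lets limits of series be interchanged. *)
Lemma psum_tail f e (rho M s : R) N N' : 0 < rho -> 0 <= s <= rho -> wbound f rho M ->
  (forall i, `|e i| <= s ^+ deg i) -> (N <= N')%N ->
  `|psum f e N' - psum f e N| <= M * (s / rho) ^+ N.
Proof.
move=> r0 /andP[s0 sr] fM es NN'.
rewrite /psum (sum_box_split _ NN') addrC addKr.
apply: (le_trans (ler_norm_sum _ _ _)).
have q0 : 0 <= s / rho by rewrite divr_ge0 // ltW.
have q1 : s / rho <= 1 by rewrite ler_pdivrMr // mul1r.
apply: (@le_trans _ _ (\sum_(i <- box N' | i \notin box N) `|f i| * rho ^+ deg i * (s / rho) ^+ N)).
  apply: ler_sum => i iN; rewrite normrM -mulrA ler_wpM2l //.
  apply: (le_trans (es i)).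
  have {1}-> : s = rho * (s / rho) by rewrite mulrC divfK // gt_eqF.
  rewrite exprMn ler_wpM2l ?exprn_ge0 ?(ltW r0) //.
  by rewrite ler_wiXn2l //; exact: box_deg.
rewrite -mulr_suml ler_wpM2r ?exprn_ge0 //.
apply: le_trans (fM N'); rewrite (sum_box_split _ NN') lerDr sumr_ge0 // => j _.
by rewrite mulr_ge0 // exprn_ge0 // ltW.
Qed.

Lemma wbound_ge0 f (rho M : R) : 0 <= rho -> wbound f rho M -> 0 <= M.
Proof.
move=> r0 /(_ 0%N); apply: le_trans; rewrite sumr_ge0 // => i _.
by rewrite mulr_ge0 // exprn_ge0.
Qed.

Lemma psum_tail_lim f e (rho M s : R) N (l : R) : 0 < rho -> 0 <= s <= rho -> wbound f rho M ->
  (forall i, `|e i| <= s ^+ deg i) -> psum f e N' @[N' --> \oo] --> l ->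
  `|l - psum f e N| <= M * (s / rho) ^+ N.
Proof.
move=> r0 sr fM es fl.
have h : `|psum f e N' - psum f e N| @[N' --> \oo] --> `|l - psum f e N|.
  by apply: cvg_norm; apply: cvgB => //; exact: cvg_cst.
rewrite -(cvg_lim _ h) //; apply: limr_le; first by apply/cvg_ex; eexists; exact: h.
by exists N => // N' /= NN'; exact: psum_tail fM es NN'.
Qed.

(* Coefficientwise limit along an ultrafilter: a diagonal extraction. *)
Lemma wbound_closure (fK : nat -> I -> R) (rho M : R) : 0 < rho ->
  (forall K, wbound (fK K) rho M) ->
  exists f, wbound f rho M /\
   forall (e : I -> R) (s : R) (gK : nat -> R) (g : R), 0 <= s < rho ->
    (forall i, `|e i| <= s ^+ deg i) ->
    (forall K, psum (fK K) e N @[N --> \oo] --> gK K) -> gK K @[K --> \oo] --> g ->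
    psum f e N @[N --> \oo] --> g.
Proof.
move=> r0 fM; have [U [UP Uoo Ucvg]] := ultra_bounded R.
have cv i : cvg (fK ^~ i @ U).
  apply: Ucvg; exists (M / rho ^+ deg i) => K.
  by rewrite ler_pdivlMr ?exprn_gt0 // (wbound_coef _ (ltW r0) (fM K)).
have {}cv i : fK ^~ i @ U --> lim (fK ^~ i @ U) by [].
exists (fun i => lim (fK ^~ i @ U)); split.
  move=> N.
  have h : \sum_(i <- box N) `|fK K i| * rho ^+ deg i @[K --> U] -->
     \sum_(i <- box N) `|lim (fK ^~ i @ U)| * rho ^+ deg i.
    apply: cvg_seq_sum => i; apply: cvgM; last exact: cvg_cst.
    by apply: cvg_norm; exact: cv.
  rewrite -(cvg_lim _ h) //; apply: limr_le; first by apply/cvg_ex; eexists; exact: h.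
  by apply: filterE => K; exact: fM.
move=> e s gK g /andP[s0 sr] es gKl gKg.
have gU : gK K @[K --> U] --> g by move=> A /gKg /Uoo.
have s0r : 0 <= s <= rho by rewrite s0 ltW.
(* At fixed [N] the tail bound is uniform in [K], so it survives the limit along [U]; letting [N]
   grow afterwards exchanges the two limits. *)
have h N : `|g - psum (fun i => lim (fK ^~ i @ U)) e N| <= M * (s / rho) ^+ N.
  have h : `|gK K - psum (fK K) e N| @[K --> U] -->
     `|g - psum (fun i => lim (fK ^~ i @ U)) e N|.
    apply: cvg_norm; apply: cvgB => //; apply: cvg_seq_sum => i.
    by apply: cvgM; [exact: cv | exact: cvg_cst].
  rewrite -(cvg_lim _ h) //; apply: limr_le; first by apply/cvg_ex; eexists; exact: h.
  apply: filterE => K; exact: psum_tail_lim (fM K) es (gKl K).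
apply/cvgrPdist_le => eps e0.
have q : M * (s / rho) ^+ N @[N --> \oo] --> (0 : R).
  rewrite -(mulr0 M); apply: cvgM; first exact: cvg_cst.
  apply: cvg_expr; rewrite ger0_norm ?divr_ge0 ?(ltW r0) //.
  by rewrite ltr_pdivrMr // mul1r.
move/cvgrPdist_le : q => /(_ _ e0); apply: filterS => N.
rewrite sub0r normrN => hN; apply: le_trans (h N) _; apply: le_trans hN.
exact: ler_norm.
Qed.

End boxes.

(** * Power series in one variable and limits of polynomials *)

Section nat_series.
Context (R : realType).

Definition nbox (N : nat) := index_iota 0 N.
Definition nbound (a : nat -> R) := wbound nbox id a.
Definition nmono (t : R) (n : nat) := t ^+ n.

Lemma nbox_uniq N : uniq (nbox N). Proof. exact: iota_uniq. Qed.
Lemma nbox_sub N N' : (N <= N')%N -> {subset nbox N <= nbox N'}.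
Proof. by move=> NN i; rewrite !mem_index_iota /= => h; exact: leq_trans h NN. Qed.
Lemma nbox_deg N i : i \notin nbox N -> (N <= i)%N.
Proof. by rewrite mem_index_iota /= -leqNgt. Qed.
Lemma nbox_all i : exists N, i \in nbox N.
Proof. by exists i.+1; rewrite mem_index_iota /=. Qed.

Lemma psum_nat (a e : nat -> R) N : psum nbox a e N = \sum_(k < N) a k * e k.
Proof. by rewrite /psum /nbox big_mkord. Qed.

Lemma nbound_ord (a : nat -> R) (rho M : R) :
  nbound a rho M <-> forall N, \sum_(k < N) `|a k| * rho ^+ k <= M.
Proof.
by split=> h N; have := h N; rewrite /nbox big_mkord.
Qed.

Lemma psum_horner (p : {poly R}) t : psum nbox (fun n => p`_n) (nmono t) N @[N --> \oo] --> p.[t].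
Proof.
apply: cvg_near_cst; exists (size p) => // N /= pN.
by rewrite psum_nat (horner_coef_wide t pN).
Qed.

Lemma nbound_poly_add (p q : {poly R}) (rho M1 M2 : R) : 0 <= rho ->
  nbound (fun n => p`_n) rho M1 -> nbound (fun n => q`_n) rho M2 ->
  nbound (fun n => (p + q)`_n) rho (M1 + M2).
Proof.
move=> r0 pM qM N; apply: le_trans (lerD (pM N) (qM N)).
rewrite -big_split /= ler_sum // => i _; rewrite -mulrDl ler_wpM2r ?exprn_ge0 //.
by rewrite coefD ler_normD.
Qed.

Lemma nbound_poly_scale (c : R) (p : {poly R}) (rho M : R) : 0 <= rho ->
  nbound (fun n => p`_n) rho M -> nbound (fun n => (c *: p)`_n) rho (`|c| * M).
Proof.
move=> r0 pM N; apply: le_trans (ler_wpM2l (normr_ge0 c) (pM N)).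
rewrite mulr_sumr ler_sum // => i _.
by rewrite coefZ normrM mulrA.
Qed.

Lemma nbox_sum_mulX (p : {poly R}) (c rho : R) N :
  \sum_(i <- nbox N.+1) `|(p * 'X + c%:P)`_i| * rho ^+ i =
  `|c| + rho * \sum_(i <- nbox N) `|p`_i| * rho ^+ i.
Proof.
rewrite /nbox big_nat_recl // coefD coefMX coefC /= add0r expr0 mulr1; congr (_ + _).
rewrite mulr_sumr; apply: eq_bigr => i _; rewrite coefD coefMX coefC /= addr0 exprS; ring.
Qed.

(** Submultiplicativity of the l1 norm, truncated at the same [N] on both sides because a
    coefficient of the product only involves coefficients of smaller or equal index. The induction
    peels off the constant term of [p], which avoids the convolution sum. *)
Lemma nbound_poly_mul (p q : {poly R}) (rho M1 M2 : R) : 0 <= rho ->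
  nbound (fun n => p`_n) rho M1 -> nbound (fun n => q`_n) rho M2 ->
  nbound (fun n => (p * q)`_n) rho (M1 * M2).
Proof.
move=> r0 pM qM.
have h (p' : {poly R}) N : \sum_(i <- nbox N) `|(p' * q)`_i| * rho ^+ i <=
   (\sum_(i <- nbox N) `|p'`_i| * rho ^+ i) * (\sum_(i <- nbox N) `|q`_i| * rho ^+ i).
  elim/poly_ind: p' N => [|p' c IH] N.
    by rewrite mul0r big1 ?mul0r // => i _; rewrite coef0 normr0 mul0r.
  case: N => [|N]; first by rewrite /nbox !big_geq // mul0r.
  have s0 (p'' : {poly R}) N' : 0 <= \sum_(i <- nbox N') `|p''`_i| * rho ^+ i.
    by apply: sumr_ge0 => i _; rewrite mulr_ge0 // exprn_ge0.
  have le1 : \sum_(i <- nbox N) `|q`_i| * rho ^+ i <= \sum_(i <- nbox N.+1) `|q`_i| * rho ^+ i.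
    rewrite (sum_box_split nbox_uniq nbox_sub _ (leqnSn N)) lerDl sumr_ge0 // => i _.
    by rewrite mulr_ge0 // exprn_ge0.
  rewrite nbox_sum_mulX [X in _ <= X]mulrDl.
  have -> : (p' * 'X + c%:P) * q = (p' * q * 'X + 0%:P) + c *: q.
    by rewrite mulrDl polyC0 addr0 mul_polyC mulrAC.
  apply: (@le_trans _ _ (\sum_(i <- nbox N.+1) `|(p' * q * 'X + 0%:P)`_i| * rho ^+ i +
       \sum_(i <- nbox N.+1) `|(c *: q)`_i| * rho ^+ i)).
    rewrite -big_split /= ler_sum // => i _; rewrite -mulrDl ler_wpM2r ?exprn_ge0 //.
    by rewrite coefD ler_normD.
  rewrite nbox_sum_mulX normr0 add0r addrC; apply: lerD.
    rewrite mulr_sumr ler_sum // => i _; by rewrite coefZ normrM mulrA.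
  rewrite -mulrA ler_wpM2l //; apply: le_trans (IH N) _.
  by rewrite ler_wpM2l.
move=> N; apply: le_trans (h p N) _; apply: ler_pM => //;
  by apply: sumr_ge0 => i _; rewrite mulr_ge0 // exprn_ge0.
Qed.

Lemma nbound_poly1 (rho : R) : nbound (fun n => (1 : {poly R})`_n) rho 1.
Proof.
case=> [|N]; first by rewrite /nbox big_geq.
have -> : (1 : {poly R}) = 0 * 'X + 1%:P by rewrite mul0r add0r polyC1.
rewrite nbox_sum_mulX normr1 big1 ?mulr0 ?addr0 // => i _.
by rewrite coef0 normr0 mul0r.
Qed.

Lemma nbound_polyX (rho : R) : 0 <= rho -> nbound (fun n => ('X : {poly R})`_n) rho rho.
Proof.
move=> r0; case=> [|N]; first by rewrite /nbox big_geq.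
have -> : ('X : {poly R}) = 1 * 'X + 0%:P by rewrite mul1r polyC0 addr0.
rewrite nbox_sum_mulX normr0 add0r -[X in _ <= X]mulr1 ler_wpM2l //.
exact: nbound_poly1.
Qed.

Lemma nbound_poly_exp (p : {poly R}) (rho M : R) j : 0 <= rho ->
  nbound (fun n => p`_n) rho M -> nbound (fun n => (p ^+ j)`_n) rho (M ^+ j).
Proof.
move=> r0 pM; elim: j => [|j IH]; last by rewrite !exprS; exact: nbound_poly_mul.
exact: nbound_poly1.
Qed.

Lemma nbound_poly0 (rho M : R) : 0 <= M -> nbound (fun n => (0 : {poly R})`_n) rho M.
Proof. by move=> M0 N; rewrite big1 // => i _; rewrite coef0 normr0 mul0r. Qed.

Lemma nbound_poly_sum (I : Type) (r : seq I) (p : I -> {poly R}) (M : I -> R) (rho : R) :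
  0 <= rho -> (forall i, nbound (fun n => (p i)`_n) rho (M i)) ->
  nbound (fun n => (\sum_(i <- r) p i)`_n) rho (\sum_(i <- r) M i).
Proof.
move=> r0 pM; elim: r => [|i r IH]; first by rewrite !big_nil; exact: nbound_poly0.
by rewrite !big_cons; apply: nbound_poly_add.
Qed.

(** The form in which the implicit function and recentred series arise: a norm bound common to all
    the polynomials and pointwise convergence where it is available. The series is chosen before
    [t]. *)
Lemma poly_limit_series (p : nat -> {poly R}) (rho M : R) : 0 < rho ->
  (forall K, nbound (fun n => (p K)`_n) rho M) ->
  exists a, nbound a rho M /\ forall t g : R, `|t| < rho ->
    (p K).[t] @[K --> \oo] --> g -> psum nbox a (nmono t) N @[N --> \oo] --> g.
Proof.
move=> r0 pM.
have [a [aM ag]] := wbound_closure nbox_uniq nbox_sub nbox_deg nbox_all r0 pM.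
exists a; split=> // t g tr pg; apply: (ag _ `|t| (fun K => (p K).[t])) => //.
- by rewrite normr_ge0.
- by move=> i; rewrite normrX.
- by move=> K; exact: psum_horner.
Qed.

End nat_series.

(** * Power series in three variables *)

Section triple.
Context (R : realType).
Definition idx := (nat * nat * nat)%type.
Definition tdeg (i : idx) := (i.1.1 + i.1.2 + i.2)%N.
Definition tbox (N : nat) : seq idx :=
  [seq (jl, n) | jl <- [seq (j, l) | j <- index_iota 0 N, l <- index_iota 0 N],
     n <- index_iota 0 N].
Definition tbound (f : idx -> R) := wbound tbox tdeg f.
Definition tmono (x y t : R) (i : idx) := x ^+ i.1.1 * y ^+ i.1.2 * t ^+ i.2.

Lemma mem_tbox N i : (i \in tbox N) = [&& (i.1.1 < N)%N, (i.1.2 < N)%N & (i.2 < N)%N].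
Proof.
case: i => [[j l] n]; rewrite /tbox; apply/allpairsP/and3P => /=.
  case=> [[[j' l'] n']] /= [/allpairsP[[j'' l'']] /= []].
  by rewrite !mem_index_iota /= => jN lN [-> ->] nN [-> -> ->].
move=> [jN lN nN]; exists ((j, l), n); split=> //=; last by rewrite mem_index_iota.
by apply/allpairsP; exists (j, l); rewrite !mem_index_iota.
Qed.

Lemma tbox_uniq N : uniq (tbox N).
Proof.
apply: allpairs_uniq; rewrite ?iota_uniq //; last by move=> [a b] [c d] _ _ [-> ->].
apply: allpairs_uniq; rewrite ?iota_uniq //.
by move=> [a b] [c d] _ _ [-> ->].
Qed.

Lemma tbox_sub N N' : (N <= N')%N -> {subset tbox N <= tbox N'}.
Proof.
move=> NN i; rewrite !mem_tbox => /and3P[a b c].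
by rewrite !(leq_trans _ NN).
Qed.

Lemma tbox_deg N i : i \notin tbox N -> (N <= tdeg i)%N.
Proof.
rewrite mem_tbox !negb_and -!leqNgt /tdeg => /or3P[] h; apply: leq_trans h _.
- by rewrite -addnA leq_addr.
- by rewrite addnAC leq_addl.
- by rewrite leq_addl.
Qed.

Lemma tbox_all i : exists N, i \in tbox N.
Proof.
exists (tdeg i).+1; rewrite mem_tbox !ltnS /tdeg; apply/and3P; split.
- by rewrite -addnA leq_addr.
- by rewrite addnAC leq_addl.
- by rewrite leq_addl.
Qed.

Lemma tmono_le (x y t s : R) i : `|x| <= s -> `|y| <= s -> `|t| <= s ->
  `|tmono x y t i| <= s ^+ tdeg i.
Proof.
move=> xs ys ts; rewrite /tmono /tdeg !normrM !normrX !exprD.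
have s0 : 0 <= s by exact: le_trans xs.
by rewrite !ler_pM ?mulr_ge0 ?exprn_ge0 // lerXn2r ?nnegrE.
Qed.

Lemma sum_tbox (h : idx -> R) N : \sum_(i <- tbox N) h i =
  \sum_(j < N) \sum_(l < N) \sum_(n < N) h ((nat_of_ord j, nat_of_ord l), nat_of_ord n).
Proof.
rewrite /tbox big_allpairs big_allpairs.
rewrite big_mkord; apply: eq_bigr => j _; rewrite big_mkord; apply: eq_bigr => l _.
exact: big_mkord.
Qed.

(** [D] restricts the parameter: at the ends of [[0, t0]] the expansion is only asserted on one
    side. Keeping [M] explicit is what allows [tser_lim] to pass to the limit. *)
Definition tser (rho M : R) (D : set R) (g : R -> R -> R -> R) :=
  exists f, tbound f rho M /\ forall x y t, `|x| < rho -> `|y| < rho -> `|t| < rho ->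
   D t -> psum tbox f (tmono x y t) N @[N --> \oo] --> g x y t.

Lemma tser_lim (rho M : R) (D : set R) (gK : nat -> R -> R -> R -> R) g : 0 < rho ->
  (forall K, tser rho M D (gK K)) ->
  (forall x y t, `|x| < rho -> `|y| < rho -> `|t| < rho -> D t ->
     gK K x y t @[K --> \oo] --> g x y t) -> tser rho M D g.
Proof.
move=> r0 /choice[fK fKP] gg.
have [f [fM fg]] := wbound_closure tbox_uniq tbox_sub tbox_deg tbox_all r0
  (fun K => (fKP K).1).
exists f; split=> // x y t xr yr tr Dt.
have sr : Num.max `|x| (Num.max `|y| `|t|) < rho by rewrite !gt_max xr yr tr.
apply: (fg _ (Num.max `|x| (Num.max `|y| `|t|)) (fun K => gK K x y t)).
- by rewrite sr le_max normr_ge0.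
- move=> i; apply: tmono_le; rewrite !le_max lexx ?orbT //.
- by move=> K; exact: (fKP K).2.
- exact: gg.
Qed.

Lemma tser_add (rho M1 M2 : R) D g1 g2 : 0 <= rho -> tser rho M1 D g1 -> tser rho M2 D g2 ->
  tser rho (M1 + M2) D (fun x y t => g1 x y t + g2 x y t).
Proof.
move=> r0 [f1 [b1 l1]] [f2 [b2 l2]]; exists (fun i => f1 i + f2 i); split.
  move=> N; apply: le_trans (lerD (b1 N) (b2 N)).
  rewrite -big_split /= ler_sum // => i _; rewrite -mulrDl ler_wpM2r ?exprn_ge0 //.
  by rewrite ler_normD.
move=> x y t xr yr tr Dt.
rewrite (_ : (fun _ => _) = (fun N => psum tbox f1 (tmono x y t) N + psum tbox f2 (tmono x y t) N)).
  by apply: cvgD; [exact: l1 | exact: l2].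
apply/funext => N; rewrite /psum -big_split /=.
by apply: eq_bigr => i _; rewrite mulrDl.
Qed.

Lemma tser_scale (rho M : R) D g (c : R) : 0 <= rho -> tser rho M D g ->
  tser rho (`|c| * M) D (fun x y t => c * g x y t).
Proof.
move=> r0 [f1 [b1 l1]]; exists (fun i => c * f1 i); split.
  move=> N; apply: le_trans (ler_wpM2l (normr_ge0 c) (b1 N)).
  rewrite mulr_sumr ler_sum // => i _; by rewrite normrM mulrA.
move=> x y t xr yr tr Dt.
rewrite (_ : (fun _ => _) = (fun N => c * psum tbox f1 (tmono x y t) N)).
  by apply: cvgM; [exact: cvg_cst | exact: l1].
apply/funext => N; rewrite /psum mulr_sumr.
by apply: eq_bigr => i _; rewrite [RHS]mulrA.
Qed.

Lemma tser_ext (rho M : R) D g1 g2 :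
  (forall x y t, `|x| < rho -> `|y| < rho -> `|t| < rho -> D t -> g1 x y t = g2 x y t) ->
  tser rho M D g1 -> tser rho M D g2.
Proof.
by move=> e [f [b l]]; exists f; split=> // x y t xr yr tr Dt; rewrite -e //; exact: l.
Qed.

Lemma tser_weaken (rho M : R) D g (rho' M' : R) : 0 <= rho' <= rho -> M <= M' ->
  tser rho M D g -> tser rho' M' D g.
Proof.
move=> /andP[r0 rr] MM [f [b l]]; exists f; split.
  move=> N; apply: le_trans MM; apply: le_trans (b N); apply: ler_sum => i _.
  by rewrite ler_wpM2l // lerXn2r // nnegrE (le_trans r0).
by move=> x y t xr yr tr Dt; apply: l => //; apply: lt_le_trans rr.
Qed.

Lemma tser0 rho D : tser rho 0 D (fun _ _ _ => 0).
Proof.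
exists (fun _ => 0); split; first by move=> N; rewrite big1 // => i _; rewrite normr0 mul0r.
move=> x y t _ _ _ _; rewrite (_ : (fun _ => _) = (fun _ => 0)); first exact: cvg_cst.
by apply/funext => N; rewrite /psum big1 // => i _; rewrite mul0r.
Qed.

Lemma tser_sum (I : Type) (r : seq I) (rho : R) (M : I -> R) D g : 0 <= rho ->
  (forall i, tser rho (M i) D (g i)) ->
  tser rho (\sum_(i <- r) M i) D (fun x y t => \sum_(i <- r) g i x y t).
Proof.
move=> r0 gM; elim: r => [|i r IH].
  rewrite big_nil; apply: tser_ext (tser0 _ _) => x y t _ _ _ _; by rewrite big_nil.
rewrite big_cons; apply: tser_ext (tser_add r0 (gM i) IH) => x y t _ _ _ _.
by rewrite big_cons.
Qed.

(** The upper limit [N] does not depend on [n], so that the expansion becomes a sum over a box; the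
    extra binomials vanish. *)
Lemma exprDn_wide (x y : R) n N : (n < N)%N ->
  (x + y) ^+ n = \sum_(i < N) 'C(n, i)%:R * x ^+ (n - i) * y ^+ i.
Proof.
move=> nN; rewrite exprDn (big_ord_widen _ (fun i => x ^+ (n - i) * y ^+ i *+ 'C(n, i)) nN).
rewrite [RHS](bigID (fun i : 'I_N => (i < n.+1)%N)) /= [X in _ = _ + X]big1 ?addr0.
  by apply: eq_bigr => i _; rewrite -mulrA -mulr_natl.
by move=> i; rewrite -leqNgt => ni; rewrite bin_small // !mul0r.
Qed.

Definition trinom_coef (c d e : R) (m n : nat) (i : idx) : R :=
  if i.2 == n then c * ('C(m, i.1.1)%:R * ('C(m - i.1.1, i.1.2)%:R *
     d ^+ (m - i.1.1 - i.1.2) * e ^+ i.1.2)) else 0.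

Lemma trinom_sum (c d e x y t : R) m n N : (m < N)%N -> (n < N)%N ->
  \sum_(i <- tbox N) trinom_coef c d e m n i * tmono x y t i =
  c * (d + x + y * e) ^+ m * t ^+ n.
Proof.
move=> mN nN; rewrite sum_tbox.
have -> : d + x + y * e = (d + y * e) + x by ring.
rewrite (exprDn_wide _ _ mN) mulr_sumr mulr_suml; apply: eq_bigr => j _.
rewrite (exprDn_wide _ _ (leq_ltn_trans (leq_subr j m) mN)).
rewrite mulr_sumr mulr_suml mulr_sumr mulr_suml; apply: eq_bigr => l _.
rewrite (bigD1 (Ordinal nN)) //= big1 ?addr0 => [|k /negPf kn]; last first.
  by rewrite /trinom_coef /=; move: kn; rewrite -val_eqE /= => ->; rewrite mul0r.
rewrite /trinom_coef /tmono /= eqxx exprMn; ring.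
Qed.

(** The norm at radius [rho] is the same polynomial evaluated at absolute values. It will be used
    with [e = cos th], to expand [V] at a point of an interval whose centre and half-length vary. *)
Lemma tser_trinom (rho c d e : R) m n D : 0 <= rho ->
  tser rho (`|c| * (`|d| + rho + rho * `|e|) ^+ m * rho ^+ n) D
    (fun x y t => c * (d + x + y * e) ^+ m * t ^+ n).
Proof.
move=> r0; exists (trinom_coef c d e m n); split.
  (* A box large enough to hold every nonzero coefficient, where [trinom_sum] gives the closed
     form. *)
  move=> N; pose N' := (maxn N (maxn m n).+1).
  have mN : (m < N')%N by rewrite leq_max ltnS leq_max leqnn /= orbT.
  have nN : (n < N')%N by rewrite leq_max ltnS leq_max leqnn /= !orbT.
  rewrite -(trinom_sum _ _ _ _ _ _ mN nN).
  rewrite (sum_box_split tbox_uniq tbox_sub _ (leq_maxl N (maxn m n).+1)).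
  have h i : `|trinom_coef c d e m n i| * rho ^+ tdeg i =
     trinom_coef `|c| `|d| `|e| m n i * tmono rho rho rho i.
    rewrite /trinom_coef /tmono /tdeg !exprD; case: ifP => _; last by rewrite normr0 !mul0r.
    by rewrite !normrM !normrX !normr_nat.
  under eq_bigr do rewrite h.
  rewrite lerDl; apply: sumr_ge0 => i _; rewrite -h.
  by rewrite mulr_ge0 // exprn_ge0.
move=> x y t _ _ _ _; apply: cvg_near_cst; exists (maxn m n).+1 => // N /= mnN.
by apply: trinom_sum; apply: leq_trans mnN; rewrite ltnS leq_max leqnn ?orbT.
Qed.

End triple.

(** * A quantitative implicit function theorem by truncated iteration *)

Section fixed_point.
Context (R : realType).
Local Notation psumT := (psum tbox).

(** The factor [d] on the left replaces the exponent [j + l - 1] on the right, which would need a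
    truncated subtraction. *)
Lemma monom_lip (x x' y y' d D : R) j l : `|x| <= d -> `|x'| <= d -> `|y| <= d -> `|y'| <= d ->
  `|x - x'| <= D -> `|y - y'| <= D ->
  d * `|x ^+ j * y ^+ l - x' ^+ j * y' ^+ l| <= (j + l)%:R * d ^+ (j + l) * D.
Proof.
move=> xd xd' yd yd' xD yD; have d0 : 0 <= d by exact: le_trans xd.
have D0 : 0 <= D by exact: le_trans xD.
have step (A A' u u' : R) m : `|u| <= d -> `|u'| <= d -> `|u - u'| <= D ->
   `|A| <= d ^+ m -> d * `|A - A'| <= m%:R * d ^+ m * D ->
   d * `|u * A - u' * A'| <= m.+1%:R * d ^+ m.+1 * D.
  move=> ud ud' uD Am AA.
  have -> : u * A - u' * A' = (u - u') * A + u' * (A - A') by ring.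
  apply: (le_trans (ler_wpM2l d0 (ler_normD _ _))); rewrite !normrM mulrDr.
  have h1 : `|u - u'| * `|A| <= D * d ^+ m by apply: ler_pM.
  have h2 : `|u'| * (d * `|A - A'|) <= d * (m%:R * d ^+ m * D).
    by apply: ler_pM => //; rewrite mulr_ge0.
  have h1' := ler_wpM2l d0 h1.
  have -> : m.+1%:R * d ^+ m.+1 * D = d * (D * d ^+ m) + d * (m%:R * d ^+ m * D).
    rewrite exprS -natr1; ring.
  apply: lerD => //; by rewrite mulrCA.
elim: j => [|j IH].
  rewrite !expr0 !mul1r add0n; elim: l => [|l IH].
    by rewrite !expr0 subrr normr0 mulr0 mulr0n !mul0r.
  rewrite !(exprS y) !(exprS y'); apply: step => //.
  by rewrite normrX lerXn2r // nnegrE.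
rewrite !(exprS x) !(exprS x') -(mulrA x) -(mulrA x') addSn; apply: step => //.
by rewrite normrM !normrX exprD ler_pM ?exprn_ge0 // lerXn2r // nnegrE.
Qed.

Lemma contraction_error_cvg (e eps : nat -> R) B :
  (forall k, 0 <= e k <= B) -> (forall k, e k.+1 <= 2^-1 * e k + eps k) ->
  eps k @[k --> \oo] --> 0 -> e k @[k --> \oo] --> 0.
Proof.
move=> eB es eps0; apply/cvgrPdist_le => d d0.
(* [d / 2] is the fixed point of [e |-> e / 2 + d / 4], so once the perturbation is below [d / 4]
   the excess over [d / 2] is halved at each step. *)
have d4 : 0 < d / 4 by rewrite divr_gt0.
move/cvgrPdist_le : (eps0) => /(_ _ d4) [N _ hN].
have h m : e (N + m)%N <= 2^-1 ^+ m * B + d / 2.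
  elim: m => [|m IH].
    rewrite addn0 expr0 mul1r; have /andP[_ h] := eB N; lra.
  rewrite addnS; apply: le_trans (es _) _.
  have := hN (N + m)%N (leq_addr _ _); rewrite sub0r normrN => h.
  have := ler_norm (eps (N + m)%N) => h'.
  rewrite exprS; lra.
have q : (2^-1 : R) ^+ m * B @[m --> \oo] --> 0.
  rewrite -(mul0r B); apply: cvgM; last exact: cvg_cst.
  by apply: cvg_expr; rewrite ger0_norm ?invr_ge0 // invf_lt1 // ltr1n.
have d2 : 0 < d / 2 by rewrite divr_gt0.
move/cvgrPdist_le : q => /(_ _ d2) [m _ hm].
exists (N + m)%N => // k /= Nk; rewrite sub0r normrN.
have /andP[e0 _] := eB k; rewrite ger0_norm //.
have hk : (m <= k - N)%N by rewrite leq_subRL // (leq_trans (leq_addr m N)).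
have := h (k - N)%N; rewrite subnKC ?(leq_trans (leq_addr m N)) //.
have := hm _ hk; rewrite sub0r normrN => h1 h2.
have := ler_norm (2^-1 ^+ (k - N) * B); lra.
Qed.

(* Indices of the monomials that must be absent from a system x = X(x, y, t): the others are
   at least quadratic in (x, y) or divisible by t. *)
Definition low_index (i : idx) := (i.2 == 0)%N && (i.1.1 + i.1.2 <= 1)%N.

(** Weighted homogeneity: [x] and [y] have weight 1 and [t] weight 2, on the region
    [|x|, |y| <= rho * eta], [|t| <= rho * eta ^+ 2]. A monomial outside [low_index] has weight at
    least 2 and gains [eta ^+ 2], against a size [rho * eta] of the region: for small [eta] the
    system maps the region into itself. *)
Lemma low_weight (eta rho : R) i : 0 <= eta <= 1 -> 0 <= rho -> ~~ low_index i ->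
  (rho * eta) ^+ (i.1.1 + i.1.2) * (rho * eta ^+ 2) ^+ i.2 <= eta ^+ 2 * rho ^+ tdeg i.
Proof.
move=> /andP[e0 e1] r0 hi; rewrite /tdeg (exprMn _ rho eta) (exprMn _ rho (eta ^+ 2)) -exprM [X in _ <= _ * X]exprD.
set a := (_ + _)%N in hi *; have -> : rho ^+ a * eta ^+ a * (rho ^+ i.2 * eta ^+ (2 * i.2)) =
   eta ^+ (a + 2 * i.2) * (rho ^+ a * rho ^+ i.2) by rewrite exprD; ring.
rewrite ler_wpM2r ?mulr_ge0 ?exprn_ge0 //; apply: ler_wiXn2l => //.
move: hi; rewrite /low_index -/a; case: (i.2) => [|n] /=; first by rewrite -ltnNge addn0.
by move=> _; rewrite mulnS addnA (leq_trans (leq_addl a 2)) // leq_addr.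
Qed.

(** The factor [a] produced by a Lipschitz estimate is at most [2 ^ a], which amounts to doubling
    [eta] in [low_weight]; hence the 4. *)
Lemma low_weight_lip (eta rho : R) i : 0 <= eta <= 2^-1 -> 0 <= rho -> ~~ low_index i ->
  (i.1.1 + i.1.2)%:R * (rho * eta) ^+ (i.1.1 + i.1.2) * (rho * eta ^+ 2) ^+ i.2
   <= 4 * eta ^+ 2 * rho ^+ tdeg i.
Proof.
move=> /andP[e0 e1] r0 hi.
have e20 : 0 <= 2 * eta by rewrite mulr_ge0.
have := @low_weight (2 * eta) rho i _ r0 hi; rewrite e20 /= => /(_ _).
have -> : 2 * eta <= 1 by lra.
move=> /(_ isT); rewrite [X in _ -> _ <= X * _](_ : _ = (2 * eta) ^+ 2); last ring.
apply: le_trans.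
set a := (_ + _)%N.
have le1 : a%:R * (rho * eta) ^+ a <= (rho * (2 * eta)) ^+ a.
  rewrite (_ : rho * (2 * eta) = 2 * (rho * eta)); last ring.
  rewrite [X in _ <= X]exprMn ler_wpM2r ?exprn_ge0 ?mulr_ge0 //.
  by rewrite -natrX ler_nat ltnW // ltn_expl.
apply: ler_pM => //; rewrite ?mulr_ge0 ?exprn_ge0 ?mulr_ge0 ?exprn_ge0 //.
rewrite lerXn2r ?nnegrE ?mulr_ge0 ?exprn_ge0 //.
rewrite ler_wpM2l // lerXn2r ?nnegrE //; lra.
Qed.

Lemma psum_low_lip X (M rho eta : R) x x' y y' t D k : 0 < rho -> 0 < eta <= 2^-1 ->
  tbound X rho M -> (forall i, low_index i -> X i = 0) ->
  `|x| <= rho * eta -> `|x'| <= rho * eta -> `|y| <= rho * eta -> `|y'| <= rho * eta ->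
  `|t| <= rho * eta ^+ 2 -> `|x - x'| <= D -> `|y - y'| <= D ->
  `|psumT X (tmono x y t) k - psumT X (tmono x' y' t) k| <= 4 * eta / rho * M * D.
Proof.
move=> r0 /andP[e0 e1] XM X0 xd xd' yd yd' td xD yD.
have D0 : 0 <= D by exact: le_trans xD.
have d0 : 0 < rho * eta by rewrite mulr_gt0.
have e01 : 0 <= eta <= 2^-1 by rewrite ltW.
rewrite -(@ler_pM2l _ (rho * eta)) // -sumrB.
have -> : rho * eta * (4 * eta / rho * M * D) = 4 * eta ^+ 2 * D * M.
  by field; rewrite gt_eqF.
apply: (@le_trans _ _ (4 * eta ^+ 2 * D * \sum_(i <- tbox k) `|X i| * rho ^+ tdeg i)); last first.
  by rewrite ler_wpM2l ?XM // mulr_ge0 // mulr_ge0 // exprn_ge0 // ltW.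
rewrite mulr_sumr; apply: (le_trans (ler_wpM2l (ltW d0) (ler_norm_sum _ _ _))).
rewrite mulr_sumr; apply: ler_sum => i _.
have [li|hi] := boolP (low_index i); first by rewrite X0 // !mul0r subr0 normr0 !mul0r !mulr0.
rewrite -mulrBr normrM /tmono -mulrBl normrM normrX.
have lip := @monom_lip _ _ _ _ _ _ i.1.1 i.1.2 xd xd' yd yd' xD yD.
have w := low_weight_lip e01 (ltW r0) hi.
have tn : `|t| ^+ i.2 <= (rho * eta ^+ 2) ^+ i.2.
  by rewrite lerXn2r ?nnegrE // mulr_ge0 ?exprn_ge0 ?ltW.
set A := `|_ - _| in lip *; set T := `|t| ^+ _ in tn *; set W := _ ^+ i.2 in tn w.
set P := _ ^+ (_ + _) in lip w; set n := _%:R in lip w; set Q := rho ^+ _ in w *.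
rewrite (_ : rho * eta * (`|X i| * (A * T)) = `|X i| * ((rho * eta * A) * T)); last by rewrite /P; ring.
rewrite (_ : 4 * eta ^+ 2 * D * (`|X i| * Q) = `|X i| * ((4 * eta ^+ 2 * Q) * D)); last by ring.
apply: ler_wpM2l => //.
apply: (@le_trans _ _ (n * P * D * W)).
  by apply: ler_pM => //; rewrite ?exprn_ge0 ?mulr_ge0 ?(ltW r0) ?(ltW e0) // /A.
rewrite (_ : n * P * D * W = (n * P * W) * D); last by ring.
by apply: ler_wpM2r.
Qed.

(** Picard iteration in which each step also truncates the system to a growing box, so that the
    iterates remain polynomials in [t]. *)
Fixpoint poly_iter (X Y : idx -> R) (k : nat) : {poly R} * {poly R} :=
  if k is k'.+1 then
    let pq := poly_iter X Y k' in
    let ev (Z : idx -> R) := \sum_(i <- tbox k') Z i *: (pq.1 ^+ i.1.1 * pq.2 ^+ i.1.2 * 'X ^+ i.2) in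
    (ev X, ev Y)
  else (0, 0).

Lemma poly_iter_horner X Y k t :
  (poly_iter X Y k.+1).1.[t] = psumT X (tmono (poly_iter X Y k).1.[t] (poly_iter X Y k).2.[t] t) k /\
  (poly_iter X Y k.+1).2.[t] = psumT Y (tmono (poly_iter X Y k).1.[t] (poly_iter X Y k).2.[t] t) k.
Proof.
by split; rewrite /= horner_sum; apply: eq_bigr => i _;
  rewrite hornerZ !hornerM !horner_exp hornerX.
Qed.

Lemma poly_iter_bound X Y (M rho eta : R) k : 0 < rho -> 0 < eta <= 1 -> eta * M <= rho ->
  tbound X rho M -> tbound Y rho M ->
  (forall i, low_index i -> X i = 0) -> (forall i, low_index i -> Y i = 0) ->
  nbound (fun n => (poly_iter X Y k).1`_n) (rho * eta ^+ 2) (rho * eta) /\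
  nbound (fun n => (poly_iter X Y k).2`_n) (rho * eta ^+ 2) (rho * eta).
Proof.
move=> r0 /andP[e0 e1] eM XM YM X0 Y0.
have d0 : 0 <= rho * eta by rewrite mulr_ge0 ?ltW.
have s0 : 0 <= rho * eta ^+ 2 by rewrite mulr_ge0 ?exprn_ge0 ?ltW.
have ev (Z : idx -> R) (p q : {poly R}) k' : tbound Z rho M -> (forall i, low_index i -> Z i = 0) ->
  nbound (fun n => p`_n) (rho * eta ^+ 2) (rho * eta) ->
  nbound (fun n => q`_n) (rho * eta ^+ 2) (rho * eta) ->
  nbound (fun n => (\sum_(i <- tbox k') Z i *: (p ^+ i.1.1 * q ^+ i.1.2 * 'X ^+ i.2))`_n)
     (rho * eta ^+ 2) (rho * eta).
  move=> ZM Z0 pb qb.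
  have h i : nbound (fun n => (Z i *: (p ^+ i.1.1 * q ^+ i.1.2 * 'X ^+ i.2))`_n) (rho * eta ^+ 2)
     (`|Z i| * ((rho * eta) ^+ i.1.1 * (rho * eta) ^+ i.1.2 * (rho * eta ^+ 2) ^+ i.2)).
    apply: nbound_poly_scale => //; apply: nbound_poly_mul => //; last first.
      by apply: nbound_poly_exp => //; exact: nbound_polyX.
    by apply: nbound_poly_mul => //; apply: nbound_poly_exp.
  move=> N; apply: le_trans (nbound_poly_sum _ s0 h N) _.
  apply: (@le_trans _ _ (eta ^+ 2 * M)); last first.
    by rewrite expr2 -mulrA mulrC ler_wpM2r // ltW.
  apply: le_trans (ler_wpM2l _ (ZM k')); last by rewrite exprn_ge0 // ltW.
  rewrite mulr_sumr; apply: ler_sum => i _.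
  have [li|hi] := boolP (low_index i); first by rewrite Z0 // normr0 !mul0r mulr0.
  rewrite [X in _ <= X]mulrCA ler_wpM2l // -exprD; apply: low_weight => //; last by rewrite ltW.
  by rewrite (ltW e0).
elim: k => [|k [IH1 IH2]] /=; first by split; exact: nbound_poly0.
by split; exact: ev.
Qed.

Lemma horner_nbound (p : {poly R}) (s M t : R) : nbound (fun n => p`_n) s M -> `|t| <= s -> `|p.[t]| <= M.
Proof.
move=> /nbound_ord /(_ (size p)) pM ts; rewrite horner_coef.
apply: (le_trans (ler_norm_sum _ _ _)); apply: le_trans pM; apply: ler_sum => i _.
rewrite normrM normrX ler_wpM2l // lerXn2r // nnegrE //; exact: le_trans ts.
Qed.

(** The series [a], [b] are extracted from the iterates without knowing whether these converge. At a
    [t] where a small solution [(x, y)] is given, the contraction forces the iterates to converge to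
    it, so the series sum to it. Existence of solutions is left to the application. *)
Lemma implicit_system X Y (M rho : R) : 0 < rho ->
  tbound X rho M -> tbound Y rho M ->
  (forall i, low_index i -> X i = 0) -> (forall i, low_index i -> Y i = 0) ->
  exists (s d : R) (a b : nat -> R), [/\ 0 < s, 0 < d, nbound a s d, nbound b s d &
   forall t x y, `|t| < s -> `|x| <= d -> `|y| <= d ->
     psumT X (tmono x y t) N @[N --> \oo] --> x ->
     psumT Y (tmono x y t) N @[N --> \oo] --> y ->
     psum nbox a (nmono t) N @[N --> \oo] --> x /\
     psum nbox b (nmono t) N @[N --> \oo] --> y].
Proof.
move=> r0 XM YM X0 Y0; have M0 : 0 <= M by exact: wbound_ge0 (ltW r0) XM.
(* The 16 makes the Lipschitz constant [4 * eta / rho * M] of each component at most 1/4, so that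
   the sum of the two errors contracts by 1/2. The same choice gives [eta * M <= rho], the
   invariance of the region. *)
pose eta := Num.min 2^-1 (rho / (16 * (M + 1))).
have M1 : 0 < 16 * (M + 1) by lra.
have e0 : 0 < eta by rewrite lt_min invr_gt0 ltr0n divr_gt0.
have e2 : eta <= 2^-1 by rewrite ge_min lexx.
have eM : eta * (16 * (M + 1)) <= rho.
  by rewrite -ler_pdivlMr // ge_min lexx orbT.
have eM' : eta * M <= rho.
  apply: le_trans eM; rewrite ler_wpM2l ?ltW //; lra.
have e1 : 0 < eta <= 1 by rewrite e0 /=; lra.
have e12 : 0 < eta <= 2^-1 by rewrite e0.
have d0 : 0 < rho * eta by rewrite mulr_gt0.
have s0 : 0 < rho * eta ^+ 2 by rewrite mulr_gt0 // exprn_gt0.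
have pb k := poly_iter_bound k r0 e1 eM' XM YM X0 Y0.
have [a [aM ag]] := poly_limit_series s0 (fun k => (pb k).1).
have [b [bM bg]] := poly_limit_series s0 (fun k => (pb k).2).
exists (rho * eta ^+ 2), (rho * eta), a, b; split=> // t x y ts xd yd Xx Yy.
pose p k := (poly_iter X Y k).1.[t]; pose q k := (poly_iter X Y k).2.[t].
have pd k : `|p k| <= rho * eta by apply: horner_nbound (pb k).1 _; exact: ltW.
have qd k : `|q k| <= rho * eta by apply: horner_nbound (pb k).2 _; exact: ltW.
pose e k : R := `|p k - x| + `|q k - y|.
(* The truncation error at the exact solution; it tends to 0 because [(x, y)] solves the full
   system. *)
pose eps k : R := `|psumT X (tmono x y t) k - x| + `|psumT Y (tmono x y t) k - y|.
have q0 : 4 * eta / rho * M <= 4^-1.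
  have -> : 4 * eta / rho * M = 4 * eta * M / rho by rewrite mulrAC.
  rewrite ler_pdivrMr //; lra.
have e_cvg : e k @[k --> \oo] --> 0.
  apply: (@contraction_error_cvg _ eps (4 * (rho * eta))).
  - move=> k; rewrite addr_ge0 //=.
    have := ler_normB (p k) x; have := ler_normB (q k) y.
    have := pd k; have := qd k; rewrite /e; lra.
  - move=> k; rewrite /e /eps.
    have hp : p k.+1 = psumT X (tmono (p k) (q k) t) k by exact: (poly_iter_horner X Y k t).1.
    have hq : q k.+1 = psumT Y (tmono (p k) (q k) t) k by exact: (poly_iter_horner X Y k t).2.
    have h1 : `|p k - x| <= e k by rewrite lerDl.
    have h2 : `|q k - y| <= e k by rewrite lerDr.
    have l1 := psum_low_lip k r0 e12 XM X0 (pd k) xd (qd k) yd (ltW ts) h1 h2.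
    have l2 := psum_low_lip k r0 e12 YM Y0 (pd k) xd (qd k) yd (ltW ts) h1 h2.
    have ek0 : 0 <= e k by rewrite addr_ge0.
    have := ler_wpM2r ek0 q0 => q0'.
    rewrite hp hq.
    have := ler_normD (psumT X (tmono (p k) (q k) t) k - psumT X (tmono x y t) k) (psumT X (tmono x y t) k - x).
    have := ler_normD (psumT Y (tmono (p k) (q k) t) k - psumT Y (tmono x y t) k) (psumT Y (tmono x y t) k - y).
    rewrite !subrKA; rewrite -/(e k); lra.
  - rewrite -(addr0 0); apply: cvgD.
      by apply/norm_cvg0P; apply/subr_cvg0.
    by apply/norm_cvg0P; apply/subr_cvg0.
have le_cvg0 (u v : nat -> R) : (forall k, `|u k| <= v k) -> v k @[k --> \oo] --> 0 -> u k @[k --> \oo] --> 0.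
  move=> uv v0; apply/norm_cvg0P; apply: (@squeeze_cvgr _ _ _ _ (fun=> 0) v) => //; last exact: cvg_cst.
  by apply: nearW => k; rewrite normr_ge0 uv.
split.
  apply: ag => //; apply/subr_cvg0; apply: le_cvg0 e_cvg => k.
  by rewrite /e lerDl.
apply: bg => //; apply/subr_cvg0; apply: le_cvg0 e_cvg => k.
by rewrite /e lerDr.
Qed.

End fixed_point.

(** * Critical points of a series in three variables *)

Section minimizer.
Context (R : realType).
Implicit Types (f : idx -> R) (x y t rho M s : R).

(** A tail bound for index sets other than boxes. Omitted terms may be negligible by degree, or
    because their monomial vanishes, as happens at [t = 0]. *)
Lemma sum_tail f (e : idx -> R) rho M s N K (S1 S2 : seq idx) : 0 < rho -> 0 <= s <= rho ->
  tbound f rho M -> (forall i, `|e i| <= s ^+ tdeg i) ->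
  uniq S1 -> uniq S2 -> {subset S1 <= S2} -> {subset S2 <= tbox N} ->
  (forall i, i \in S2 -> i \notin S1 -> e i = 0 \/ (K <= tdeg i)%N) ->
  `|\sum_(i <- S2) f i * e i - \sum_(i <- S1) f i * e i| <= M * (s / rho) ^+ K.
Proof.
move=> r0 /andP[s0 sr] fM es u1 u2 s12 s2N hK.
have q0 : 0 <= s / rho by rewrite divr_ge0 // ltW.
have q1 : s / rho <= 1 by rewrite ler_pdivrMr // mul1r.
have split (h : idx -> R) (A B : seq idx) : uniq A -> uniq B -> {subset A <= B} ->
    \sum_(i <- B) h i = \sum_(i <- A) h i + \sum_(i <- B | i \notin A) h i.
  move=> uA uB AB; rewrite (bigID (mem A)) /=; congr (_ + _).
  rewrite -big_filter; apply: perm_big; apply: uniq_perm => //.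
    by rewrite filter_uniq.
  by move=> i; rewrite mem_filter; apply/andP/idP => [[]//|iN]; split=> //; exact: AB.
rewrite (split _ S1 S2) // addrC addKr.
apply: (le_trans (ler_norm_sum _ _ _)).
apply: (@le_trans _ _ (\sum_(i <- S2 | i \notin S1) `|f i| * rho ^+ tdeg i * (s / rho) ^+ K)).
  rewrite big_seq_cond [X in _ <= X]big_seq_cond; apply: ler_sum => i /andP[i2 i1].
  rewrite normrM -mulrA ler_wpM2l //.
  have [->|h] := hK i i2 i1.
    by rewrite normr0 mulr_ge0 ?exprn_ge0 // ltW.
  apply: (le_trans (es i)).
  have {1}-> : s = rho * (s / rho) by rewrite mulrC divfK // gt_eqF.
  rewrite exprMn ler_wpM2l ?exprn_ge0 ?(ltW r0) //.
  by rewrite ler_wiXn2l.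
rewrite -mulr_suml ler_wpM2r ?exprn_ge0 //.
have pos i : 0 <= `|f i| * rho ^+ tdeg i by rewrite mulr_ge0 // exprn_ge0 // ltW.
apply: le_trans (fM N); rewrite (split _ S2 (tbox N)) ?tbox_uniq //.
apply: (@le_trans _ _ (\sum_(i <- S2) `|f i| * rho ^+ tdeg i)); last first.
  by rewrite lerDl sumr_ge0.
by rewrite (split _ S1 S2) // lerDr sumr_ge0.
Qed.

Lemma taylor2 f rho M x y s g : 0 < rho -> tbound f rho M -> `|x| <= s -> `|y| <= s -> s <= rho ->
  psum tbox f (tmono x y 0) N @[N --> \oo] --> g ->
  `|g - (f (0, 0, 0) + f (1, 0, 0) * x + f (0, 1, 0) * y +
     (f (2, 0, 0) * x ^+ 2 + f (1, 1, 0) * (x * y) + f (0, 2, 0) * y ^+ 2))|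
   <= M * (s / rho) ^+ 3.
Proof.
move=> r0 fM xs ys sr fg; have s0 : 0 <= s by exact: le_trans xs.
set P := (X in `|g - X|).
have h : `|psum tbox f (tmono x y 0) N - P| @[N --> \oo] --> `|g - P|.
  by apply: cvg_norm; apply: cvgB => //; exact: cvg_cst.
rewrite -(cvg_lim _ h) //; apply: limr_le; first by apply/cvg_ex; eexists; exact: h.
exists 3 => // N /= N3.
pose S1 : seq idx := [:: (0, 0, 0); (1, 0, 0); (0, 1, 0); (2, 0, 0); (1, 1, 0); (0, 2, 0)]%N.
have -> : P = \sum_(i <- S1) f i * tmono x y 0 i.
  rewrite /S1 !big_cons big_nil /tmono /= /P; ring.
apply: (@sum_tail _ _ _ _ _ N) => //.
- by rewrite s0.
- by move=> i; apply: tmono_le => //; rewrite normr0.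
- exact: tbox_uniq.
- move=> i; rewrite mem_tbox => iS.
  have : all (fun i : idx => [&& (i.1.1 < 3)%N, (i.1.2 < 3)%N & (i.2 < 3)%N]) S1 by [].
  by move=> /allP /(_ i iS) /and3P[a b c]; rewrite !(leq_trans _ N3).
- move=> [[j l] [|n]] _; last by move=> _; left; rewrite /tmono /= expr0n mulr0.
  rewrite /tdeg /= addn0 => iS; right; rewrite ltnNge; apply: contra iS.
  by case: j => [|[|[|j]]]; case: l => [|[|[|l]]].
Qed.

Lemma psum_at0 f rho M g : 0 < rho -> tbound f rho M ->
  psum tbox f (tmono 0 0 0) N @[N --> \oo] --> g -> g = f (0, 0, 0)%N.
Proof.
move=> r0 fM /(taylor2 r0 fM (s := 0)); rewrite normr0 lexx => /(_ isT isT (ltW r0)).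
have -> : M * (0 / rho) ^+ 3 = 0 by rewrite mul0r expr0n mulr0.
rewrite normr_le0 subr_eq0 => /eqP ->; ring.
Qed.

Lemma ge0_of_small (A C e0 : R) : 0 < e0 -> (forall e, 0 < e < e0 -> 0 <= A + C * e) -> 0 <= A.
Proof.
move=> e00 h; rewrite leNgt; apply/negP => A0.
pose e := Num.min (e0 / 2) (- A / (2 * (`|C| + 1))).
have C1 : 0 < 2 * (`|C| + 1) by rewrite mulr_gt0 // ltr_wpDl.
have ep : 0 < e by rewrite lt_min !divr_gt0 // oppr_gt0.
have ee0 : e < e0 by rewrite gt_min; apply/orP; left; lra.
have eC : e * (2 * (`|C| + 1)) <= - A by rewrite -ler_pdivlMr // ge_min lexx orbT.
have := h e; rewrite ep ee0 => /(_ isT).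
have : C * e <= `|C| * e by rewrite ler_wpM2r ?ler_norm // ltW.
have : 0 <= e * `|C| by rewrite mulr_ge0 // ltW.
lra.
Qed.

Definition quadform f (x y : R) :=
  f (2, 0, 0)%N * x ^+ 2 + f (1, 1, 0)%N * (x * y) + f (0, 2, 0)%N * y ^+ 2.

Lemma quadform_scale f e x y : quadform f (e * x) (e * y) = e ^+ 2 * quadform f x y.
Proof. rewrite /quadform; ring. Qed.

(** In the application [x] shifts the centre and [y] the half-length: [y <= x] moves the left
    endpoint inwards and [x + y <= 0] the right one. Each second-order inequality extends from its
    half-plane by evenness of [quadform], and the average of [(x - y) ^+ 2] and [(x + y) ^+ 2] is
    [x ^+ 2 + y ^+ 2]. *)
Lemma minimum_taylor f rho M rho' (k : R) (g : R -> R -> R) : 0 < rho -> 0 < k -> 0 < rho' <= rho ->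
  tbound f rho M ->
  (forall x y, `|x| < rho' -> `|y| < rho' ->
     psum tbox f (tmono x y 0) N @[N --> \oo] --> g x y) ->
  (forall x y, `|x| < rho' -> `|y| < rho' -> g 0 0 <= g x y) ->
  (forall x y, `|x| < rho' -> `|y| < rho' -> y <= x -> g 0 0 + k * (x - y) ^+ 2 <= g x y) ->
  (forall x y, `|x| < rho' -> `|y| < rho' -> x + y <= 0 -> g 0 0 + k * (x + y) ^+ 2 <= g x y) ->
  [/\ f (1, 0, 0)%N = 0, f (0, 1, 0)%N = 0 &
      forall x y, k * (x ^+ 2 + y ^+ 2) <= quadform f x y].
Proof.
move=> r0 k0 /andP[rp0 rpr] fM fg g0 gx gy.
have M0 : 0 <= M by exact: wbound_ge0 (ltW r0) fM.
have g00 : g 0 0 = f (0, 0, 0)%N by apply: (psum_at0 r0 fM); apply: fg; rewrite normr0.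
pose C := M / rho ^+ 3.
have tay x y e : `|x| <= 1 -> `|y| <= 1 -> 0 < e < rho' ->
  `|g (e * x) (e * y) - (g 0 0 + e * (f (1, 0, 0)%N * x + f (0, 1, 0)%N * y) + e ^+ 2 * quadform f x y)| <= C * e ^+ 3.
  move=> x1 y1 /andP[e0 er].
  have ex : `|e * x| <= e by rewrite normrM gtr0_norm // ler_piMr // ltW.
  have ey : `|e * y| <= e by rewrite normrM gtr0_norm // ler_piMr // ltW.
  have := taylor2 r0 fM ex ey (le_trans (ltW er) rpr) (fg _ _ (le_lt_trans ex er) (le_lt_trans ey er)).
  rewrite -/(quadform f (e * x) (e * y)) quadform_scale g00.
  rewrite [X in _ <= X -> _](_ : _ = C * e ^+ 3); last by rewrite /C expr_div_n mulrA mulrAC.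
  by congr (`|_ - _| <= _); ring.
have small x y e : `|x| <= 1 -> `|y| <= 1 -> 0 < e < rho' -> `|e * x| < rho' /\ `|e * y| < rho'.
  move=> x1 y1 /andP[e0 er]; rewrite !normrM gtr0_norm //; split; apply: le_lt_trans er;
  by rewrite ler_piMr // ltW.
have C0 : 0 <= C by rewrite /C divr_ge0 // exprn_ge0 // ltW.
have lin x y : `|x| <= 1 -> `|y| <= 1 -> 0 <= f (1, 0, 0)%N * x + f (0, 1, 0)%N * y.
  move=> x1 y1; apply: (@ge0_of_small _ (`|quadform f x y| + C * rho') rho') => // e er.
  have := tay x y e x1 y1 er; have [h1 h2] := small x y e x1 y1 er.
  have := g0 _ _ h1 h2; move: er => /andP[e0 er] gg /ler_normlP[_ hh].
  have e2 : 0 < e ^+ 2 by rewrite exprn_gt0.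
  rewrite -(pmulr_rge0 _ e0).
  have : e ^+ 2 * quadform f x y <= e ^+ 2 * `|quadform f x y|.
    by rewrite ler_wpM2l ?ler_norm // ltW.
  have : C * e ^+ 3 <= C * rho' * e ^+ 2.
    rewrite exprS mulrA ler_wpM2r ?(ltW e2) // ler_wpM2l // ltW //.
  lra.
have n1 : `|1 : R| <= 1 by rewrite normr1.
have nm1 : `|-1 : R| <= 1 by rewrite normrN normr1.
have n0 : `|0 : R| <= 1 by rewrite normr0.
have f1 : f (1, 0, 0)%N = 0.
  by have := lin 1 0 n1 n0; have := lin (-1) 0 nm1 n0; lra.
have f2 : f (0, 1, 0)%N = 0.
  by have := lin 0 1 n0 n1; have := lin 0 (-1) n0 nm1; lra.
split=> // x y.
have quad (u : R -> R -> R) x' y' : (forall e a b, u (e * a) (e * b) = e ^+ 2 * u a b) -> 0 <= u x' y' ->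
   (forall e, 0 < e -> `|e * x'| < rho' -> `|e * y'| < rho' -> g 0 0 + k * u (e * x') (e * y') <= g (e * x') (e * y')) ->
   k * u x' y' <= quadform f x' y'.
  move=> uh u0 hu.
  (* Rescaling into the unit ball, where [tay] applies; both sides are homogeneous of degree 2. *)
  pose m := `|x'| + `|y'| + 1.
  have m0 : 0 < m by rewrite ltr_wpDl // addr_ge0.
  have xm : `|x' / m| <= 1 by rewrite normrM normfV (gtr0_norm m0) ler_pdivrMr // mul1r /m; have := normr_ge0 y'; lra.
  have ym : `|y' / m| <= 1 by rewrite normrM normfV (gtr0_norm m0) ler_pdivrMr // mul1r /m; have := normr_ge0 x'; lra.
  have um a b : u (a / m) (b / m) = m ^- 2 * u a b.
    by rewrite -exprVn -uh ![_^-1 * _]mulrC.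
  have qm a b : quadform f (a / m) (b / m) = m ^- 2 * quadform f a b.
    by rewrite -exprVn -quadform_scale ![_^-1 * _]mulrC.
  have mm : 0 < m ^- 2 by rewrite invr_gt0 exprn_gt0.
  rewrite -(ler_pM2l mm) -qm mulrCA -um -subr_ge0.
  apply: (@ge0_of_small _ C rho') => // e er.
  have := tay _ _ e xm ym er; have [h1 h2] := small _ _ e xm ym er.
  move: er => /andP[e0 er] /ler_normlP[_ hh].
  have e2 : 0 < e ^+ 2 by rewrite exprn_gt0.
  have em : 0 < e / m by rewrite divr_gt0.
  have := hu (e / m) em.
  have ea a : e / m * a = e * (a / m) by rewrite mulrAC mulrA.
  rewrite !ea => /(_ h1 h2); rewrite uh => hk.
  rewrite -(pmulr_rge0 _ e2); move: hh; rewrite f1 f2.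
  rewrite [C * e ^+ 3](_ : _ = e ^+ 2 * (C * e)); last ring.
  lra.
have half x' y' : k * (x' - y') ^+ 2 <= quadform f x' y' /\ k * (x' + y') ^+ 2 <= quadform f x' y'.
  have even a b : quadform f (- a) (- b) = quadform f a b by rewrite /quadform; ring.
  split.
    wlog yx : x' y' / y' <= x'.
      move=> W; have [/W//|/ltW yx] := leP y' x'.
      have := W (- x') (- y'); rewrite lerN2 even => /(_ yx).
      by rewrite (_ : (- x' - - y') ^+ 2 = (x' - y') ^+ 2) //; ring.
    apply: (quad (fun a b => (a - b) ^+ 2)) => //.
    - by move=> e a b; ring.
    - by rewrite sqr_ge0.
    - by move=> e e0 h1 h2; apply: gx => //; rewrite ler_pM2l.
  wlog yx : x' y' / x' + y' <= 0.
    move=> W; have [/W//|/ltW yx] := leP (x' + y') 0.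
    have := W (- x') (- y'); rewrite even -opprD oppr_le0 => /(_ yx).
    by rewrite sqrrN.
  apply: (quad (fun a b => (a + b) ^+ 2)) => //.
  - by move=> e a b; ring.
  - by rewrite sqr_ge0.
  - by move=> e e0 h1 h2; apply: gy => //; rewrite -mulrDr pmulr_rle0.
have [h1 h2] := half x y.
have : k * (x - y) ^+ 2 + k * (x + y) ^+ 2 = 2 * (k * (x ^+ 2 + y ^+ 2)) by ring.
lra.
Qed.

Definition rbox (N1 N2 N : nat) : seq idx :=
  [seq (jl, n) | jl <- [seq (j, l) | j <- index_iota 0 N1, l <- index_iota 0 N2],
     n <- index_iota 0 N].

Lemma mem_rbox N1 N2 N i :
  (i \in rbox N1 N2 N) = [&& (i.1.1 < N1)%N, (i.1.2 < N2)%N & (i.2 < N)%N].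
Proof.
case: i => [[j l] n]; rewrite /rbox; apply/allpairsP/and3P => /=.
  case=> [[[j' l'] n']] /= [/allpairsP[[j'' l'']] /= []].
  by rewrite !mem_index_iota /= => jN lN [-> ->] nN [-> -> ->].
move=> [jN lN nN]; exists ((j, l), n); split=> //=; last by rewrite mem_index_iota.
by apply/allpairsP; exists (j, l); rewrite !mem_index_iota.
Qed.

Lemma rbox_uniq N1 N2 N : uniq (rbox N1 N2 N).
Proof.
apply: allpairs_uniq; rewrite ?iota_uniq //; last by move=> [a b] [c d] _ _ [-> ->].
apply: allpairs_uniq; rewrite ?iota_uniq //.
by move=> [a b] [c d] _ _ [-> ->].
Qed.

(** The enlarged box differs from box [N] only by terms of degree at least [N]. *)
Lemma rbox_cvg f (e : idx -> R) rho M s (g : R) N1 N2 : 0 < rho -> 0 <= s < rho ->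
  tbound f rho M -> (forall i, `|e i| <= s ^+ tdeg i) ->
  (forall N, N <= N1 N <= N.+1)%N -> (forall N, N <= N2 N <= N.+1)%N ->
  psum tbox f e N @[N --> \oo] --> g ->
  \sum_(i <- rbox (N1 N) (N2 N) N) f i * e i @[N --> \oo] --> g.
Proof.
move=> r0 /andP[s0 sr] fM es h1 h2 fg.
have q0 : 0 <= s / rho by rewrite divr_ge0 // ltW.
have h N : `|\sum_(i <- rbox (N1 N) (N2 N) N) f i * e i - psum tbox f e N| <= M * (s / rho) ^+ N.
  have /andP[a1 b1] := h1 N; have /andP[a2 b2] := h2 N.
  apply: (@sum_tail _ _ _ _ _ N.+1) => //.
  - by rewrite s0 ltW.
  - exact: tbox_uniq.
  - exact: rbox_uniq.
  - by move=> i; rewrite mem_tbox mem_rbox => /and3P[a b c]; rewrite (leq_trans a) // (leq_trans b).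
  - move=> i; rewrite mem_tbox mem_rbox => /and3P[a b c].
    by rewrite (leq_trans a) // (leq_trans b) //= ltnW.
  - by move=> i _ iN; right; exact: tbox_deg.
rewrite (_ : (fun _ => _) = (fun N => (\sum_(i <- rbox (N1 N) (N2 N) N) f i * e i - psum tbox f e N) + psum tbox f e N)); last by apply/funext => N; rewrite subrK.
rewrite -[X in _ --> X]add0r; apply: cvgD => //.
apply/norm_cvg0P; apply: (@squeeze_cvgr _ _ _ _ (fun=> 0) (fun N => M * (s / rho) ^+ N)).
- by apply: nearW => k; rewrite normr_ge0 h.
- exact: cvg_cst.
- rewrite -(mulr0 M); apply: cvgM; first exact: cvg_cst.
  by apply: cvg_expr; rewrite ger0_norm // ltr_pdivrMr // mul1r.
Qed.

(** The remainder is a polynomial with nonnegative coefficients divisible by [h ^+ 2], so it is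
    dominated by its value at [(X, eta)] times [(h / eta) ^+ 2]. The recurrence [DS] shows this
    without writing the coefficients. *)
Lemma expr_taylor1 (x h X eta : R) j : `|x| <= X -> `|h| <= eta -> 0 < eta ->
  `|(x + h) ^+ j - x ^+ j - j%:R * h * x ^+ j.-1| <= (h / eta) ^+ 2 * (X + eta) ^+ j.
Proof.
move=> xX he e0; have X0 : 0 <= X by exact: le_trans xX.
pose D (x h : R) j := (x + h) ^+ j - x ^+ j - j%:R * h * x ^+ j.-1.
have DS a b k : D a b k.+1 = (a + b) * D a b k + k%:R * b ^+ 2 * a ^+ k.-1.
  case: k => [|k]; rewrite /D /= ?expr0 ?expr1 -?natr1 ?exprS; ring.
have D0 a b : D a b 0%N = 0 by rewrite /D !expr0; ring.
have h2 : 0 <= (h / eta) ^+ 2 by rewrite sqr_ge0.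
have bnd k : 0 <= D X eta k /\ `|D x h k| <= (h / eta) ^+ 2 * D X eta k.
  elim: k => [|k [IH0 IH]]; first by rewrite !D0 normr0 mulr0.
  rewrite !DS; split.
    have Xe : 0 <= X + eta by rewrite addr_ge0 // ltW.
    rewrite addr_ge0 //; first exact: mulr_ge0.
    by rewrite !mulr_ge0 // ?exprn_ge0 // ltW.
  apply: (le_trans (ler_normD _ _)); rewrite [X in _ <= X]mulrDr; apply: lerD.
    rewrite normrM mulrCA; apply: ler_pM => //.
    by apply: (le_trans (ler_normD _ _)); apply: lerD.
  rewrite !normrM !normrX normr_nat.
  rewrite [X in _ <= X](_ : _ = k%:R * `|h| ^+ 2 * X ^+ k.-1); last first.
    rewrite real_normK ?num_real //; field; by rewrite gt_eqF.
  by rewrite ler_wpM2l ?mulr_ge0 ?exprn_ge0 // lerXn2r // nnegrE.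
apply: (le_trans (bnd j).2); rewrite ler_wpM2l // /D.
have : 0 <= X ^+ j by rewrite exprn_ge0.
have : 0 <= j%:R * eta * X ^+ j.-1 by rewrite !mulr_ge0 ?exprn_ge0 // ltW.
lra.
Qed.

Definition dx f (i : idx) : R := i.1.1.+1%:R * f (i.1.1.+1, i.1.2, i.2).
Definition dy f (i : idx) : R := i.1.2.+1%:R * f (i.1.1, i.1.2.+1, i.2).

Lemma sum_rboxx (h : idx -> R) N : \sum_(i <- rbox N.+1 N N) h i =
  \sum_(l < N) \sum_(n < N) h ((0%N, nat_of_ord l), nat_of_ord n) +
  \sum_(i <- tbox N) h (i.1.1.+1, i.1.2, i.2).
Proof.
rewrite sum_tbox /rbox big_allpairs big_allpairs big_nat_recl //; congr (_ + _).
  by rewrite big_mkord; apply: eq_bigr => l _; rewrite big_mkord.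
rewrite big_mkord; apply: eq_bigr => j _; rewrite big_mkord; apply: eq_bigr => l _.
exact: big_mkord.
Qed.

Lemma sub_rbox_tbox (h : idx -> R) N1 N2 N N' : (N1 <= N')%N -> (N2 <= N')%N -> (N <= N')%N ->
  (forall i, 0 <= h i) -> \sum_(i <- rbox N1 N2 N) h i <= \sum_(i <- tbox N') h i.
Proof.
move=> a b c h0.
have u : {subset rbox N1 N2 N <= tbox N'}.
  by move=> i; rewrite mem_tbox mem_rbox => /and3P[x y z]; rewrite !(leq_trans x, leq_trans y, leq_trans z).
rewrite [X in _ <= X](bigID (mem (rbox N1 N2 N))) /= -[X in X <= _]addr0; apply: lerD.
  rewrite -[X in _ <= X]big_filter le_eqVlt; apply/orP; left; apply/eqP; apply: perm_big; apply: uniq_perm => //.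
  - exact: rbox_uniq.
  - by rewrite filter_uniq // tbox_uniq.
  - move=> i; rewrite mem_filter; apply/idP/andP => [iN|[]//]; split=> //; exact: u.
by apply: sumr_ge0.
Qed.

Lemma natr_half_pow k m : (k <= m)%N -> k.+1%:R * (2^-1 : R) ^+ m <= 2.
Proof.
move=> km; rewrite exprVn ler_pdivrMr ?exprn_gt0 // -natrX -natrM ler_nat.
by rewrite mulnC -expnSr; apply: (leq_trans (ltnW (ltn_expl k.+1 (ltnSn 1)))); rewrite leq_exp2l.
Qed.

(** Halving the radius absorbs the factor brought down by differentiation. *)
Lemma dx_bound f rho M : 0 < rho -> tbound f rho M -> tbound (dx f) (rho / 2) (2 / rho * M).
Proof.
move=> r0 fM N.
have w i : `|dx f i| * (rho / 2) ^+ tdeg i <= 2 / rho * (`|f (i.1.1.+1, i.1.2, i.2)| * rho ^+ (tdeg i).+1).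
  rewrite /dx normrM normr_nat exprMn exprS.
  have := @natr_half_pow i.1.1 (tdeg i) _; rewrite {1}/tdeg -addnA leq_addr => /(_ isT).
  set A := 2^-1 ^+ _; set B := rho ^+ _; set F := `|_|; move=> h.
  rewrite (_ : _ * F * _ = (i.1.1.+1%:R * A) * (F * B)); last by ring.
  rewrite (_ : 2 / rho * _ = 2 * (F * B)); last by field; rewrite gt_eqF.
  apply: ler_wpM2r => //; apply: mulr_ge0; first exact: normr_ge0.
  by rewrite /B exprn_ge0 // ltW.
apply: (le_trans (ler_sum _ (fun i _ => w i))); rewrite -mulr_sumr ler_wpM2l ?divr_ge0 ?(ltW r0) //.
have := sum_rboxx (fun i => `|f i| * rho ^+ tdeg i) N.
have pos i : 0 <= `|f i| * rho ^+ tdeg i by rewrite mulr_ge0 // exprn_ge0 // ltW.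
have := sub_rbox_tbox (leqnn N.+1) (leqnSn N) (leqnSn N) pos => le1 e1.
apply: le_trans (fM N.+1); apply: le_trans le1; rewrite e1 /tdeg /= lerDr.
by apply: sumr_ge0 => j _; apply: sumr_ge0.
Qed.

Definition swapf f (i : idx) : R := f (i.1.2, i.1.1, i.2).

Lemma sum_tbox_swap (h : idx -> R) N :
  \sum_(i <- tbox N) h (i.1.2, i.1.1, i.2) = \sum_(i <- tbox N) h i.
Proof. by rewrite !sum_tbox exchange_big. Qed.

Lemma swapf_bound f rho M : tbound f rho M -> tbound (swapf f) rho M.
Proof.
move=> fM N; apply: le_trans (fM N); rewrite -[X in _ <= X]sum_tbox_swap /tdeg /=.
by rewrite ler_sum // => i _; rewrite [(i.1.2 + _)%N]addnC.
Qed.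

Lemma psum_swapf f x y t N : psum tbox (swapf f) (tmono y x t) N = psum tbox f (tmono x y t) N.
Proof.
rewrite /psum -[RHS]sum_tbox_swap; apply: eq_bigr => i _.
rewrite /swapf /tmono /=; ring.
Qed.

Lemma dy_bound f rho M : 0 < rho -> tbound f rho M -> tbound (dy f) (rho / 2) (2 / rho * M).
Proof. by move=> r0 fM; exact: swapf_bound (dx_bound r0 (swapf_bound fM)). Qed.

(* Summing over rbox N.+1 N N makes the derivative series in x an exact box sum. *)
Lemma stationary_x f rho M x y t (G : R -> R) e0 : 0 < rho -> 0 < e0 -> tbound f rho M ->
  `|x| <= rho / 4 -> `|y| <= rho / 4 -> `|t| <= rho / 4 ->
  (forall x', `|x' - x| < e0 -> psum tbox f (tmono x' y t) N @[N --> \oo] --> G x') ->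
  (forall x', `|x' - x| < e0 -> G x <= G x') ->
  psum tbox (dx f) (tmono x y t) N @[N --> \oo] --> 0.
Proof.
move=> r0 e00 fM xr yr tr fG Gmin.
have M0 : 0 <= M by exact: wbound_ge0 (ltW r0) fM.
have sum1 h N : \sum_(i <- rbox N.+1 N N) f i * tmono (x + h) y t i -
   \sum_(i <- rbox N.+1 N N) f i * tmono x y t i - h * psum tbox (dx f) (tmono x y t) N =
   \sum_(i <- rbox N.+1 N N) f i *
     (((x + h) ^+ i.1.1 - x ^+ i.1.1 - i.1.1%:R * h * x ^+ i.1.1.-1) * y ^+ i.1.2 * t ^+ i.2).
  have -> : h * psum tbox (dx f) (tmono x y t) N =
    \sum_(i <- rbox N.+1 N N) f i * (i.1.1%:R * h * x ^+ i.1.1.-1 * y ^+ i.1.2 * t ^+ i.2).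
    rewrite sum_rboxx /= big1 ?add0r => [|l _]; last by rewrite big1 // => n _; ring.
    rewrite /psum mulr_sumr; apply: eq_bigr => i _; rewrite /dx /tmono /=; ring.
  rewrite -!sumrB; apply: eq_bigr => i _; rewrite /tmono; ring.
pose C := (4 / rho) ^+ 2 * M.
have est h N : `|h| <= rho / 4 ->
   `|\sum_(i <- rbox N.+1 N N) f i * tmono (x + h) y t i -
   \sum_(i <- rbox N.+1 N N) f i * tmono x y t i - h * psum tbox (dx f) (tmono x y t) N| <= C * h ^+ 2.
  move=> hr; rewrite sum1; apply: (le_trans (ler_norm_sum _ _ _)).
  have r4 : 0 < rho / 4 by rewrite divr_gt0.
  have pos i : 0 <= `|f i| * rho ^+ tdeg i by rewrite mulr_ge0 // exprn_ge0 // ltW.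
  have := sub_rbox_tbox (leqnn N.+1) (leqnSn N) (leqnSn N) pos => le1.
  apply: (@le_trans _ _ ((h / (rho / 4)) ^+ 2 * \sum_(i <- rbox N.+1 N N) `|f i| * rho ^+ tdeg i)).
    rewrite mulr_sumr; apply: ler_sum => i _; rewrite normrM mulrCA ler_wpM2l //.
    rewrite !normrM !normrX.
    have -> : rho ^+ tdeg i = rho ^+ i.1.1 * rho ^+ i.1.2 * rho ^+ i.2 by rewrite /tdeg !exprD.
    have t1 := expr_taylor1 i.1.1 xr hr r4.
    have le4 : rho / 4 + rho / 4 <= rho by lra.
    have a1 : `|y| ^+ i.1.2 <= rho ^+ i.1.2 by rewrite lerXn2r ?nnegrE ?(ltW r0) //; lra.
    have a2 : `|t| ^+ i.2 <= rho ^+ i.2 by rewrite lerXn2r ?nnegrE ?(ltW r0) //; lra.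
    have a0 : (rho / 4 + rho / 4) ^+ i.1.1 <= rho ^+ i.1.1 by rewrite lerXn2r ?nnegrE ?(ltW r0) //; lra.
    rewrite mulrA; apply: ler_pM => //; rewrite ?mulr_ge0 ?exprn_ge0 //.
    rewrite mulrA; apply: ler_pM => //; rewrite ?exprn_ge0 //.
    by apply: le_trans t1 _; rewrite ler_wpM2l // sqr_ge0.
  rewrite (_ : C * h ^+ 2 = (h / (rho / 4)) ^+ 2 * M); last by rewrite /C; field; rewrite gt_eqF.
  by rewrite ler_wpM2l ?sqr_ge0 // (le_trans le1).
have C0 : 0 <= C by rewrite mulr_ge0 // sqr_ge0.
have rb x' : `|x'| <= rho / 2 -> `|x' - x| < e0 ->
   \sum_(i <- rbox N.+1 N N) f i * tmono x' y t i @[N --> \oo] --> G x'.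
  move=> xr' xe; apply: (@rbox_cvg _ _ _ _ (rho / 2) _ (fun N => N.+1) (fun N => N) r0 _ fM) => //.
  - apply/andP; split; lra.
  - by move=> i; apply: tmono_le => //; lra.
  - by move=> N; rewrite leqnn leqnSn.
  - by move=> N; rewrite leqnn leqnSn.
  - exact: fG.
apply/cvgrPdist_le => d d0.
(* A step small enough for the quadratic remainder [C * h ^+ 2] to stay below [d * h / 2]. *)
pose h := Num.min (e0 / 2) (Num.min (rho / 4) (d / (2 * (C + 1)))).
have C1 : 0 < 2 * (C + 1) by lra.
have h0 : 0 < h by rewrite !lt_min !divr_gt0.
have he : h < e0 by rewrite gt_min; apply/orP; left; lra.
have hr : h <= rho / 4 by rewrite !ge_min lexx orbT.
have hd : h * (2 * (C + 1)) <= d by rewrite -ler_pdivlMr // !ge_min lexx !orbT.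
have dh : 0 < d * h / 2 by rewrite divr_gt0 // mulr_gt0.
(* Minimality at [x + h'] for a fixed step, without taking a derivative: the steps [h] and [- h]
   together trap the partial sum between [- d] and [d]. *)
have ev h' : `|h'| = h -> \forall N \near \oo, - (d * h) <= h' * psum tbox (dx f) (tmono x y t) N.
  move=> hh'.
  have c1 : \sum_(i <- rbox N.+1 N N) f i * tmono (x + h') y t i -
     \sum_(i <- rbox N.+1 N N) f i * tmono x y t i @[N --> \oo] --> G (x + h') - G x.
    apply: cvgB; apply: rb.
    - apply: (le_trans (ler_normD _ _)); rewrite hh'; lra.
    - by rewrite addrC addKr hh'.
    - lra.
    - by rewrite subrr normr0.
  move/cvgrPdist_le : c1 => /(_ _ dh); apply: filterS => N /ler_normlP[_ c1].
  have := est h' N; rewrite hh' => /(_ hr) /ler_normlP[_ c2].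
  have gm : G x <= G (x + h') by apply: Gmin; rewrite addrC addKr hh'.
  have : C * h' ^+ 2 <= d * h / 2.
    rewrite -[h' ^+ 2](real_normK (num_real _)) hh' expr2.
    have := ler_wpM2r (ltW h0) hd; have := mulr_ge0 (ltW h0) (ltW h0); lra.
  lra.
have := ev h (gtr0_norm h0); have := ev (- h); rewrite normrN gtr0_norm // => /(_ erefl).
apply: filterS2 => N; set u := psum _ _ _ _; rewrite sub0r normrN => l1 l2.
rewrite ler_norml -(ler_pM2l h0) -[X in _ && X](ler_pM2l h0); apply/andP; split; lra.
Qed.

Lemma stationary_y f rho M x y t (G : R -> R) e0 : 0 < rho -> 0 < e0 -> tbound f rho M ->
  `|x| <= rho / 4 -> `|y| <= rho / 4 -> `|t| <= rho / 4 ->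
  (forall y', `|y' - y| < e0 -> psum tbox f (tmono x y' t) N @[N --> \oo] --> G y') ->
  (forall y', `|y' - y| < e0 -> G y <= G y') ->
  psum tbox (dy f) (tmono x y t) N @[N --> \oo] --> 0.
Proof.
move=> r0 e00 fM xr yr tr fG Gmin.
have := @stationary_x (swapf f) rho M y x t G e0 r0 e00 (swapf_bound fM) yr xr tr.
have fG' y' : `|y' - y| < e0 -> psum tbox (swapf f) (tmono y' x t) N @[N --> \oo] --> G y'.
  move=> ye; rewrite (_ : psum _ _ _ = psum tbox f (tmono x y' t)); first exact: fG.
  by apply/funext => N; exact: psum_swapf.
move=> /(_ fG' Gmin).
rewrite (_ : psum tbox (dx (swapf f)) (tmono y x t) = psum tbox (dy f) (tmono x y t)) //.
apply/funext => N; rewrite -[RHS]psum_swapf; apply: eq_bigr => i _.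
by rewrite /dx /swapf /dy.
Qed.

Lemma wboundD f g rho M1 M2 : 0 <= rho -> tbound f rho M1 -> tbound g rho M2 ->
  tbound (fun i => f i + g i) rho (M1 + M2).
Proof.
move=> r0 b1 b2 N; apply: le_trans (lerD (b1 N) (b2 N)).
rewrite -big_split /= ler_sum // => i _; rewrite -mulrDl ler_wpM2r ?exprn_ge0 //.
by rewrite ler_normD.
Qed.

Lemma wboundZ f rho M c : 0 <= rho -> tbound f rho M -> tbound (fun i => c * f i) rho (`|c| * M).
Proof.
move=> r0 b1 N; apply: le_trans (ler_wpM2l (normr_ge0 c) (b1 N)).
by rewrite mulr_sumr ler_sum // => i _; rewrite normrM mulrA.
Qed.

Lemma sum_tbox_delta (i0 : idx) (h : idx -> R) N : i0 \in tbox N ->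
  \sum_(i <- tbox N) (i == i0)%:R * h i = h i0.
Proof.
move=> iN; rewrite (bigD1_seq i0) ?tbox_uniq //= eqxx mul1r big1 ?addr0 //.
by move=> i /negPf ->; rewrite mul0r.
Qed.

Lemma delta_bound (i0 : idx) rho : 0 <= rho -> tbound (fun i => (i == i0)%:R) rho (rho ^+ tdeg i0).
Proof.
move=> r0 N; have [N0 h0] := tbox_all i0.
apply: (@le_trans _ _ (\sum_(i <- tbox (maxn N N0)) `|(i == i0)%:R| * rho ^+ tdeg i)).
  rewrite (sum_box_split tbox_uniq tbox_sub _ (leq_maxl N N0)) lerDl sumr_ge0 // => i _.
  by rewrite mulr_ge0 // exprn_ge0.
under eq_bigr do rewrite normr_nat.
by rewrite sum_tbox_delta // (tbox_sub (leq_maxr N N0)).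
Qed.

Lemma psum_delta (i0 : idx) (e : idx -> R) : psum tbox (fun i => (i == i0)%:R) e N @[N --> \oo] --> e i0.
Proof.
have [N0 h0] := tbox_all i0; apply: cvg_near_cst; exists N0 => // N /= NN.
by rewrite /psum sum_tbox_delta // (tbox_sub NN).
Qed.

(** The two conclusions serve separately: strict local minimality at [t = 0] feeds the uniqueness of
    the global minimizer, while the series describe every local minimizer near the origin for small
    [t] in [D]. *)
Lemma minimizer_series rho M (D : set R) (g : R -> R -> R -> R) (k rho' : R) :
  0 < rho -> 0 < k -> 0 < rho' <= rho -> D 0 -> tser rho M D g ->
  (forall x y, `|x| < rho' -> `|y| < rho' -> g 0 0 0 <= g x y 0) ->
  (forall x y, `|x| < rho' -> `|y| < rho' -> y <= x -> g 0 0 0 + k * (x - y) ^+ 2 <= g x y 0) ->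
  (forall x y, `|x| < rho' -> `|y| < rho' -> x + y <= 0 -> g 0 0 0 + k * (x + y) ^+ 2 <= g x y 0) ->
  (exists2 d, 0 < d & forall x y, `|x| < d -> `|y| < d -> (x != 0) || (y != 0) -> g 0 0 0 < g x y 0) /\
  exists s d M' a b, [/\ 0 < s, 0 < d, nbound a s M', nbound b s M' &
    forall t x y, D t -> `|t| < s -> `|x| <= d -> `|y| <= d ->
    (exists2 e, 0 < e & forall x' y', `|x' - x| < e -> `|y' - y| < e -> g x y t <= g x' y' t) ->
     psum nbox a (nmono t) N @[N --> \oo] --> x /\
     psum nbox b (nmono t) N @[N --> \oo] --> y].
Proof.
move=> r0 k0 rp D0 [f [fM fg]] g0 gx gy; have /andP[rp0 rpr] := rp.
have fg0 x y : `|x| < rho' -> `|y| < rho' -> psum tbox f (tmono x y 0) N @[N --> \oo] --> g x y 0.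
  by move=> h1 h2; apply: fg => //; rewrite ?normr0 // (lt_le_trans _ rpr).
have [f1 f2 Q] := minimum_taylor r0 k0 rp fM fg0 g0 gx gy.
have M0 : 0 <= M by exact: wbound_ge0 (ltW r0) fM.
split.
  pose C := M / rho ^+ 3.
  have C0 : 0 <= C by rewrite divr_ge0 // exprn_ge0 // ltW.
  have C1 : 0 < C + 1 by lra.
  (* Within this radius the cubic remainder [C * s ^+ 3] is smaller than the quadratic gain
     [k * s ^+ 2]. *)
  exists (Num.min rho' (k / (C + 1))); first by rewrite lt_min rp0 divr_gt0.
  move=> x y; rewrite !lt_min => /andP[xr xk] /andP[yr yk] xy0.
  pose s := Num.max `|x| `|y|.
  have s0 : 0 < s by rewrite lt_max !normr_gt0.
  have sk : s * (C + 1) < k by rewrite -ltr_pdivlMr // gt_max xk yk.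
  have xs : `|x| <= s by rewrite le_max lexx.
  have ys : `|y| <= s by rewrite le_max lexx orbT.
  have sr : s <= rho by rewrite ge_max !(le_trans (ltW _) rpr).
  have r00 : `|0 : R| < rho' by rewrite normr0.
  have := taylor2 r0 fM xs ys sr (fg0 _ _ xr yr).
  have g00 : g 0 0 0 = f (0, 0, 0)%N by apply: (psum_at0 r0 fM); exact: fg0.
  rewrite -/(quadform f x y) f1 f2 => /ler_normlP[h _].
  have := Q x y.
  have : s ^+ 2 <= x ^+ 2 + y ^+ 2.
    have h' (z : R) : z ^+ 2 = `|z| ^+ 2 by rewrite real_normK ?num_real.
    rewrite (h' x) (h' y) /s; case: (leP `|x| `|y|) => _; by rewrite ?lerDl ?lerDr exprn_ge0.
  have : M * (s / rho) ^+ 3 = C * s * s ^+ 2 by rewrite /C expr_div_n; field; rewrite gt_eqF.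
  have s2 : 0 < s ^+ 2 by rewrite exprn_gt0.
  have := ltr_pM2r s2 (s * (C + 1)) k; rewrite sk => s2k.
  have := ler_wpM2l (ltW k0) (lexx (x ^+ 2 + y ^+ 2)).
  move: h; rewrite g00; move: s2k; move=> + h _ eq ss q.
  have := ler_wpM2l (ltW k0) ss; have := mulr_gt0 s0 s2; lra.
(* [A], [B], [C] are the entries of the Hessian at the origin and [Dt] is its determinant. *)
pose A := 2 * f (2, 0, 0)%N; pose B := f (1, 1, 0)%N; pose C := 2 * f (0, 2, 0)%N.
pose Dt := C * A - B * B.
have A0 : 0 < A.
  have := Q 1 0; rewrite /quadform /A; lra.
have Dt0 : 0 < Dt.
  (* At the vector [(B, - A)] the form takes the value [A * Dt / 2], so its positivity gives that of
     the determinant. *)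
  have := Q B (- A); have -> : quadform f B (- A) = A * Dt / 2.
    by rewrite /quadform /Dt /A /B /C; field.
  move=> h; have : 0 < A * Dt / 2.
    apply: lt_le_trans h; rewrite mulr_gt0 // ltr_wpDl ?sqr_ge0 //.
    by rewrite sqrrN exprn_gt0.
  by rewrite pmulr_lgt0 ?invr_gt0 // pmulr_rgt0.
(* Newton's map with the Hessian frozen at the origin: its fixed points are the critical points, and
   its linear part in [(x, y)] vanishes, as [implicit_system] requires. *)
pose X i := (i == (1, 0, 0)%N)%:R + - Dt^-1 * (C * dx f i + - B * dy f i).
pose Y i := (i == (0, 1, 0)%N)%:R + - Dt^-1 * (A * dy f i + - B * dx f i).
have r2 : 0 <= rho / 2 by rewrite divr_ge0 // ltW.
have XM := wboundD r2 (delta_bound (1, 0, 0)%N r2) (wboundZ (- Dt^-1) r2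
   (wboundD r2 (wboundZ C r2 (dx_bound r0 fM)) (wboundZ (- B) r2 (dy_bound r0 fM)))).
have YM := wboundD r2 (delta_bound (0, 1, 0)%N r2) (wboundZ (- Dt^-1) r2
   (wboundD r2 (wboundZ A r2 (dy_bound r0 fM)) (wboundZ (- B) r2 (dx_bound r0 fM)))).
set M1 := (X in tbound _ _ X) in XM; set M2 := (X in tbound _ _ X) in YM.
have XM' : tbound X (rho / 2) (Num.max M1 M2).
  by move=> N; apply: le_trans (XM N) _; rewrite le_max lexx.
have YM' : tbound Y (rho / 2) (Num.max M1 M2).
  by move=> N; apply: le_trans (YM N) _; rewrite le_max lexx orbT.
have lowP (P : idx -> Prop) : P (0, 0, 0)%N -> P (1, 0, 0)%N -> P (0, 1, 0)%N -> forall i, low_index i -> P i.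
  move=> p0 p1 p2 [[j l] n]; rewrite /low_index /= => /andP[/eqP ->].
  by case: j => [|[|j]]; case: l => [|[|l]].
have Dn : Dt != 0 by rewrite gt_eqF.
have X0 : forall i, low_index i -> X i = 0.
  apply: lowP; rewrite /X /dx /dy /= ?f1 ?f2 -/B.
  - ring.
  - rewrite -/A -[1%:R * _]mul1r -/B /Dt; move: Dn; rewrite /Dt /A => Dn; field.
    by [].
  - move: Dn; rewrite /Dt /C => Dn; field; by [].
have Y0 : forall i, low_index i -> Y i = 0.
  apply: lowP; rewrite /Y /dx /dy /= ?f1 ?f2 -/B.
  - ring.
  - move: Dn; rewrite /Dt /A => Dn; field; by [].
  - move: Dn; rewrite /Dt /C => Dn; field; by [].
have r20 : 0 < rho / 2 by rewrite divr_gt0.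
have [s [d [a [b [s0 d0 aM bM ab]]]]] := implicit_system r20 XM' YM' X0 Y0.
pose s' := Num.min s (rho / 8); pose d' := Num.min d (rho / 8).
have r8 : 0 < rho / 8 by rewrite divr_gt0.
have ss : s' <= s by rewrite ge_min lexx.
have s'0 : 0 < s' by rewrite lt_min s0 r8.
have nweak (c : nat -> R) : nbound c s d -> nbound c s' d.
  move=> cM N; apply: le_trans (cM N); apply: ler_sum => i _.
  by rewrite ler_wpM2l // lerXn2r // nnegrE ltW.
exists s', d', d, a, b; split=> //.
- by rewrite lt_min d0 r8.
- exact: nweak.
- exact: nweak.
move=> t x y Dt' ; rewrite lt_min => /andP[ts tr]; rewrite !le_min => /andP[xd xr] /andP[yd yr] [e e0 mine].
have x4 : `|x| <= rho / 4 by clear -xr r8; lra.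
have y4 : `|y| <= rho / 4 by clear -yr r8; lra.
have t4 : `|t| <= rho / 4 by clear -tr r8; lra.
pose e' := Num.min e (rho / 2).
have e'0 : 0 < e' by rewrite lt_min e0 r20.
have near_lt (u v : R) : `|v| <= rho / 8 -> `|u - v| < e' -> `|u| < rho.
  rewrite lt_min => v8 /andP[_ uv]; have := ler_normD (u - v) v; rewrite subrK.
  clear -v8 uv r8; lra.
have lt_rho (u : R) : `|u| <= rho / 4 -> `|u| < rho by clear -r8; lra.
have sx : psum tbox (dx f) (tmono x y t) N @[N --> \oo] --> 0.
  apply: (@stationary_x f rho M x y t (fun x' => g x' y t) e') => //.
  - by move=> x' xe; apply: fg => //; [exact: near_lt xr xe | exact: lt_rho | exact: lt_rho].
  - by move=> x'; rewrite lt_min => /andP[xe _]; apply: mine => //; rewrite subrr normr0.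
have sy : psum tbox (dy f) (tmono x y t) N @[N --> \oo] --> 0.
  apply: (@stationary_y f rho M x y t (fun y' => g x y' t) e') => //.
  - by move=> y' ye; apply: fg => //; [exact: lt_rho | exact: near_lt yr ye | exact: lt_rho].
  - by move=> y'; rewrite lt_min => /andP[ye _]; apply: mine => //; rewrite subrr normr0.
have lin (i0 : idx) (c1 c2 c3 : R) :
    psum tbox (fun i => (i == i0)%:R + c1 * (c2 * dx f i + c3 * dy f i)) (tmono x y t) N @[N --> \oo] --> tmono x y t i0.
  rewrite (_ : psum _ _ _ = fun N => psum tbox (fun i => (i == i0)%:R) (tmono x y t) N +
     c1 * (c2 * psum tbox (dx f) (tmono x y t) N + c3 * psum tbox (dy f) (tmono x y t) N)); last first.
    apply/funext => N; rewrite /psum !mulr_sumr -big_split mulr_sumr -big_split /=.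
    by apply: eq_bigr => i _; ring.
  rewrite -[X in _ --> X]addr0 -[X in _ + X](mulr0 c1) -[X in _ * X](addr0 0) -[X in _ * (X + _)](mulr0 c2) -[X in _ * (_ + X)](mulr0 c3).
  apply: cvgD; first exact: psum_delta.
  apply: cvgM; first exact: cvg_cst.
  by apply: cvgD; apply: cvgM => //; exact: cvg_cst.
apply: ab => //.
  have := lin (1, 0, 0)%N (- Dt^-1) C (- B); rewrite /tmono /= expr1 !expr0 !mulr1; exact.
have := lin (0, 1, 0)%N (- Dt^-1) (- B) A; rewrite /tmono /= expr1 !expr0 mul1r mulr1.
rewrite (_ : (fun i => _ + _) = Y); first exact.
by apply/funext => i; rewrite /Y; congr (_ + _ * _); rewrite addrC.
Qed.

End minimizer.

(** * Variational inequalities *)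

Section measure_tools.
Local Open Scope ereal_scope.
Context d (T : measurableType d) (R : realType).

Lemma ge0_integral_mrestr (mu : {measure set T -> \bar R}) A (mA : measurable A) (f : T -> \bar R) :
  measurable_fun setT f -> (forall x, 0 <= f x) ->
  \int[mrestr mu mA]_x f x = \int[mu]_(x in A) f x.
Proof.
move=> mf f0.
rewrite -(setUv A) ge0_integral_setU //=.
- rewrite [X in _ + X](_ : _ = 0) ?adde0.
    by apply: eq_measure_integral => S mS SA; rewrite /= /mrestr setIidl.
  rewrite (@eq_measure_integral _ _ _ (~` A) mzero).
    by rewrite integral_measure_zero.
  move=> S mS SA; rewrite /= /mrestr /mzero; rewrite (_ : S `&` A = set0) ?measure0 //.
  by apply/seteqP; split => x //= [/SA].
- exact: measurableC.
- exact: measurable_funTS.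
- by apply/disj_setPS => x [].
Qed.

(** Supplies both kinds of competitor: convex combinations, with [A] the whole line, and
    conditioning on a set, with [p = 0]. The total mass is already 1; [mnormalize] only serves to
    view the sum as a probability. *)
Lemma mixture (mu nu : probability T R) A (mA : measurable A) (p q : R) :
  (0 <= p)%R -> (0 <= q)%R -> p%:E + q%:E * nu A = 1 ->
  exists m : probability T R, forall f : T -> \bar R,
    measurable_fun setT f -> (forall x, 0 <= f x) ->
    \int[m]_x f x = p%:E * \int[mu]_x f x + q%:E * \int[nu]_(x in A) f x.
Proof.
move=> p0 q0 pq1.
pose m0 : {measure set T -> \bar R} := measure_add (mscale (NngNum p0) mu) (mscale (NngNum q0) (mrestr nu mA)).
have m01 : m0 setT = 1.
  by rewrite /m0 /measure_add /= /msum !big_ord_recl big_ord0 /= /mscale /= /mrestr setTI probability_setT mule1 adde0.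
exists (mnormalize m0 mu) => f mf f0.
transitivity (\int[m0]_x f x).
  have e S : mnormalize m0 mu S = m0 S by rewrite /mnormalize m01 onee_eq0 /= invr1 mule1.
  by apply: eq_measure_integral => S mS _; exact: e.
rewrite /m0 ge0_integral_measure_add // !ge0_integral_mscale //=.
by rewrite ge0_integral_mrestr.
Qed.

(** Holds also when the integral is infinite. This lets the energy, whose kernel has no sign, be
    replaced by that of a nonnegative kernel for every competitor. *)
Lemma integral_shift (mu : probability T R) (f : T -> \bar R) (c : R) :
  measurable_fun setT f -> (forall x, 0 <= f x) ->
  \int[mu]_x (f x - c%:E) = \int[mu]_x f x - c%:E.
Proof.
move=> mf f0.
have mg : measurable_fun setT (fun x => f x - c%:E) by apply: emeasurable_funB.
have ic : mu.-integrable setT (cst c%:E) by apply: finite_measure_integrable_cst.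
have icst (r : R) : \int[mu]_x r%:E = r%:E.
  by transitivity (r%:E * mu setT); [exact: integral_cst | rewrite probability_setT mule1].
have [foo|] := ltP (\int[mu]_x f x) +oo.
  have fi : mu.-integrable setT f.
    by apply/integrableP; split => //; under eq_integral do rewrite gee0_abs //.
  by rewrite integralB // icst.
rewrite leye_eq => /eqP foo; rewrite foo addye //.
have n1 : \int[mu]_x ((fun x => f x - c%:E)^\- x) <= `|c|%:E.
  apply: (@le_trans _ _ (\int[mu]_x (cst `|c|%:E x))).
    apply: ge0_le_integral => //; first exact: measurable_funeneg.
    move=> x _; rewrite funenegE ge_max; apply/andP; split; last by rewrite lee_fin.
    rewrite fin_num_oppeB // addeC; apply: (@le_trans _ _ c%:E).
      by rewrite -[leRHS]adde0 leeD2l // leeNl oppe0.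
    by rewrite lee_fin ler_norm.
  by rewrite icst.
have p1 : \int[mu]_x ((fun x => f x - c%:E)^\+ x) = +oo.
  apply/eqP; rewrite -leye_eq -foo.
  have : \int[mu]_x f x <= \int[mu]_x ((fun x => f x - c%:E)^\+ x + cst `|c|%:E x).
    apply: ge0_le_integral => //.
      by apply: emeasurable_funD => //; exact: measurable_funepos.
    move=> x _; rewrite -[leLHS](@subeK _ _ c%:E) //.
    apply: leeD; first by rewrite funeposE le_max lexx.
    by rewrite /= lee_fin ler_norm.
  rewrite ge0_integralD //; [|exact: measurable_funepos|by move=> x _; rewrite lee_fin].
  rewrite icst foo; set I := \int[mu]_x _.
  by case: I => // r; rewrite leye_eq.
rewrite integralE p1 addye //.
by move: n1; set I := \int[mu]_x _; case: I.
Qed.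

End measure_tools.

(** * The logarithmic kernel *)

Section kernel.
Context (R : realType).
Implicit Types (x y z : R).

Definition nlog x : \bar R := if x == 0 then +oo%E else (- ln `|x|)%:E.

Lemma nlogN x : nlog (- x) = nlog x.
Proof. by rewrite /nlog oppr_eq0 normrN. Qed.

Lemma energy_kernelE (V : R -> R) x y :
  energy_kernel V x y = (nlog (x - y) + (V x / 2 + V y / 2)%:E)%E.
Proof.
rewrite /energy_kernel /nlog subr_eq0; case: ifP => // _.
by rewrite -EFinD addrA.
Qed.

(** From [|x - y| <= (1 + |x|) * (1 + |y|)]: the variables separate, so that the growth of [V] can
    compensate. *)
Lemma nlog_ge x y : ((- (ln (1 + `|x|) + ln (1 + `|y|)))%:E <= nlog (x - y)%R)%E.
Proof.
have p (z : R) : 0 < 1 + `|z| by rewrite ltr_pwDl.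
rewrite /nlog; case: ifPn => [_|xy]; first by rewrite leey.
rewrite lee_fin lerN2 -lnM ?posrE // ler_ln ?posrE ?normr_gt0 ?mulr_gt0 //.
apply: (le_trans (ler_normB _ _)).
have := mulr_ge0 (normr_ge0 x) (normr_ge0 y); lra.
Qed.

Lemma measurable_nlog : measurable_fun setT nlog.
Proof.
apply: measurable_fun_ifT => //.
  by apply: measurable_fun_eqr.
apply/measurable_EFinP; apply: measurableT_comp => //.
apply: measurableT_comp; first exact: measurable_ln.
exact: normr_measurable.
Qed.

End kernel.

(** * Energies with a nonnegative kernel and the first variation *)

Section potential.
Context (R : realType) (V : R -> R) (B : R).
Hypothesis cV : continuous V.
Hypothesis VB : forall x, 4 * ln (1 + `|x|) - B <= V x.
Local Open Scope ereal_scope.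

(** The shift by [B] makes the kernel nonnegative, so that Tonelli applies without integrability
    conditions. The 4 in [VB] leaves [ln (1 + |x|) + ln (1 + |y|)] to spare in [kerK_ge], which will
    confine the equilibrium measure. *)
Definition kerK (x y : R) : \bar R := energy_kernel V x y + B%:E.
Implicit Types mu nu : probability R R.

Lemma kerK_ge (x y : R) : (ln (1 + `|x|) + ln (1 + `|y|))%:E <= kerK x y.
Proof.
rewrite /kerK energy_kernelE.
apply: (@le_trans _ _ ((- (ln (1 + `|x|) + ln (1 + `|y|)))%:E + (V x / 2 + V y / 2)%:E + B%:E)).
  rewrite -!EFinD lee_fin; have := VB x; have := VB y; lra.
by apply: leeD => //; apply: leeD => //; exact: nlog_ge.
Qed.

Lemma ln1D_ge0 (x : R) : (0 <= ln (1 + `|x|))%R.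
Proof. by rewrite ln_ge0 // lerDl. Qed.

Lemma kerK_ge0 (x y : R) : 0 <= kerK x y.
Proof. by apply: le_trans (kerK_ge x y); rewrite lee_fin addr_ge0 // ln1D_ge0. Qed.

Lemma kerK_sym (x y : R) : kerK x y = kerK y x.
Proof. by rewrite /kerK !energy_kernelE -nlogN opprB [(V x / 2 + _)%R]addrC. Qed.

Lemma measurable_V : measurable_fun setT V.
Proof. exact: continuous_measurable_fun. Qed.

Lemma measurable_kerK2 : measurable_fun setT (fun p : R * R => kerK p.1 p.2).
Proof.
rewrite /kerK; apply: emeasurable_funD => //.
rewrite (_ : (fun _ => _) = fun p : R * R => nlog (p.1 - p.2)%R + (V p.1 / 2 + V p.2 / 2)%:E).
  apply: emeasurable_funD.
    apply: measurableT_comp; first exact: measurable_nlog.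
    by apply: measurable_funB; [exact: measurable_fst|exact: measurable_snd].
  apply/measurable_EFinP; apply: measurable_funD; apply: measurable_funM => //.
    by apply: measurableT_comp; [exact: measurable_V|exact: measurable_fst].
  by apply: measurableT_comp; [exact: measurable_V|exact: measurable_snd].
by apply/funext => p; rewrite energy_kernelE.
Qed.

Lemma measurable_kerKl (x : R) : measurable_fun setT (kerK x).
Proof. exact: (measurableT_comp measurable_kerK2 (pair1_measurable x)). Qed.

Definition potK mu (x : R) : \bar R := \int[mu]_y kerK x y.
Definition enK mu nu : \bar R := \int[mu]_x \int[nu]_y kerK x y.

Lemma measurable_potK mu : measurable_fun setT (potK mu).
Proof. exact: (measurable_fun_fubini_tonelli_F _ measurable_kerK2 (fun p => kerK_ge0 p.1 p.2)). Qed.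

Lemma potK_ge0 mu x : 0 <= potK mu x.
Proof. by apply: integral_ge0 => y _; exact: kerK_ge0. Qed.

Lemma enK_ge0 mu nu : 0 <= enK mu nu.
Proof. by apply: integral_ge0 => x _; exact: potK_ge0. Qed.

Lemma enK_sym mu nu : enK mu nu = enK nu mu.
Proof.
have := @fubini_tonelli _ _ _ _ R mu nu _ measurable_kerK2 (fun p => kerK_ge0 p.1 p.2).
rewrite /enK /= => ->; apply: eq_integral => x _; apply: eq_integral => y _.
exact: kerK_sym.
Qed.

Lemma energyE mu : energy V mu = enK mu mu - B%:E.
Proof.
rewrite /energy /enK -(@integral_shift _ _ _ mu _ B (measurable_potK mu)); last exact: potK_ge0.
apply: eq_integral => x _; rewrite /potK -integral_shift.
- by apply: eq_integral => y _; rewrite /kerK addeK.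
- exact: measurable_kerKl.
- by move=> y; exact: kerK_ge0.
Qed.

Lemma equilibrium_enK mu nu : is_equilibrium_measure V mu -> enK mu mu <= enK nu nu.
Proof. by move=> /(_ nu); rewrite !energyE leeD2rE. Qed.

Lemma fubini_kerK mu nu : \int[nu]_x potK mu x = \int[mu]_y potK nu y.
Proof. exact: enK_sym. Qed.

(** First variation: the right-hand side is the energy of [(1 - e) mu + e nu]; divide by [e] and let
    [e] tend to 0. Only the cross energy [C] may be infinite. *)
Lemma lee_ge0_quadratic (E C W : \bar R) : 0 <= E -> E < +oo -> 0 <= C -> 0 <= W -> W < +oo ->
  (forall e : R, (0 < e < 1)%R ->
     E <= (1 - e)%:E * ((1 - e)%:E * E + e%:E * C) + e%:E * ((1 - e)%:E * C + e%:E * W)) ->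
  E <= C.
Proof.
case: E => [E| |] // E0 _; case: C => [C| |] // C0; last by rewrite leey.
case: W => [W| |] // W0 _ h; rewrite lee_fin -subr_ge0.
have h' e : (0 < e < 1 -> 0 <= 2 * (C - E) + (E + W - 2 * C) * e)%R.
  move=> e01; have /andP[e0 e1] := e01; have := h e e01.
  rewrite -?EFinM -?EFinD -?EFinM -?EFinD lee_fin => hh.
  by rewrite -(pmulr_rge0 _ e0); lra.
rewrite leNgt; apply/negP => CE.
pose m := (1 + `|E + W - 2 * C|)%R.
have m0 : (0 < m)%R by rewrite ltr_pwDl.
pose e := (Num.min (1 / 2) ((E - C) / m))%R.
have e0 : (0 < e)%R by rewrite lt_min !divr_gt0 //; lra.
have e1 : (e < 1)%R by rewrite gt_min; apply/orP; left; lra.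
have em : (e * m <= E - C)%R by rewrite -ler_pdivlMr // ge_min lexx orbT.
have := h' e; rewrite e0 e1 => /(_ isT).
have : ((E + W - 2 * C) * e <= `|E + W - 2 * C| * e)%R by rewrite ler_wpM2r ?ler_norm // ltW.
move: em; rewrite /m; lra.
Qed.

Lemma equilibrium_potK mu nu : is_equilibrium_measure V mu ->
  enK mu mu < +oo -> enK nu nu < +oo -> enK mu mu <= enK nu mu.
Proof.
move=> eq Ef Wf.
apply: (lee_ge0_quadratic (enK_ge0 mu mu) Ef (enK_ge0 nu mu) (enK_ge0 nu nu) Wf) => e /andP[e0 e1].
have p0 : (0 <= 1 - e)%R by lra.
have pq : (1 - e)%:E + e%:E * nu setT = 1.
  by rewrite probability_setT mule1 -EFinD subrK.
have [m mP] := @mixture _ _ _ mu nu _ measurableT _ _ p0 (ltW e0) pq.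
apply: le_trans (equilibrium_enK m eq) _.
have pm x : potK m x = (1 - e)%:E * potK mu x + e%:E * potK nu x.
  by rewrite /potK mP //; [exact: measurable_kerKl | move=> y; exact: kerK_ge0].
have ip (la : probability R R) : \int[la]_x potK m x = (1 - e)%:E * enK la mu + e%:E * enK la nu.
  under eq_integral do rewrite pm.
  rewrite ge0_integralD //.
  - rewrite !ge0_integralZl //; try exact: measurable_potK; try by move=> ? _; exact: potK_ge0.
    by rewrite lee_fin ltW.
  - by move=> x _; rewrite mule_ge0 ?lee_fin // potK_ge0.
  - by apply: measurable_funeM; exact: measurable_potK.
  - by move=> x _; rewrite mule_ge0 ?lee_fin ?(ltW e0) // potK_ge0.
  - by apply: measurable_funeM; exact: measurable_potK.
rewrite /enK -/(potK m) mP; [|exact: measurable_potK|exact: potK_ge0].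
by rewrite -/(enK mu m) -/(enK nu m) /enK -!/(potK m _) !ip (enK_sym mu nu).
Qed.

(** Apply [equilibrium_potK] to [nu] conditioned on [A], whose energy is at most that of [nu]
    divided by the square of [nu A]. *)
Lemma equilibrium_potK_on mu nu A : is_equilibrium_measure V mu ->
  enK mu mu < +oo -> enK nu nu < +oo -> measurable A ->
  enK mu mu * nu A <= \int[nu]_(x in A) potK mu x.
Proof.
move=> eq Ef Wf mA.
have [A0|A0] := eqVneq (nu A) 0.
  by rewrite A0 mule0; apply: integral_ge0 => x _; exact: potK_ge0.
have Af : nu A \is a fin_num by exact: fin_num_measure.
pose b := fine (nu A).
have bE : nu A = b%:E by rewrite fineK.
have b0 : (0 < b)%R by rewrite -lte_fin -bE lt0e A0 measure_ge0.
have pq : (0 : R)%:E + (b^-1)%:E * nu A = 1.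
  by rewrite bE add0e -EFinM mulVf // gt_eqF.
have bi0 : (0 <= b^-1)%R by rewrite invr_ge0 ltW.
have [m mP] := @mixture _ _ _ mu nu _ mA _ _ (lexx 0%R) bi0 pq.
have mle (f : R -> \bar R) : measurable_fun setT f -> (forall x, 0 <= f x) ->
    \int[m]_x f x <= (b^-1)%:E * \int[nu]_x f x.
  move=> mf f0; rewrite mP // mul0e add0e lee_wpmul2l ?lee_fin //.
  apply: ge0_subset_integral => //.
have mf : enK m m < +oo.
  have h1 x : potK m x <= (b^-1)%:E * potK nu x.
    by apply: mle; [exact: measurable_kerKl | move=> y; exact: kerK_ge0].
  apply: (@le_lt_trans _ _ ((b^-1)%:E * ((b^-1)%:E * enK nu nu))).
    apply: (@le_trans _ _ (\int[m]_x ((b^-1)%:E * potK nu x))).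
      apply: ge0_le_integral => //; try exact: measurable_potK.
      - by move=> x _; exact: potK_ge0.
      - by apply: measurable_funeM; exact: measurable_potK.
      - by move=> x _; exact: h1.
    rewrite ge0_integralZl //; try exact: measurable_potK; try by move=> ? _; exact: potK_ge0.
    rewrite lee_wpmul2l ?lee_fin //; apply: mle; first exact: measurable_potK.
    exact: potK_ge0.
  by rewrite muleA -EFinM lte_mul_pinfty // lee_fin mulr_ge0.
have := equilibrium_potK eq Ef mf.
rewrite /enK -/(potK mu) mP; [|exact: measurable_potK|exact: potK_ge0].
rewrite mul0e add0e -/(enK mu mu) bE => h.
rewrite muleC -lee_pdivlMl //.
Qed.

End potential.

(** * Lower semicontinuity of potentials *)

Section continuity.
Context (R : realType).
Local Open Scope ereal_scope.

Lemma nlog_cvg (u : nat -> R) (l : R) : u n @[n --> \oo] --> l -> nlog (u n) @[n --> \oo] --> nlog l.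
Proof.
move=> ul; have [l0|l0] := eqVneq l 0%R.
  rewrite l0 in ul *.
  rewrite [nlog 0]/nlog eqxx; apply/cvgeyPge => M.
  move/cvgrPdist_lt : (ul) => /(_ (expR (- M)) (expR_gt0 _)); apply: filterS => n.
  have [->|un0] := eqVneq (u n) 0%R; first by rewrite /nlog eqxx leey.
  rewrite sub0r normrN => h; rewrite /nlog (negPf un0) lee_fin lerNr -(expRK (- M)%R).
  by rewrite ler_ln ?posrE ?normr_gt0 ?expR_gt0 // ltW.
have ll : (0 < `|l|)%R by rewrite normr_gt0.
have un0 : \forall n \near \oo, u n != 0%R.
  move/cvgrPdist_lt : (ul) => /(_ _ ll); apply: filterS => n h.
  by apply: contraTN h => /eqP ->; rewrite subr0 ltxx.
rewrite [nlog l]/nlog (negPf l0); apply: cvg_EFin.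
  by apply: filterS un0 => n n0; rewrite /nlog (negPf n0).
have h : (- ln `|u n|)%R @[n --> \oo] --> (- ln `|l|)%R.
  apply: cvgN; apply: continuous_cvg; first exact: continuous_ln.
  exact: cvg_norm.
apply: cvg_trans h; apply: near_eq_cvg.
by apply: filterS un0 => n n0; rewrite /= /nlog (negPf n0).
Qed.

Lemma limn_einf_le (u : nat -> \bar R) c : (forall n, u n <= c) -> limn_einf u <= c.
Proof.
move=> uc; rewrite limn_einf_lim; apply: lime_le; first exact: is_cvg_einfs.
apply: nearW => n; apply: le_trans (uc n); apply: ereal_inf_lbound.
by exists n => /=.
Qed.

Variables (V : R -> R) (B : R).
Hypothesis cV : continuous V.
Hypothesis VB : (forall x, 4 * ln (1 + `|x|) - B <= V x)%R.
Implicit Types mu nu : probability R R.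

Lemma kerK_cvg (u : nat -> R) (x y : R) : u n @[n --> \oo] --> x ->
  kerK V B (u n) y @[n --> \oo] --> kerK V B x y.
Proof.
move=> ux; rewrite /kerK energy_kernelE; under eq_fun do rewrite energy_kernelE.
have h1 : nlog (u n - y)%R @[n --> \oo] --> nlog (x - y)%R.
  by apply: nlog_cvg; apply: cvgB => //; exact: cvg_cst.
have h2 : (V (u n) / 2 + V y / 2)%:E @[n --> \oo] --> (V x / 2 + V y / 2)%:E.
  apply: cvg_EFin; first exact: nearW.
  apply: cvgD; last exact: cvg_cst.
  apply: cvgM; last exact: cvg_cst.
  by apply: continuous_cvg => //; exact: cV.
apply: cvgeD; [exact: fin_num_adde_defl | | exact: cvg_cst].
by apply: cvgeD => //; exact: fin_num_adde_defl.
Qed.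

(** Fatou along a sequence that violates the claim, the kernel being continuous in its first
    argument as an extended real function. *)
Lemma potK_lsc mu (x : R) (c : \bar R) : c < potK V B mu x ->
  exists2 e : R, (0 < e)%R & forall y : R, (`|y - x| < e)%R -> c < potK V B mu y.
Proof.
move=> cx; apply: contrapT => /forall2NP h.
have /choice[u uP] (n : nat) : exists y : R, (`|y - x| < n.+1%:R^-1)%R /\ potK V B mu y <= c.
  have [|] := h n.+1%:R^-1%R; first by rewrite invr_gt0 ltr0n.
  by move=> /existsNP[y /not_implyP[yx /negP]]; rewrite -leNgt => yc; exists y.
have ux : u n @[n --> \oo] --> x.
  apply/cvgrPdist_lt => e e0; have := near_infty_natSinv_lt (PosNum e0).
  apply: filterS => n /= ne; rewrite distrC; exact: lt_trans (uP n).1 ne.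
have := fatou mu measurableT (f := fun n => kerK V B (u n)).
move=> /(_ (fun n => measurable_kerKl B cV (u n)) (fun n y _ => kerK_ge0 VB (u n) y)).
apply/negP; rewrite -ltNge; apply: (@le_lt_trans _ _ c).
  by apply: limn_einf_le => n; exact: (uP n).2.
rewrite (_ : (fun y => _) = kerK V B x) //.
apply/funext => y; have k := @kerK_cvg u x y ux.
by rewrite (is_cvg_limn_einfE (cvgP _ k)); exact: cvg_lim.
Qed.

(** If the potential exceeded the energy at a point of the support of [nu], it would do so by a
    margin on a neighbourhood of positive [nu]-mass, and [equilibrium_potK_on] forbids compensation
    elsewhere. The second measure [nu] will be the arcsine measure of another minimizing
    interval. *)
Lemma potK_le_support mu nu (x : R) : is_equilibrium_measure V mu ->
  enK V B mu mu < +oo -> enK V B nu nu < +oo -> enK V B nu mu <= enK V B mu mu ->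
  msupport nu x -> potK V B mu x <= enK V B mu mu.
Proof.
move=> eq Ef Wf nE nx; rewrite leNgt; apply/negP => Ex.
have Efin : enK V B mu mu \is a fin_num by rewrite ge0_fin_numE // enK_ge0.
have [c Ec cx] : exists2 c : R, enK V B mu mu < c%:E & c%:E < potK V B mu x.
  rewrite -(fineK Efin) in Ex *; set E := fine _ in Ex *.
  case: (potK V B mu x) Ex => [p| |] //.
    by rewrite lte_fin => Ep; exists ((E + p) / 2)%R; rewrite lte_fin; lra.
  by move=> _; exists (E + 1)%R; rewrite ?ltry // lte_fin ltrDl.
have [e e0 he] := potK_lsc cx.
pose N := `](x - e)%R, (x + e)%R[%classic.
have mN : measurable (N : set R) by exact: measurable_itv.
have N0 : 0 < nu N by exact: nx.
have h1 : c%:E * nu N <= \int[nu]_(y in N) potK V B mu y.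
  rewrite -(@integral_cst _ _ _ nu) //; apply: ge0_le_integral => //.
  - move=> y _; rewrite lee_fin -lee_fin; apply: le_trans (ltW Ec); exact: enK_ge0.
  - by apply: measurable_funTS; exact: measurable_potK.
  - move=> y; rewrite /N /= in_itv /= => yN; apply: ltW; apply: he.
    by rewrite ltr_norml; lra.
have h2 := equilibrium_potK_on cV VB eq Ef Wf (measurableC mN).
have split : enK V B nu mu = \int[nu]_(y in N) potK V B mu y + \int[nu]_(y in ~` N) potK V B mu y.
  rewrite /enK -/(potK V B mu) -{1}(setUv N) ge0_integral_setU //.
  - exact: measurableC.
  - by apply: measurable_funTS; exact: measurable_potK.
  - by move=> y _; exact: potK_ge0.
  - by apply/disj_setPS => y [].
have : enK V B mu mu < enK V B mu mu; last by rewrite ltxx.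
apply: lt_le_trans nE; rewrite split.
apply: (@lt_le_trans _ _ (c%:E * nu N + enK V B mu mu * nu (~` N))); last exact: leeD.
have Nf : nu N \is a fin_num by exact: fin_num_measure.
rewrite probability_setC // -(fineK Efin) -(fineK Nf) -EFinB -!EFinM -EFinD lte_fin.
have e1 : (fine (enK V B mu mu) < c)%R by rewrite -lte_fin fineK.
have n1 : (0 < fine (nu N))%R by rewrite -lte_fin fineK.
have := ltr_pM2r n1 (fine (enK V B mu mu)) c; rewrite e1; lra.
Qed.

End continuity.

(** * Logarithmic potential of the arcsine distribution *)

Section antiderivative.
Context (R : realType).
Notation leb := (@lebesgue_measure R).
Implicit Types (g Phi : R -> R) (a b : R).

Lemma cont_integrable g a b : continuous g -> leb.-integrable `[a, b] (EFin \o g).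
Proof.
move=> cg; apply: continuous_compact_integrable; first exact: segment_compact.
exact: continuous_subspaceT.
Qed.

Lemma FTC_is_derive_in g Phi a b : a < b -> (forall x, a <= x <= b -> {for x, continuous g}) ->
  (forall x, a <= x <= b -> is_derive x (1 : R) Phi (g x)) ->
  (\int[leb]_(x in `[a, b]) (g x)%:E = (Phi b - Phi a)%:E)%E.
Proof.
move=> ab cg dP; rewrite EFinB; apply: continuous_FTC2 => //.
- by apply: continuous_in_subspaceT => x; rewrite inE /= in_itv /=; exact: cg.
- have cP x : a <= x <= b -> {for x, continuous Phi}.
    by move=> xab; apply: differentiable_continuous; apply/derivable1_diffP; case: (dP x xab).
  split.
  + by move=> x; rewrite in_itv /= => /andP[ax xb]; case: (dP x); rewrite ?(ltW ax) ?(ltW xb).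
  + by apply: cvg_at_right_filter; apply: cP; rewrite lexx ltW.
  + by apply: cvg_at_left_filter; apply: cP; rewrite lexx ltW.
- move=> x; rewrite in_itv /= => /andP[ax xb]; rewrite derive1E.
  by have := dP x; rewrite (ltW ax) (ltW xb) => /(_ isT) d; rewrite derive_val.
Qed.

Lemma FTC_is_derive g Phi a b : a < b -> continuous g ->
  (forall x, a <= x <= b -> is_derive x (1 : R) Phi (g x)) ->
  (\int[leb]_(x in `[a, b]) (g x)%:E = (Phi b - Phi a)%:E)%E.
Proof. by move=> ab cg; apply: FTC_is_derive_in => // x _; exact: cg. Qed.

Lemma antiderivative g a0 : continuous g -> exists Phi, forall x, a0 < x -> is_derive x (1 : R) Phi (g x).
Proof.
move=> cg; exists (fun x => \int[leb]_(t in [set` Interval (BLeft a0) (BRight x)]) g t) => x ax.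
have [d1 d2] := @continuous_FTC1 R g (BLeft a0) x (x + 1) (ltr_pwDr ltr01 (lexx x)) (cont_integrable _ _ cg) ax (cg x).
split; first exact: d1.
by rewrite -derive1E; exact: d2.
Qed.

Lemma is_derive_affine Phi (c1 c2 c3 : R) x d : is_derive (c1 + c2 * x) (1 : R) Phi d ->
  is_derive x (1 : R) (fun y => c3 * Phi (c1 + c2 * y)) (c3 * (d * c2)).
Proof.
move=> dP; have dl : is_derive x (1 : R) (fun y => c1 + c2 * y) c2.
  have := @is_deriveD R R R (cst c1) (fun y => c2 * y) x 1 0 c2 (is_derive_cst c1 x 1).
  rewrite add0r; apply.
  have := @is_deriveZ R R R id c2 x 1 1 (is_derive_id x 1).
  by rewrite /GRing.scale /= mulr1.
have dc := @is_derive1_comp R Phi (fun y => c1 + c2 * y) x d c2 dP dl.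
exact: (@is_deriveZ R R R _ c3 x 1 _ dc).
Qed.

Lemma integral_reflect g a : continuous g -> 0 < a ->
  (\int[leb]_(x in `[0%R, a]) (g (a - x))%:E = \int[leb]_(x in `[0%R, a]) (g x)%:E)%E.
Proof.
move=> cg a0; have [Phi dP] := antiderivative (-1) cg.
have i1 : (\int[leb]_(x in `[0%R, a]) (g x)%:E = (Phi a - Phi 0)%:E)%E.
  by apply: FTC_is_derive => // x /andP[x0 _]; apply: dP; lra.
rewrite i1.
have i2 : (\int[leb]_(x in `[0%R, a]) (g (a - x))%:E =
   (-1 * Phi (a + -1 * a) - -1 * Phi (a + -1 * 0))%:E)%E; last first.
  by rewrite i2; congr EFin; rewrite mulr0 addr0 !mulN1r subrr; ring.
apply: (@FTC_is_derive (fun x => g (a - x)) (fun y => -1 * Phi (a + -1 * y))) => //.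
- by move=> x; apply: continuous_comp; [apply: cvgB; [exact: cvg_cst|exact: cvg_id] | exact: cg].
- move=> x /andP[x0 xa]; have := @is_derive_affine Phi a (-1) (-1) x (g (a - x)).
  rewrite !mulN1r mulrN1 opprK; apply; apply: dP; lra.
Qed.

(** Both sides are half the integral of [g] over [[0, 2 * a]]: the left one by scaling, the right
    one by reflection about [a]. *)
Lemma integral_fold g a : continuous g -> 0 < a -> (forall x, g (2 * a - x) = g x) ->
  (\int[leb]_(x in `[0%R, a]) (g (2 * x))%:E = \int[leb]_(x in `[0%R, a]) (g x)%:E)%E.
Proof.
move=> cg a0 gs; have [Phi dP] := antiderivative (-1) cg.
have i1 : (\int[leb]_(x in `[0%R, a]) (g x)%:E = (Phi a - Phi 0)%:E)%E.
  by apply: FTC_is_derive => // x /andP[x0 _]; apply: dP; lra.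
rewrite i1.
have i3 : (\int[leb]_(x in `[0%R, a]) (g (2 * x))%:E =
   (2^-1 * Phi (0 + 2 * a) - 2^-1 * Phi (0 + 2 * 0))%:E)%E; last first.
  rewrite i3.
have h : (\int[leb]_(x in `[a, (2 * a)%R]) (g x)%:E =
     (-1 * Phi (2 * a + -1 * (2 * a)) - -1 * Phi (2 * a + -1 * a))%:E)%E.
    apply: (@FTC_is_derive g (fun y => -1 * Phi (2 * a + -1 * y))) => //; first lra.
    move=> x /andP[x0 xa].
    have d1 : is_derive (2 * a + -1 * x) (1 : R) Phi (g (2 * a - x)).
      by rewrite mulN1r; apply: dP; lra.
    have := is_derive_affine (-1) d1.
    by rewrite (_ : -1 * (g (2 * a - x) * -1) = g x) // gs; ring.
  have i2 : (\int[leb]_(x in `[a, (2 * a)%R]) (g x)%:E = (Phi (2 * a) - Phi a)%:E)%E.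
    by apply: FTC_is_derive => //; [lra|move=> x /andP[xa _]; apply: dP; lra].
  move: h; rewrite i2 !mulN1r subrr (_ : 2 * a - a = a); last ring.
  by move=> [h]; congr EFin; rewrite !add0r mulr0; lra.
apply: (@FTC_is_derive (fun x => g (2 * x)) (fun y => 2^-1 * Phi (0 + 2 * y))) => //.
- by move=> x; apply: continuous_comp; [apply: cvgM; [exact: cvg_cst|exact: cvg_id] | exact: cg].
- move=> x /andP[x0 xa]; have := @is_derive_affine Phi 0 2 2^-1 x (g (2 * x)).
  rewrite add0r (_ : 2^-1 * (g (2 * x) * 2) = g (2 * x)); last by field.
  apply; apply: dP; lra.
Qed.

End antiderivative.

(** * Means of logarithms over the circle *)

Section log_integral.
Context (R : realType).
Notation leb := (@lebesgue_measure R).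
Implicit Types (q u phi th : R).

(** The squared modulus of [1 - q * exp (i * u)]. *)
Definition pker q u : R := 1 - 2 * q * cos u + q ^+ 2.

Lemma pker_ge q u : 0 <= q < 1 -> (1 - q) ^+ 2 <= pker q u <= 4.
Proof.
move=> /andP[q0 q1]; rewrite /pker.
have h1 := cos_le1 u; have h2 := cos_geN1 u.
have := ler_wpM2l q0 h1; have := ler_wpM2l q0 h2.
have : q ^+ 2 <= 1 by rewrite expr_le1 // ltW.
lra.
Qed.

Lemma pker_gt0 q u : 0 <= q < 1 -> 0 < pker q u.
Proof.
move=> qq; have /andP[h _] := pker_ge u qq; apply: lt_le_trans h.
by rewrite exprn_gt0 // subr_gt0; case/andP: qq.
Qed.

Lemma continuous_pker q : continuous (pker q).
Proof.
move=> u; apply: cvgD; last exact: cvg_cst.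
apply: cvgB; first exact: cvg_cst.
apply: cvgM; first exact: cvg_cst.
exact: continuous_cos.
Qed.

(** The squared modulus of [(1 - z) * (1 + z) = 1 - z ^+ 2]. *)
Lemma pker_double q u : pker q u * pker q (u + pi) = pker (q ^+ 2) (2 * u).
Proof.
rewrite /pker cosDpi (_ : 2 * u = u + u); last ring.
have := cos2Dsin2 u; rewrite cosD -!expr2 => h.
have -> : sin u ^+ 2 = 1 - cos u ^+ 2 by rewrite -h; ring.
ring.
Qed.

(** Symmetrized in [th], so that the integral over [[0, pi]] amounts to one over the whole
    circle. *)
Definition Hker q phi th : R := ln (pker q (phi + th)) + ln (pker q (phi - th)).

Lemma continuous_lnpker q (a b : R) : 0 <= q < 1 -> continuous (fun th => ln (pker q (a + b * th))).
Proof.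
move=> qq th; apply: continuous_cvg; first by apply: continuous_ln; exact: pker_gt0.
apply: continuous_cvg; first exact: continuous_pker.
by apply: cvgD; [exact: cvg_cst | apply: cvgM; [exact: cvg_cst|exact: cvg_id]].
Qed.

Lemma continuous_Hker q phi : 0 <= q < 1 -> continuous (Hker q phi).
Proof.
move=> qq; have -> : Hker q phi = fun th => ln (pker q (phi + 1 * th)) + ln (pker q (phi + -1 * th)).
  by apply/funext => th; rewrite mul1r mulN1r.
by move=> th; apply: cvgD; exact: continuous_lnpker.
Qed.

Lemma Hker_double q phi th : 0 <= q < 1 ->
  Hker q phi th + Hker q phi (pi - th) = Hker (q ^+ 2) (2 * phi) (2 * th).
Proof.
move=> qq; rewrite /Hker.
have e1 : pker q (phi - (pi - th)) = pker q (phi + th + pi).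
  rewrite /pker (_ : phi + th + pi = phi - (pi - th) + pi *+ 2); last by rewrite mulr2n; ring.
  by rewrite cosD2pi.
have e2 : pker q (phi + (pi - th)) = pker q (phi - th + pi) by congr pker; ring.
rewrite e1 e2 -(mulrDr 2) -(mulrBr 2) -!pker_double !lnM ?posrE ?pker_gt0 //; ring.
Qed.

Lemma Hker_bound q q' phi th : 0 <= q' <= q -> q < 1 ->
  `|Hker q' phi th| <= 2 * (ln 4 - 2 * ln (1 - q)).
Proof.
move=> /andP[q0 qq] q1.
have q'1 : 0 <= q' < 1 by rewrite q0 (le_lt_trans qq).
have one (u : R) : `|ln (pker q' u)| <= ln 4 - 2 * ln (1 - q).
  have /andP[l1 l2] := pker_ge u q'1.
  have p0 := pker_gt0 u q'1.
  have lq : 0 < 1 - q by rewrite subr_gt0.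
  have l3 : (1 - q) ^+ 2 <= pker q' u.
    by apply: le_trans l1; rewrite lerXn2r ?nnegrE; lra.
  have a1 : ln ((1 - q) ^+ 2) <= ln (pker q' u) by rewrite ler_ln ?posrE ?exprn_gt0.
  have a2 : ln (pker q' u) <= ln 4 by rewrite ler_ln ?posrE.
  have a3 : ln (1 - q) <= 0 by apply: ln_le0; lra.
  have a4 : 0 <= ln (4 : R) by apply: ln_ge0; lra.
  rewrite lnXn ?posrE // -[_ *+ 2]mulr_natl in a1.
  by rewrite ler_norml; lra.
apply: (le_trans (ler_normD _ _)); have := one (phi + th); have := one (phi - th); lra.
Qed.

Definition Hint q phi : R := fine (\int[leb]_(th in `[0%R, pi]) (Hker q phi th)%:E)%E.

Lemma HintE q phi : 0 <= q < 1 ->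
  (\int[leb]_(th in `[0%R, pi]) (Hker q phi th)%:E = (Hint q phi)%:E)%E.
Proof.
move=> qq; rewrite /Hint fineK //; apply: integrable_fin_num => //.
exact: cont_integrable (@continuous_Hker q phi qq).
Qed.

Lemma Hint_double q phi : 0 <= q < 1 -> 2 * Hint q phi = Hint (q ^+ 2) (2 * phi).
Proof.
move=> qq; have /andP[q0 q1] := qq.
have qq2 : 0 <= q ^+ 2 < 1 by rewrite sqr_ge0 expr_lt1.
apply: EFin_inj; rewrite -HintE // mulr_natl mulr2n EFinD -HintE //.
rewrite -[X in (_ + X)%E](integral_reflect (@continuous_Hker q phi qq) (pi_gt0 R)).
rewrite -integralD //; last 2 first.
- exact: cont_integrable (@continuous_Hker q phi qq).
- apply: (@cont_integrable _ (fun x => Hker q phi (pi - x))) => x.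
  apply: (@continuous_comp _ _ _ (fun z => pi - z) (Hker q phi)); last exact: continuous_Hker.
  by apply: cvgB; [exact: cvg_cst|exact: cvg_id].
rewrite -(integral_fold (@continuous_Hker (q ^+ 2) (2 * phi) qq2) (pi_gt0 R)); last first.
  move=> x; rewrite /Hker addrC; congr (_ + _).
    rewrite /pker (_ : 2 * phi + x = 2 * phi - (2 * pi - x) + pi *+ 2); last by rewrite mulr2n; ring.
    by rewrite cosD2pi.
  rewrite /pker (_ : 2 * phi + (2 * pi - x) = 2 * phi - x + pi *+ 2); last by rewrite mulr2n; ring.
  by rewrite cosD2pi.
by apply: eq_integral => th _; rewrite -EFinD Hker_double.
Qed.

Lemma leb_pi : leb `[0%R, pi] = pi%:E.
Proof. by rewrite lebesgue_measure_itv /= lte_fin pi_gt0 oppr0 adde0. Qed.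

Lemma int_cst_pi (a : R) : (\int[leb]_(x in `[0%R, pi]) a%:E = (pi * a)%:E)%E.
Proof.
transitivity (a%:E * leb `[0%R, pi])%E; first exact: integral_cst.
by rewrite leb_pi -EFinM mulrC.
Qed.

Lemma Hint_bound q q' phi : 0 <= q' <= q -> q < 1 ->
  `|Hint q' phi| <= pi * (2 * (ln 4 - 2 * ln (1 - q))).
Proof.
move=> /andP[q0 qq] q1.
have q'1 : 0 <= q' < 1 by rewrite q0 (le_lt_trans qq).
set C := 2 * _.
have iH : leb.-integrable `[0, pi] (EFin \o Hker q' phi).
  exact: cont_integrable (@continuous_Hker q' phi q'1).
rewrite -lee_fin -abse_EFin -HintE //.
apply: (le_trans (le_abse_integral _ _ (measurable_int _ iH))) => //.
apply: (@le_trans _ _ (\int[leb]_(th in `[0%R, pi]) (cst C%:E th))%E).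
  apply: ge0_le_integral => //.
  - by apply: measurableT_comp => //; exact: measurable_int iH.
  - by move=> th _ /=; rewrite lee_fin /C; apply: (@Hker_bound q) => //; rewrite q0.
by rewrite int_cst_pi.
Qed.

(** The mean value property of [ln |1 - z|] by doubling: [Hint_double] replaces [q] by [q ^+ 2] at
    the price of a factor 1/2, and the integrals stay bounded for smaller [q], so iterating leaves
    0. *)
Lemma Hint0 q phi : 0 <= q < 1 -> Hint q phi = 0.
Proof.
move=> /andP[q0 q1].
pose C := pi * (2 * (ln 4 - 2 * ln (1 - q))).
have h n q' phi' : 0 <= q' <= q -> `|Hint q' phi'| <= 2^-1 ^+ n * C.
  elim: n q' phi' => [|n IH] q' phi' /andP[q0' qq'].
    by rewrite expr0 mul1r; apply: Hint_bound => //; rewrite q0'.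
  have q'1 : 0 <= q' < 1 by rewrite q0' (le_lt_trans qq').
  have -> : Hint q' phi' = 2^-1 * Hint (q' ^+ 2) (2 * phi').
    by rewrite -Hint_double //; field.
  rewrite normrM (gtr0_norm (x := 2^-1)) ?invr_gt0 // (exprS 2^-1) -(mulrA 2^-1) ler_wpM2l ?invr_ge0 //.
  apply: IH; rewrite sqr_ge0 /= expr2; apply: le_trans qq'.
  by rewrite ler_piMr //; case/andP: q'1 => _ /ltW.
have cv : (2^-1 : R) ^+ n * C @[n --> \oo] --> 0.
  rewrite -(mul0r C); apply: cvgM; last exact: cvg_cst.
  by apply: cvg_expr; rewrite ger0_norm ?invr_ge0 // invf_lt1 // ltr1n.
apply/eqP; rewrite -normr_le0 -(cvg_lim _ cv) //; apply: limr_ge; first exact: cvgP cv.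
by apply: nearW => n; apply: h; rewrite q0 lexx.
Qed.

(** Regularizes the kernel on the cut: the second term vanishes at [q = 1] and increases with
    [q + q^-1], so that letting [q] increase to 1 is a monotone limit. *)
Lemma pker_factor q phi th : 0 < q ->
  pker q (phi + th) * pker q (phi - th) / q ^+ 2 =
  4 * (cos phi - cos th) ^+ 2 + ((q + q^-1) - 2) * ((q + q^-1) + 2 - 4 * (cos phi * cos th)).
Proof.
move=> q0; rewrite /pker cosD cosB; set a := cos phi; set b := cos th.
have h1 : sin phi ^+ 2 = 1 - a ^+ 2 by have := cos2Dsin2 phi; rewrite -/a; lra.
have h2 : sin th ^+ 2 = 1 - b ^+ 2 by have := cos2Dsin2 th; rewrite -/b; lra.
have -> : (1 - 2 * q * (a * b - sin phi * sin th) + q ^+ 2) *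
  (1 - 2 * q * (a * b + sin phi * sin th) + q ^+ 2) / q ^+ 2 =
  ((1 + q ^+ 2 - 2 * q * a * b) ^+ 2 - 4 * q ^+ 2 * (sin phi ^+ 2 * sin th ^+ 2)) / q ^+ 2.
  by congr (_ / _); ring.
rewrite h1 h2; field; by rewrite gt_eqF.
Qed.

Lemma ln_pker_sum q phi th : 0 < q < 1 ->
  Hker q phi th - 2 * ln q =
  ln (4 * (cos phi - cos th) ^+ 2 + ((q + q^-1) - 2) * ((q + q^-1) + 2 - 4 * (cos phi * cos th))).
Proof.
move=> /andP[q0 q1]; rewrite -pker_factor // /Hker.
have qq : 0 <= q < 1 by rewrite ltW.
rewrite lnM ?posrE ?mulr_gt0 ?pker_gt0 ?invr_gt0 ?exprn_gt0 //.
by rewrite lnM ?posrE ?pker_gt0 // lnV ?posrE ?exprn_gt0 // lnXn // -[ln q *+ 2]mulr_natl.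
Qed.

(* Logarithmic integral outside the cut: with |y - c| / r = (q + 1/q) / 2, the integrand is
   r / (2 q) times a kernel pker whose logarithm has mean zero. *)
Lemma int_nlog_out (c r y q s : R) : 0 < r -> 0 < q < 1 -> s ^+ 2 = 1 ->
  y = c + s * (r * ((q + q^-1) / 2)) ->
  (forall th, nlog (c + r * cos th - y) = (- ln (r / (2 * q)) - 2^-1 * Hker q (if s == 1 then 0 else pi) th)%:E).
Proof.
move=> r0 /andP[q0 q1] s1 -> th.
have qq : 0 <= q < 1 by rewrite ltW.
have rq : 0 < r / (2 * q) by rewrite divr_gt0 // mulr_gt0.
have key : `|c + r * cos th - (c + s * (r * ((q + q^-1) / 2)))| = r / (2 * q) * pker q (if s == 1 then th else th + pi) /\
   Hker q (if s == 1 then 0 else pi) th = 2 * ln (pker q (if s == 1 then th else th + pi)).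
  have [s'1|s'1] := eqVneq s 1.
    split; last by rewrite /Hker add0r sub0r /pker cosN; ring.
    rewrite s'1 mul1r distrC.
    have -> : c + r * ((q + q^-1) / 2) - (c + r * cos th) = r / (2 * q) * pker q th.
      by rewrite /pker; field; rewrite gt_eqF.
    by rewrite ger0_norm // mulr_ge0 ?ltW ?pker_gt0.
  have sm : s = -1 by apply/eqP; move/eqP: s1; rewrite sqrf_eq1 (negPf s'1).
  split; last first.
    have -> : Hker q pi th = ln (pker q (th + pi)) + ln (pker q (th + pi)); last ring.
    by rewrite /Hker (addrC pi th) /pker cosB cospi sinpi cosDpi mulN1r mul0r addr0.
  rewrite sm; have -> : c + r * cos th - (c + -1 * (r * ((q + q^-1) / 2))) = r / (2 * q) * pker q (th + pi).
    by rewrite /pker cosDpi; field; rewrite gt_eqF.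
  by rewrite ger0_norm // mulr_ge0 ?ltW ?pker_gt0.
have [k1 k2] := key; rewrite /nlog -normr_eq0 k1 k2 gt_eqF ?mulr_gt0 ?pker_gt0 ?invr_gt0 ?mulr_gt0 //.
by rewrite lnM ?posrE ?pker_gt0 //; congr EFin; field.
Qed.

Lemma int_Hker q phi : 0 <= q < 1 -> (\int[leb]_(th in `[0%R, pi]) (Hker q phi th)%:E = 0)%E.
Proof. by move=> qq; rewrite HintE // Hint0. Qed.

Lemma int_affine_Hker q phi (a b : R) : 0 <= q < 1 ->
  leb.-integrable `[0, pi] (fun th => (a + b * Hker q phi th)%:E) /\
  (\int[leb]_(th in `[0%R, pi]) (a + b * Hker q phi th)%:E = (pi * a)%:E)%E.
Proof.
move=> qq.
have iH : leb.-integrable `[0, pi] (EFin \o Hker q phi).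
  exact: cont_integrable (@continuous_Hker q phi qq).
have iZ : leb.-integrable `[0, pi] (fun th => b%:E * (Hker q phi th)%:E)%E.
  exact: integrableZl.
have ia : leb.-integrable `[0, pi] (fun th => a%:E).
  by apply: (@cont_integrable _ (cst a)) => x; exact: cvg_cst.
have e : (fun th => (a + b * Hker q phi th)%:E) = (fun th => a%:E + b%:E * (Hker q phi th)%:E)%E.
  by apply/funext => th; rewrite EFinD EFinM.
rewrite e; split; first exact: integrableD.
rewrite integralD // integralZl // int_Hker // mule0 adde0.
by rewrite int_cst_pi.
Qed.

Lemma nlogM (r u : R) : 0 < r -> nlog (r * u) = (nlog u + (- ln r)%:E)%E.
Proof.
move=> r0; rewrite /nlog mulf_eq0 gt_eqF //=; case: ifPn => // u0.
by rewrite -EFinD normrM gtr0_norm // lnM ?posrE ?normr_gt0 // opprD addrC.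
Qed.

Lemma nlog_sqrt (A : R) : 0 < A -> nlog (Num.sqrt A) = (- 2^-1 * ln A)%:E.
Proof.
move=> A0; rewrite /nlog gt_eqF ?sqrtr_gt0 // ger0_norm ?sqrtr_ge0 //.
rewrite -{2}(sqr_sqrtr (ltW A0)) lnXn ?sqrtr_gt0 //; congr EFin.
by rewrite -[ln _ *+ 2]mulr_natl; field.
Qed.

Let qn (n : nat) : R := 1 - n.+2%:R^-1.

Let qn01 n : 0 < qn n < 1.
Proof.
rewrite /qn subr_gt0 ltrBlDr ltrDl invr_gt0 ltr0n andbT.
by rewrite invf_lt1 ?ltr0n // ltr1n.
Qed.

Let sn n : R := qn n + (qn n)^-1 - 2.

Let sn_ge0 n : 0 <= sn n.
Proof.
have /andP[q0 q1] := qn01 n; have -> : sn n = (1 - qn n) ^+ 2 / qn n.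
  by rewrite /sn; field; rewrite gt_eqF.
by rewrite divr_ge0 ?sqr_ge0 // ltW.
Qed.

Let qn_cvg : qn n @[n --> \oo] --> (1 : R).
Proof.
rewrite -[X in _ --> X]subr0; apply: cvgB; first exact: cvg_cst.
apply/cvgrPdist_lt => e e0; have := near_infty_natSinv_lt (PosNum e0).
apply: filterS => n /=; rewrite sub0r normrN ger0_norm ?invr_ge0 ?ler0n //.
by apply: le_lt_trans; rewrite lef_pV2 ?posrE ?ltr0n // ler_nat.
Qed.

Let sn_cvg : sn n @[n --> \oo] --> (0 : R).
Proof.
rewrite (_ : 0 = 1 + 1^-1 - 2 :> R); last by rewrite invr1; ring.
apply: cvgB; last exact: cvg_cst.
by apply: cvgD; [exact: qn_cvg | apply: cvgV => //; exact: qn_cvg].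
Qed.

Let sn_anti n m : (n <= m)%N -> sn m <= sn n.
Proof.
move=> nm; have /andP[a0 a1] := qn01 n; have /andP[b0 b1] := qn01 m.
have ab : qn n <= qn m.
  by rewrite /qn lerD2l lerN2 lef_pV2 ?posrE ?ltr0n // ler_nat !ltnS.
rewrite -subr_ge0; have -> : sn n - sn m = (qn m - qn n) * (1 - qn n * qn m) / (qn n * qn m).
  by rewrite /sn; field; rewrite !gt_eqF.
have h : qn n * qn m <= 1 by apply: mulr_ile1 => //; apply: ltW.
apply: divr_ge0; first by apply: mulr_ge0; rewrite subr_ge0.
by apply: mulr_ge0; apply: ltW.
Qed.

Lemma int_nlog_cos phi :
  leb.-integrable `[0, pi] (fun th => nlog (cos th - cos phi)) /\
  (\int[leb]_(th in `[0%R, pi]) nlog (cos th - cos phi) = (pi * ln 2)%:E)%E.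
Proof.
pose A n th := 4 * (cos phi - cos th) ^+ 2 + sn n * (sn n + 4 - 4 * (cos phi * cos th)).
have cc th : cos phi * cos th <= 1.
  have := ler_norm (cos phi * cos th); rewrite normrM.
  have h (x : R) : `|cos x| <= 1 by rewrite ler_norml cos_geN1 cos_le1.
  have := mulr_ile1 (normr_ge0 _) (normr_ge0 _) (h phi) (h th); lra.
have HA n th : Hker (qn n) phi th - 2 * ln (qn n) = ln (A n th).
  rewrite ln_pker_sum // /A /sn; congr (ln (_ + _ * _)); ring.
have A0 n th : 0 < A n th.
  have /andP[q0 q1] := qn01 n; have qq : 0 <= qn n < 1 by rewrite ltW.
  have -> : A n th = pker (qn n) (phi + th) * pker (qn n) (phi - th) / qn n ^+ 2.
    by rewrite pker_factor // /A /sn; congr (_ + _ * _); ring.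
  by rewrite !mulr_gt0 ?pker_gt0 // invr_gt0 exprn_gt0.
have Aanti th n m : (n <= m)%N -> A m th <= A n th.
  move=> nm; rewrite lerD2l; have := sn_anti nm; have := sn_ge0 m; have := cc th => c1 s0 ss.
  apply: ler_pM => //; lra.
have Abound th : A 0%N th <= 4 * 4 + sn 0 * (sn 0 + 8).
  have h (x : R) : `|cos x| <= 1 by rewrite ler_norml cos_geN1 cos_le1.
  have h1 : - 1 <= cos phi * cos th.
    have := mulr_ile1 (normr_ge0 _) (normr_ge0 _) (h phi) (h th).
    rewrite -normrM; have := ler_norm (- (cos phi * cos th)); rewrite normrN; lra.
  have h2 : (cos phi - cos th) ^+ 2 <= 4.
    have : (cos phi) ^+ 2 <= 1 by rewrite -(real_normK (num_real _)) expr_le1.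
    have : (cos th) ^+ 2 <= 1 by rewrite -(real_normK (num_real _)) expr_le1.
    have -> : (cos phi - cos th) ^+ 2 = cos phi ^+ 2 + cos th ^+ 2 - 2 * (cos phi * cos th) by ring.
    lra.
  apply: lerD; first lra.
  by rewrite ler_wpM2l ?sn_ge0 //; have := sn_ge0 0%N; lra.
(* [C] makes all the regularized integrands nonnegative, as monotone convergence requires. *)
pose C := 2^-1 * ln (4 * 4 + sn 0 * (sn 0 + 8)).
pose f n th : R := C + ln (qn n) + - 2^-1 * Hker (qn n) phi th.
have fA n th : f n th = C - 2^-1 * ln (A n th) by rewrite -(HA n th) /f; field.
have qq n : 0 <= qn n < 1 by have /andP[a b] := qn01 n; rewrite ltW.
have fmono th : {homo (fun n => (f n th)%:E) : n m / (n <= m)%N >-> (n <= m)%E}.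
  move=> n m nm; rewrite lee_fin !fA lerD2l lerN2 ler_pM2l ?invr_gt0 //.
  by rewrite ler_ln ?posrE //; exact: Aanti.
have f0 n th : (0 <= (f n th)%:E)%E.
  apply: le_trans (fmono th _ _ (leq0n n)).
  rewrite lee_fin fA subr_ge0 ler_pM2l ?invr_gt0 // ler_ln ?posrE //.
  by apply: lt_le_trans (Abound th).
have fint n := int_affine_Hker phi (C + ln (qn n)) (- 2^-1) (qq n).
have mf n : measurable_fun `[0, pi] (fun th => (f n th)%:E) by exact: measurable_int (fint n).1.
have flim th : (f n th)%:E @[n --> \oo] --> (C%:E + (nlog (cos th - cos phi) + (- ln 2)%:E))%E.
  rewrite -nlogM // -nlogN -mulrN opprB.
  have e n : (f n th)%:E = (C%:E + nlog (Num.sqrt (A n th)))%E.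
    by rewrite nlog_sqrt // fA -EFinD; congr EFin; ring.
  under eq_fun do rewrite e.
  apply: cvgeD; [exact: fin_num_adde_defr | exact: cvg_cst | ].
  rewrite (_ : nlog (2 * _) = nlog (Num.sqrt (4 * (cos phi - cos th) ^+ 2))); last first.
    have -> : 4 * (cos phi - cos th) ^+ 2 = (2 * (cos phi - cos th)) ^+ 2 by ring.
    by rewrite sqrtr_sqr /nlog normr_eq0 normr_id.
  apply: nlog_cvg; apply: continuous_cvg; first exact: sqrt_continuous.
  rewrite -[X in _ --> X]addr0; apply: cvgD; first exact: cvg_cst.
  rewrite -(mul0r (0 + 4 - 4 * (cos phi * cos th))); apply: cvgM; first exact: sn_cvg.
  by apply: cvgB; [apply: cvgD; [exact: sn_cvg|exact: cvg_cst]|exact: cvg_cst].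
pose G th := (C%:E + (nlog (cos th - cos phi) + (- ln 2)%:E))%E.
have flimG th : (f n th)%:E @[n --> \oo] --> G th by exact: flim.
have G0 th : (0 <= G th)%E.
  rewrite -(cvg_lim _ (flimG th)) //; apply: lime_ge; first exact: cvgP (flimG th).
  exact: nearW.
have IG : (\int[leb]_(th in `[0%R, pi]) G th = (pi * C)%:E)%E.
  have mc := @cvg_monotone_convergence _ _ R leb `[0, pi] (measurable_itv _) _ mf
    (fun n th _ => f0 n th) (fun th _ => fmono th).
  have eG : (fun th => limn (fun n => (f n th)%:E)) = G.
    by apply/funext => th; exact: cvg_lim (flimG th).
  rewrite eG in mc; rewrite -(cvg_lim _ mc) //.
  under eq_fun do rewrite (fint _).2.
  apply/cvg_lim => //; apply: cvg_EFin; first exact: nearW.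
  apply: cvgM; first exact: cvg_cst.
  rewrite -[X in _ --> X]addr0 -(ln1 R); apply: cvgD; first exact: cvg_cst.
  by apply: continuous_cvg; [exact: continuous_ln | exact: qn_cvg].
have mG : measurable_fun `[0, pi] G.
  apply: measurable_funTS; apply: emeasurable_funD => //; apply: emeasurable_funD => //.
  apply: measurableT_comp; first exact: measurable_nlog.
  by apply: measurable_funB => //; apply: continuous_measurable_fun; exact: continuous_cos.
have iG : leb.-integrable `[0, pi] G.
  apply/integrableP; split => //; under eq_integral do rewrite gee0_abs //.
  by rewrite IG ltry.
have eN : (fun th => nlog (cos th - cos phi)) = (fun th => G th + (ln 2 - C)%:E)%E.
  apply/funext => th; rewrite /G; case: (nlog _) => [x| |] //.
  by rewrite -!EFinD; congr EFin; ring.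
have ic : leb.-integrable `[0, pi] (fun th : R => (ln 2 - C)%:E).
  by apply: (@cont_integrable _ (cst (ln 2 - C))) => x; exact: cvg_cst.
rewrite eN; split; first exact: integrableD.
rewrite integralD // IG int_cst_pi -EFinD; congr EFin; ring.
Qed.

Theorem arcsine_log_in (c r y : R) : 0 < r -> `|y - c| <= r ->
  leb.-integrable `[0, pi] (fun th => nlog (c + r * cos th - y)) /\
  (\int[leb]_(th in `[0%R, pi]) nlog (c + r * cos th - y) = (pi * - ln (r / 2))%:E)%E.
Proof.
move=> r0 yr.
have [phi [_ hphi]] : exists phi, 0 <= phi <= pi /\ cos phi = (y - c) / r.
  exists (acos ((y - c) / r)); apply: acos_def.
  by rewrite -ler_norml normrM normfV (gtr0_norm r0) ler_pdivrMr // mul1r.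
have [i1 i2] := int_nlog_cos phi.
have e : (fun th => nlog (c + r * cos th - y)) = (fun th => nlog (cos th - cos phi) + (- ln r)%:E)%E.
  apply/funext => th; rewrite -nlogM //; congr nlog; rewrite hphi; field; by rewrite gt_eqF.
have ic : leb.-integrable `[0, pi] (fun th : R => (- ln r)%:E).
  by apply: (@cont_integrable _ (cst (- ln r))) => x; exact: cvg_cst.
rewrite e; split; first exact: integrableD.
rewrite integralD // i2 int_cst_pi -EFinD lnM ?posrE ?invr_gt0 // lnV ?posrE //.
congr EFin; ring.
Qed.

(** The gap [g = - ln q] is the Green function of the complement of the interval, [q] being the
    Joukowski parameter of [y]. The bound combines [- ln q >= 1 - q] with
    [(1 - q) ^+ 2 = 2 * q * (xi - 1)] and [2 * q * xi = 1 + q ^+ 2 >= 1]; it keeps the square root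
    behaviour at the endpoints. *)
Theorem arcsine_log_out (c r y : R) : 0 < r -> r < `|y - c| ->
  leb.-integrable `[0, pi] (fun th => nlog (c + r * cos th - y)) /\
  exists2 g, Num.sqrt (1 - r / `|y - c|) <= g &
  (\int[leb]_(th in `[0%R, pi]) nlog (c + r * cos th - y) = (pi * (- ln (r / 2) - g))%:E)%E.
Proof.
move=> r0 yr; have n0 : 0 < `|y - c| by apply: lt_trans yr.
pose xi := `|y - c| / r.
have xi1 : 1 < xi by rewrite ltr_pdivlMr // mul1r.
have xi0 : 0 < xi by apply: lt_trans xi1.
pose w := Num.sqrt (xi ^+ 2 - 1).
have w2 : w ^+ 2 = xi ^+ 2 - 1.
  by rewrite sqr_sqrtr // subr_ge0 expr_ge1 // ltW.
have wp : 0 < w by rewrite sqrtr_gt0 subr_gt0 expr_gt1 // ltW.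
have wxi : w < xi by rewrite -(@ltr_pXn2r _ 2) ?nnegrE ?ltW // w2; lra.
pose q := xi - w.
have q0 : 0 < q by rewrite subr_gt0.
have qinv : q^-1 = xi + w.
  have h : q * (xi + w) = 1 by rewrite /q -subr_sqr w2; ring.
  have qn0 : q != 0 by rewrite gt_eqF.
  by rewrite -[RHS](mulKf qn0) h mulr1.
have q1 : q < 1 by rewrite -(invf_gt1 q0) qinv; lra.
have q01 : 0 < q < 1 by rewrite q0.
have qq : 0 <= q < 1 by rewrite ltW.
have qxi : (q + q^-1) / 2 = xi by rewrite qinv /q; field.
pose s := Num.sg (y - c).
have s1 : s ^+ 2 = 1 by rewrite sqr_sg -normr_gt0 n0.
have ys : y = c + s * (r * ((q + q^-1) / 2)).
  have rxi : r * xi = `|y - c| by rewrite /xi mulrC divfK // gt_eqF.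
  by rewrite qxi rxi -numEsg; ring.
have e : (fun th => nlog (c + r * cos th - y)) =
    (fun th => (- ln (r / (2 * q)) + - 2^-1 * Hker q (if s == 1 then 0 else pi) th)%:E).
  by apply/funext => th; rewrite (int_nlog_out r0 q01 s1 ys) mulNr.
have [i1 i2] := int_affine_Hker (if s == 1 then 0 else pi) (- ln (r / (2 * q))) (- 2^-1) qq.
rewrite e; split => //; exists (- ln q); last first.
  rewrite i2 invfM mulrA lnM ?posrE ?divr_gt0 ?invr_gt0 // lnV ?posrE //.
  congr EFin; ring.
apply: (@le_trans _ _ (1 - q)); last first.
  have l1 : -1 < q - 1 by lra.
  have := le_ln1Dx l1; rewrite (_ : 1 + (q - 1) = q); [lra|ring].
have q10 : 0 <= 1 - q by lra.
apply: (@le_trans _ _ (Num.sqrt ((1 - q) ^+ 2))); last by rewrite sqrtr_sqr ger0_norm.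
rewrite ler_sqrt ?sqr_ge0 //.
have -> : r / `|y - c| = xi^-1 by rewrite invf_div.
rewrite -(ler_pM2r xi0) mulrBl mul1r mulVf ?gt_eqF //.
have -> : (1 - q) ^+ 2 * xi = 2 * q * (xi - 1) * xi.
  congr (_ * _); have : q * (xi + w) = 1 by rewrite -qinv mulfV // gt_eqF.
  rewrite /q => h; have := w2; nra.
have hq : 1 <= 2 * q * xi.
  have : q * (xi + w) = 1 by rewrite -qinv mulfV // gt_eqF.
  have : q * w <= q * xi by rewrite ler_pM2l // ltW.
  lra.
rewrite mulrAC -[leLHS]mul1r ler_wpM2r //; lra.
Qed.

End log_integral.

(** * The Mhaskar-Saff functional *)

Section arcsine.
Context (R : realType).
Notation leb := (@lebesgue_measure R).

(** The push-forward of the uniform law on [[0, pi]]: integrals are taken over the angle and the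
    singular density never appears. *)
Lemma arcsine_measure (c r : R) : exists w : probability R R, forall f : R -> \bar R,
  measurable_fun setT f -> (forall x, 0 <= f x)%E ->
  (\int[w]_x f x = (pi^-1)%:E * \int[leb]_(th in `[0%R, pi]) f (c + r * cos th)%R)%E.
Proof.
pose X : R -> R := fun th => c + r * cos th.
have mX : measurable_fun setT X.
  apply: measurable_funD => //; apply: measurable_funM => //.
  by apply: continuous_measurable_fun; exact: continuous_cos.
pose mixX := isMeasurableFun.Build _ _ (measurableTypeR R) R X mX.
pose pX : {mfun measurableTypeR R >-> R} := HB.pack X mixX.
exists (distribution (uniform_prob (pi_gt0 R)) pX) => f mf f0.
rewrite ge0_integral_distribution // integral_uniform //.
- by rewrite subr0.
- by apply: measurableT_comp => //.
- by move=> x; exact: f0.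
Qed.

Definition arcsine (c r : R) : probability R R := projT1 (cid (arcsine_measure c r)).

Lemma integral_arcsine c r (f : R -> \bar R) :
  measurable_fun setT f -> (forall x, 0 <= f x)%E ->
  (\int[arcsine c r]_x f x = (pi^-1)%:E * \int[leb]_(th in `[0%R, pi]) f (c + r * cos th)%R)%E.
Proof. exact: (projT2 (cid (arcsine_measure c r))). Qed.

Lemma arcsine_itv_gt0 c r x e : 0 < r -> `|x - c| <= r -> 0 < e ->
  (0 < arcsine c r `](x - e)%R, (x + e)%R[%classic)%E.
Proof.
move=> r0 xr e0.
pose N := `](x - e)%R, (x + e)%R[%classic.
have -> : arcsine c r N = (\int[arcsine c r]_y (\1_N y)%:E)%E.
  by rewrite integral_indic; [rewrite setIT| exact: measurableT|exact: measurable_itv].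
rewrite integral_arcsine; last 2 first.
- apply/measurable_EFinP; exact: measurable_indic (measurable_itv _).
- by move=> y; rewrite lee_fin.
have [phi [phi01 hphi]] : exists phi, 0 <= phi <= pi /\ cos phi = (x - c) / r.
  exists (acos ((x - c) / r)); apply: acos_def.
  by rewrite -ler_norml normrM normfV (gtr0_norm r0) ler_pdivrMr // mul1r.
have cphi := @continuous_cos R phi.
have er : 0 < e / r by rewrite divr_gt0.
move/cvgrPdist_lt : cphi => /(_ _ er) /nbhs_ballP[d /= d0 hd].
(* The angles are taken on the side of [phi] away from the nearer end of [[0, pi]], so as to stay in
   it. *)
have [u [v [uv h]]] : exists u v, u < v /\ forall th, u <= th <= v -> 0 <= th <= pi /\ `|phi - th| < d.
  have p0 := pi_gt0 R; case/andP: phi01 => ph0 ph1.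
  have [hp|hp] := ltP phi (pi / 2).
    exists phi, (Num.min (phi + d / 2) pi); split.
      by rewrite lt_min; apply/andP; split; lra.
    move=> th; rewrite le_min => /and3P[h1 h2 h3]; split; first by apply/andP; split; lra.
    rewrite ltr_norml; lra.
  exists (Num.max (phi - d / 2) 0), phi; split.
    by rewrite gt_max; apply/andP; split; lra.
  move=> th; rewrite ge_max => /andP[/andP[h1 h2] h3]; split; first by apply/andP; split; lra.
  rewrite ltr_norml; lra.
have sub : (\int[leb]_(th in `[u, v]) (cst 1 th) <= \int[leb]_(th in `[0%R, pi]) (\1_N (c + r * cos th))%:E)%E.
  apply: (@le_trans _ _ (\int[leb]_(th in `[u, v]) (\1_N (c + r * cos th))%:E)%E).
    apply: ge0_le_integral => //.
    - apply/measurable_funTS/measurable_EFinP; apply: measurableT_comp; first exact: measurable_indic (measurable_itv _).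
      apply: measurable_funD => //; apply: measurable_funM => //.
      by apply: continuous_measurable_fun; exact: continuous_cos.
    - move=> th; rewrite /= in_itv /= => /h[_ hth].
      suff Nth : N (c + r * cos th) by rewrite indicE mem_set //= lexx.
      rewrite /N /= in_itv /=.
      have := hd th hth; rewrite /= hphi => hh.
      have : `|(x - c) / r - cos th| * r < e by rewrite -ltr_pdivlMr.
      rewrite -[X in _ * X](gtr0_norm r0) -normrM mulrBl divfK ?gt_eqF // ltr_norml; lra.
  apply: ge0_subset_integral => //.
  - apply/measurable_funTS/measurable_EFinP; apply: measurableT_comp; first exact: measurable_indic (measurable_itv _).
    apply: measurable_funD => //; apply: measurable_funM => //.
    by apply: continuous_measurable_fun; exact: continuous_cos.
  - by move=> th; rewrite /= !in_itv /= => /h[].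
apply: mule_gt0; first by rewrite lte_fin invr_gt0 pi_gt0.
apply: lt_le_trans sub.
have -> : (\int[leb]_(th in `[u, v]) (cst 1 th) = (v - u)%:E)%E.
  transitivity (1 * leb `[u, v])%E; first exact: integral_cst.
  by rewrite mul1e lebesgue_measure_itv /= lte_fin uv.
by rewrite lte_fin subr_gt0.
Qed.

End arcsine.

(** * Mass of the equilibrium measure near the endpoints *)

Section density.
Context (R : realType).
Notation leb := (@lebesgue_measure R).

Lemma analytic_lipschitz_at (f : R -> R) (S : set R) x0 : real_analytic_on f S -> S x0 ->
  exists C d : R, 0 <= C /\ 0 < d /\ forall x, S x -> `|x - x0| < d -> `|f x - f x0| <= C * `|x - x0|.
Proof.
move=> fS Sx0; have [r [r0 [c hc]]] := fS _ Sx0.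
have c0 : c 0%N = f x0.
  have := hc _ Sx0; rewrite subrr normr0 => /(_ r0) h.
  suff : (\sum_(k < N) c k * 0 ^+ k) @[N --> \oo] --> c 0%N by move=> h2; exact: (cvg_unique _ h2 h).
  rewrite -(cvg_shiftS (fun N => \sum_(k < N) c k * 0 ^+ k)) /=.
  rewrite (_ : (fun N => _) = cst (c 0%N)); first exact: cvg_cst.
  apply/funext => N; rewrite big_ord_recl /= expr0 mulr1 big1 ?addr0 // => k _.
  by rewrite /bump /= exprS mul0r mulr0.
(* [real_analytic_on] asserts convergence only at points of [S], so the terms of the series are
   bounded by means of one other point [x1] of [S]; without one the claim is trivial. *)
case: (pselect (exists2 x1, S x1 & 0 < `|x1 - x0| < r)) => [[x1 Sx1 /andP[x10 x1r]]|no]; last first.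
  exists 0, r; split => //; split => // x Sx xr; rewrite mul0r.
  have [->|xx] := eqVneq x x0; first by rewrite subrr normr0.
  by exfalso; apply: no; exists x => //; rewrite normr_gt0 subr_eq0 xx.
set w := `|x1 - x0|.
have [K hK] : exists K, forall k, `|c k| * w ^+ k <= K.
  have cv : cvg (series (fun k => c k * (x1 - x0) ^+ k) @ \oo).
    apply/cvg_ex; exists (f x1); rewrite seriesEord; exact: hc.
  have := cvg_series_cvg_0 cv => /cvgP /cvg_seq_bounded [K [_ hK]].
  exists (K + 1) => k; have := hK (K + 1); rewrite ltrDl ltr01 => /(_ isT k I).
  by rewrite /= normrM normrX.
have K0 : 0 <= K by have := hK 0%N; rewrite expr0 mulr1; apply: le_trans.
exists (2 * K / w), (w / 2); split; first by rewrite !mulr_ge0 ?invr_ge0 // ltW.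
split; first by rewrite divr_gt0.
move=> x Sx xw; set q := `|x - x0| / w.
have q0 : 0 <= q by rewrite divr_ge0 // /w normr_ge0.
have q2 : q <= 1 / 2 by rewrite ler_pdivrMr //; move: xw; lra.
have -> : 2 * K / w * `|x - x0| = 2 * K * q by rewrite /q mulrAC mulrA.
have bound N : `|\sum_(k < N.+1) c k * (x - x0) ^+ k - f x0| <= 2 * K * q * (1 - (1 / 2) ^+ N).
  elim: N => [|N IH].
    by rewrite big_ord_recl big_ord0 !expr0 mulr1 addr0 c0 !subrr normr0 mulr0.
  rewrite big_ord_recr /= addrAC.
  apply: le_trans (ler_normD _ _) _.
  have t1 : `|c N.+1 * (x - x0) ^+ N.+1| <= K * q * (1 / 2) ^+ N.
    have -> : `|c N.+1 * (x - x0) ^+ N.+1| = `|c N.+1| * w ^+ N.+1 * q ^+ N.+1.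
      rewrite normrM normrX -mulrA -exprMn; congr (_ * _ ^+ _).
      by rewrite /q mulrC divfK // gt_eqF.
    rewrite -[K * q * _]mulrA.
    apply: ler_pM => //.
    - by rewrite mulr_ge0 // exprn_ge0 // ltW.
    - by rewrite exprn_ge0.
    - by rewrite exprS ler_wpM2l // lerXn2r // nnegrE; lra.
  rewrite [(1/2) ^+ N.+1]exprS; move: IH t1; set u := (1/2) ^+ N; lra.
have lim : `|\sum_(k < N.+1) c k * (x - x0) ^+ k - f x0| @[N --> \oo] --> `|f x - f x0|.
  apply: cvg_norm; apply: cvgB; last exact: cvg_cst.
  rewrite (cvg_shiftS (fun N => \sum_(k < N) c k * (x - x0) ^+ k)).
  by apply: hc => //; apply: lt_trans xw _; apply: lt_trans x1r; rewrite -/w ltr_pdivrMr // ltr_pMr // ltr1n.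
rewrite -(cvg_lim _ lim) //; apply: limr_le; first by apply/cvg_ex; eexists; exact: lim.
apply: nearW => N /=; apply: le_trans (bound N) _.
have Kq : 0 <= 2 * K * q by apply: mulr_ge0 q0; apply: mulr_ge0 K0.
have u0 : 0 <= (1 / 2) ^+ N :> R by rewrite exprn_ge0 //; lra.
by rewrite ler_piMr // lerBlDr lerDl.
Qed.

Lemma analytic_continuous_at (f : R -> R) c d x : real_analytic_on f `]c, d[%classic -> c < x < d ->
  {for x, continuous f}.
Proof.
move=> fS cxd.
have [C [e [C0 [e0 he]]]] := analytic_lipschitz_at fS (x0 := x) cxd.
apply/cvgrPdist_lt => eps eps0; have C1 : 0 < C + 1 by lra.
have /andP[cx xd] := cxd.
apply/nbhs_ballP; exists (Num.min (Num.min e (eps / (C + 1))) (Num.min (x - c) (d - x))).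
  by rewrite /= !lt_min e0 divr_gt0 //= !subr_gt0 cx.
move=> y; rewrite /ball /= !lt_min => /andP[/andP[y1 y2] /andP[y3 y4]].
move: y3 y4; rewrite !(ltr_norml _ (x - c), ltr_norml _ (d - x)) => /andP[y5 y6] /andP[y7 y8].
rewrite distrC; apply: le_lt_trans (he y _ _) _.
- by rewrite /= in_itv /=; apply/andP; split; lra.
- by rewrite distrC.
apply: (@le_lt_trans _ _ ((C + 1) * `|x - y|)); last by rewrite mulrC -ltr_pdivlMr.
by rewrite distrC ler_wpM2r // lerDl.
Qed.

Variables (mu : probability R R) (a b : R) (h : R -> R).
Hypothesis shape : one_cut_shape mu a b h.

Lemma one_cut_lt : a < b. Proof. by case: shape. Qed.
Lemma one_cut_support : msupport mu = `[a, b]%classic. Proof. by case: shape => _ [_ []]. Qed.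

Lemma one_cut_outside : mu (~` `[a, b]%classic) = 0%E.
Proof.
case: shape => _ [_ [_ ->]]; last by apply: measurableC; exact: measurable_itv.
by rewrite setICl integral_set0.
Qed.

Let dens x := 1 / (2 * pi) * h x * Num.sqrt ((b - x) * (x - a)).

Let pi20 : 0 < 2 * pi :> R. Proof. by rewrite mulr_gt0 ?pi_gt0. Qed.

Lemma one_cut_measurable : measurable_fun `[a, b]%classic dens.
Proof.
have [_ [[c [d [ca [bd hcd]]]] _]] := shape.
apply: (@measurable_funS _ _ _ _ `]c, d[%classic).
- exact: measurable_itv.
- move=> x; rewrite /= !in_itv /= => /andP[x1 x2]; apply/andP; split; lra.
apply: measurable_funM.
  apply: measurable_funM => //.
  apply: open_continuous_measurable_fun => // x; rewrite inE /= in_itv /=.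
  exact: analytic_continuous_at.
apply: measurable_funTS; apply: continuous_measurable_fun => x.
apply: (@continuous_comp _ _ _ (fun x => (b - x) * (x - a)) Num.sqrt); last exact: sqrt_continuous.
by apply: cvgM; apply: cvgB; try exact: cvg_cst; exact: cvg_id.
Qed.

Lemma one_cut_mass u v : a <= u -> u <= v -> v <= b ->
  mu `[u, v]%classic = (\int[leb]_(x in `[u, v]%classic) (dens x)%:E)%E.
Proof.
move=> au uv vb; have [_ [_ [_ ->]]] := shape; last exact: measurable_itv.
congr integral; apply/seteqP; split => x /=; rewrite !in_itv /=; first by case.
by move=> /andP[x1 x2]; split; apply/andP; split; lra.
Qed.

Let cst_mass u v (k : R) : u <= v -> (\int[leb]_(x in `[u, v]%classic) k%:E = (k * (v - u))%:E)%E.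
Proof.
move=> uv; transitivity (k%:E * leb `[u, v]%classic)%E; first exact: integral_cst.
rewrite lebesgue_measure_itv /= lte_fin; case: ltP uv => // vu uv.
by rewrite (@le_anti _ _ u v) ?uv ?vu // subrr mulr0 mule0.
Qed.

Lemma one_cut_mass_ge u v k : a <= u -> u <= v -> v <= b -> 0 <= k ->
  (forall x, u <= x <= v -> k <= dens x) -> k * (v - u) <= fine (mu `[u, v]%classic).
Proof.
move=> au uv vb k0 hk.
rewrite -lee_fin fineK; last by apply: fin_num_measure; exact: measurable_itv.
rewrite one_cut_mass // -cst_mass //; apply: ge0_le_integral => //.
- apply/measurable_EFinP; apply: (measurable_funS _ _ one_cut_measurable) => //.
  by move=> x; rewrite /= !in_itv /= => /andP[x1 x2]; apply/andP; split; lra.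
Qed.

Lemma sqrt_ge_on u v x : a <= u -> v <= b -> u <= x <= v ->
  Num.sqrt ((b - v) * (u - a)) <= Num.sqrt ((b - x) * (x - a)).
Proof.
move=> au vb /andP[ux xv]; apply: ler_wsqrtr; apply: ler_pM; lra.
Qed.

(** A nonzero value of [h] on the support is positive: otherwise the density would be negative on a
    whole interval, to which [mu] would give negative mass. *)
Lemma density_pos x0 : a <= x0 <= b -> h x0 != 0 ->
  exists h1 d : R, 0 < h1 /\ 0 < d /\ forall x, a <= x <= b -> `|x - x0| < d -> h1 <= h x.
Proof.
move=> x0ab hx0; have [ab [[c [d [ca [bd hcd]]]] _]] := shape.
have hc : {for x0, continuous h} by apply: (analytic_continuous_at hcd); move: x0ab; lra.
have e0 : 0 < `|h x0| / 2 by rewrite divr_gt0 // normr_gt0.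
move/cvgrPdist_lt : hc => /(_ _ e0) /nbhs_ballP[e /= e1 he].
have he2 x : `|x - x0| < e -> `|h x0 - h x| < `|h x0| / 2 by move=> xe; apply: he; rewrite /ball /= distrC.
have [hp|hn] := ltP 0 (h x0).
  exists (h x0 / 2), e; split; first by rewrite divr_gt0.
  split => // x _ /he2; rewrite (gtr0_norm hp) ltr_norml; lra.
exfalso; have {hn} hn : h x0 < 0 by rewrite lt_neqAle hx0.
(* An interval strictly inside [[a, b]], where the square root factor is bounded below. *)
have [u [v [au [uv [vb hv]]]]] : exists u v, a < u /\ u < v /\ v < b /\ forall x, u <= x <= v -> `|x - x0| < e.
  pose w := Num.min (e / 2) ((b - a) / 2).
  have w0 : 0 < w by rewrite lt_min !divr_gt0 // subr_gt0.
  have w1 : w <= e / 2 by rewrite ge_min lexx.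
  have w2 : w <= (b - a) / 2 by rewrite ge_min lexx orbT.
  have [xm|xm] := leP x0 ((a + b) / 2).
    exists (x0 + w / 3), (x0 + w / 2).
    split; first lra. split; first lra. split; first lra.
    by move=> x /andP[x1 x2]; rewrite ltr_norml; apply/andP; split; lra.
  exists (x0 - w / 2), (x0 - w / 3).
  split; first lra. split; first lra. split; first lra.
  by move=> x /andP[x1 x2]; rewrite ltr_norml; apply/andP; split; lra.
pose q := Num.sqrt ((b - v) * (u - a)).
have q0 : 0 < q by rewrite sqrtr_gt0 mulr_gt0 //; lra.
pose k := (2 * pi)^-1 * (- h x0 / 2) * q.
have k0 : 0 < k by rewrite !mulr_gt0 ?invr_gt0 ?oppr_gt0.
have hk x : u <= x <= v -> k <= - dens x.
  move=> xuv; have := he2 _ (hv _ xuv); rewrite (ltr0_norm hn) ltr_norml => /andP[h1 h2].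
  rewrite /dens /k -mulNr -mulrN mul1r; apply: ler_pM.
  - by rewrite mulr_ge0 // ?invr_ge0 ?(ltW pi20) //; lra.
  - exact: ltW.
  - by rewrite ler_wpM2l ?invr_ge0 ?(ltW pi20) //; lra.
  - by apply: sqrt_ge_on => //; lra.
have : (0 <= mu `[u, v]%classic)%E by [].
rewrite one_cut_mass; [|lra..].
have -> : (\int[leb]_(x in `[u, v]%classic) (dens x)%:E = - \int[leb]_(x in `[u, v]%classic) (- dens x)%:E)%E.
  rewrite -integral_ge0N; first by apply: eq_integral => x _; rewrite -EFinN opprK.
  by move=> x; rewrite /= in_itv /= => /hk; rewrite lee_fin; apply: le_trans; exact: ltW.
apply/negP; rewrite -ltNge oppe_lt0; apply: (@lt_le_trans _ _ (k * (v - u))%:E).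
  by rewrite lte_fin mulr_gt0 // subr_gt0.
rewrite -cst_mass ?(ltW uv) //; apply: ge0_le_integral => //.
- by move=> x _; rewrite lee_fin ltW.
- apply/measurable_EFinP; apply: measurable_funN; apply: (measurable_funS _ _ one_cut_measurable) => //.
  by move=> x; rewrite /= !in_itv /= => /andP[x1 x2]; apply/andP; split; lra.
Qed.

(** The density is bounded below by the square root of the distance to the endpoint, hence the mass
    [sqrt t * t]. The windows keep away from the endpoint because of the density, and from [a + t]
    or [b - t] because the potential gap of the trial interval vanishes there. *)
Lemma endpoint_mass : h a != 0 -> h b != 0 ->
  exists k d : R, 0 < k /\ 0 < d /\ forall t, 0 < t < d ->
    k * (Num.sqrt t * t) <= fine (mu `[a + t / 4, a + t / 2]%classic) /\
    k * (Num.sqrt t * t) <= fine (mu `[b - t / 2, b - t / 4]%classic).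
Proof.
move=> ha hb; have ab := one_cut_lt.
have [|h1 [d1 [h10 [d10 hd1]]]] := density_pos _ ha; first by rewrite lexx ltW.
have [|h2 [d2 [h20 [d20 hd2]]]] := density_pos _ hb; first by rewrite lexx ltW.
pose hm := Num.min h1 h2; pose dm := Num.min (Num.min d1 d2) (b - a).
have hm0 : 0 < hm by rewrite lt_min h10.
have dm0 : 0 < dm by rewrite !lt_min d10 d20 subr_gt0.
have [hm1 hm2] : hm <= h1 /\ hm <= h2 by rewrite !ge_min !lexx orbT.
have [dm1 dm2 dm3] : [/\ dm <= d1, dm <= d2 & dm <= b - a] by rewrite /dm; split; rewrite !ge_min !lexx ?orbT.
pose S := Num.sqrt ((b - a) / 8).
have S0 : 0 < S by rewrite sqrtr_gt0 divr_gt0 // subr_gt0.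
exists ((2 * pi)^-1 * hm * S / 4), dm; split; first by rewrite !mulr_gt0 // invr_gt0.
split => // t /andP[t0 td].
have step x y (hx : R) : hm <= hx -> (b - a) / 2 <= x -> t / 4 <= y ->
    (2 * pi)^-1 * hm * S * Num.sqrt t <= 1 / (2 * pi) * hx * Num.sqrt (x * y).
  move=> hxm x1 y1; rewrite mul1r -mulrA -sqrtrM; last by rewrite divr_ge0 // subr_ge0 ltW.
  apply: ler_pM.
  - by rewrite mulr_ge0 ?invr_ge0 ?(ltW pi20) // ltW.
  - exact: sqrtr_ge0.
  - by rewrite ler_wpM2l // invr_ge0 ltW.
  - apply: ler_wsqrtr; have -> : (b - a) / 8 * t = (b - a) / 2 * (t / 4) by field.
    by apply: ler_pM => //; rewrite divr_ge0 // ?subr_ge0 ltW.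
have e : (2 * pi)^-1 * hm * S / 4 * (Num.sqrt t * t) = (2 * pi)^-1 * hm * S * Num.sqrt t * (t / 4).
  by move: (2 * pi)^-1 => p; field.
have k0 : 0 <= (2 * pi)^-1 * hm * S * Num.sqrt t.
  by rewrite !mulr_ge0 ?invr_ge0 ?(ltW pi20) ?(ltW hm0) ?(ltW S0) // sqrtr_ge0.
rewrite e; split.
- rewrite [X in _ * X <= _](_ : _ = (a + t / 2) - (a + t / 4)); last by field.
  apply: one_cut_mass_ge => //; try lra.
  move=> x /andP[x1 x2]; rewrite /dens; apply: step; try lra.
  by apply: le_trans hm1 _; apply: hd1; [lra|rewrite ltr_norml; lra].
- rewrite [X in _ * X <= _](_ : _ = (b - t / 4) - (b - t / 2)); last by field.
  apply: one_cut_mass_ge => //; try lra.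
  move=> x /andP[x1 x2]; rewrite /dens mulrC [(b - x) * _]mulrC -mulrC; apply: step; try lra.
  by apply: le_trans hm2 _; apply: hd2; [lra|rewrite ltr_norml; lra].
Qed.

End density.

(** * Arcsine measures as competitors *)

Section functional.
Context (R : realType) (V : R -> R) (B : R).
Hypothesis cV : continuous V.
Hypothesis VB : forall x, 4 * ln (1 + `|x|) - B <= V x.
Hypothesis B0 : 0 <= B.
Notation leb := (@lebesgue_measure R).
Notation K := (kerK V B).
Notation pot := (potK V B).
Notation en := (enK V B).
Implicit Types (mu nu : probability R R) (c r : R).

Definition Vmean c r : R := pi^-1 * fine (\int[leb]_(th in `[0%R, pi]) (V (c + r * cos th))%:E)%E.

(* Minus the Mhaskar-Saff functional of the interval [c - r, c + r]. *)
Definition MSF c r : R := Vmean c r / 2 - ln (r / 2).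

Lemma continuous_Vcos c r : continuous (fun th => V (c + r * cos th)).
Proof.
move=> th; apply: (@continuous_comp _ _ _ (fun th => c + r * cos th) V); last exact: cV.
apply: cvgD; first exact: cvg_cst.
by apply: cvgM; [exact: cvg_cst|exact: continuous_cos].
Qed.

Lemma VmeanE c r :
  (\int[leb]_(th in `[0%R, pi]) (V (c + r * cos th))%:E = (pi * Vmean c r)%:E)%E.
Proof.
rewrite /Vmean mulrA mulfV ?gt_eqF ?pi_gt0 // mul1r fineK //.
have := cont_integrable 0 pi (@continuous_Vcos c r).
exact: integrable_fin_num.
Qed.

(** On its interval an arcsine measure has potential [MSF + hV]. This part does not depend on the
    interval, so its integral against [mu] cancels when two intervals are compared. *)
Definition hV (y : R) : R := V y / 2 + B.

Lemma hV_ge0 y : 0 <= hV y.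
Proof. have h : 0 <= ln (1 + `|y|) by rewrite ln_ge0 // lerDl.
have h2 := VB y; rewrite /hV; move: h2 h; set l := ln _ => h2 h; move: B0; lra. Qed.

Lemma continuous_hV : continuous hV.
Proof.
move=> y; apply: cvgD; last exact: cvg_cst.
by apply: cvgM; [exact: cV|exact: cvg_cst].
Qed.

Lemma measurable_hV : measurable_fun setT (EFin \o hV).
Proof. by apply/measurable_EFinP; apply: continuous_measurable_fun; exact: continuous_hV. Qed.

Lemma pot_arcsine c r y (l : R) : 0 < r ->
  leb.-integrable `[0, pi] (fun th => nlog (c + r * cos th - y)) ->
  (\int[leb]_(th in `[0%R, pi]) nlog (c + r * cos th - y) = (pi * l)%:E)%E ->
  pot (arcsine c r) y = (l + Vmean c r / 2 + hV y)%:E.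
Proof.
move=> r0 il el; rewrite /potK integral_arcsine; last 2 first.
- exact: measurable_kerKl.
- by move=> x; exact: kerK_ge0.
have p0 := pi_gt0 R.
have iV : leb.-integrable `[0, pi] (fun th => (2^-1)%:E * (V (c + r * cos th))%:E)%E.
  by apply: integrableZl => //; exact: cont_integrable 0 pi (@continuous_Vcos c r).
have ic : leb.-integrable `[0, pi] (fun th : R => (hV y)%:E).
  by apply: (@cont_integrable _ (cst (hV y))) => x; exact: cvg_cst.
have e th : K y (c + r * cos th) =
   (nlog (c + r * cos th - y) + ((2^-1)%:E * (V (c + r * cos th))%:E + (hV y)%:E))%E.
  rewrite /kerK energy_kernelE -nlogN opprB -addeA; congr (_ + _)%E.
  by rewrite -EFinM -!EFinD; congr EFin; rewrite /hV; ring.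
under eq_integral do rewrite e.
rewrite integralD //; last exact: integrableD.
rewrite integralD // el integralZl //; last exact: cont_integrable 0 pi (@continuous_Vcos c r).
have -> := VmeanE c r; have -> := int_cst_pi (hV y).
transitivity (pi^-1 * (pi * l + (2^-1 * (pi * Vmean c r) + pi * hV y)))%:E; first by [].
have pn : pi != 0 :> R by rewrite gt_eqF.
congr EFin; move: pn; move: (pi : R) (Vmean c r) (hV y) => p m h pn; field.
exact: pn.
Qed.

Lemma pot_arcsine_in c r y : 0 < r -> `|y - c| <= r ->
  pot (arcsine c r) y = (MSF c r + hV y)%:E.
Proof.
move=> r0 yr; have [h1 h2] := arcsine_log_in r0 yr.
by rewrite (pot_arcsine r0 h1 h2); congr EFin; rewrite /MSF; ring.
Qed.

Lemma pot_arcsine_out c r y : 0 < r -> r < `|y - c| ->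
  (pot (arcsine c r) y + (Num.sqrt (1 - r / `|y - c|))%:E <= (MSF c r + hV y)%:E)%E.
Proof.
move=> r0 yr; have [h1 [g gs h2]] := arcsine_log_out r0 yr.
rewrite (pot_arcsine r0 h1 h2) -EFinD lee_fin /MSF; lra.
Qed.

Lemma pot_arcsine_le c r y : 0 < r -> (pot (arcsine c r) y <= (MSF c r + hV y)%:E)%E.
Proof.
move=> r0; have [yr|yr] := leP `|y - c| r; first by rewrite pot_arcsine_in.
apply: le_trans (pot_arcsine_out r0 yr); rewrite leeDl // lee_fin sqrtr_ge0 //.
Qed.

Lemma en_arcsine c r : 0 < r -> (en (arcsine c r) (arcsine c r) < +oo)%E.
Proof.
move=> r0; rewrite /enK -/(pot (arcsine c r)) integral_arcsine; last 2 first.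
- exact: measurable_potK.
- by move=> x; exact: potK_ge0.
have e th : pot (arcsine c r) (c + r * cos th) = (MSF c r + hV (c + r * cos th))%:E.
  apply: pot_arcsine_in => //; rewrite addrC addKr normrM gtr0_norm //.
  by rewrite ler_piMr ?(ltW r0) // ler_norml cos_geN1 cos_le1.
have -> : (\int[leb]_(th in `[0%R, pi]) pot (arcsine c r) (c + r * cos th)%R = \int[leb]_(th in `[0%R, pi]) (MSF c r + hV (c + r * cos th)%R)%:E)%E.
  by apply: eq_integral => th _; exact: e.
have ci : leb.-integrable `[0, pi] (EFin \o (fun th => MSF c r + hV (c + r * cos th))).
  apply: cont_integrable => th; apply: cvgD; first exact: cvg_cst.
  apply: (@continuous_comp _ _ _ (fun th => c + r * cos th) hV); last exact: continuous_hV.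
  apply: cvgD; first exact: cvg_cst.
  by apply: cvgM; [exact: cvg_cst|exact: continuous_cos].
have fi : (\int[leb]_(th in `[0%R, pi]) (MSF c r + hV (c + r * cos th)%R)%:E \is a fin_num)%E by exact: integrable_fin_num ci.
by rewrite -(fineK fi) -EFinM ltry.
Qed.

Lemma equilibrium_en_fin mu : is_equilibrium_measure V mu -> (en mu mu < +oo)%E.
Proof.
by move=> eq; apply: le_lt_trans (equilibrium_enK cV VB (arcsine 0 1) eq) (en_arcsine _ ltr01).
Qed.

(** * Trial intervals compared with the support *)

Section interval_support.
Variables (mu : probability R R) (a b : R).
Hypothesis eqm : is_equilibrium_measure V mu.
Hypothesis ab : a < b.
Hypothesis supp : msupport mu = `[a, b]%classic.
Hypothesis out : mu (~` `[a, b]%classic) = 0%E.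
Local Notation c := ((a + b) / 2).
Local Notation r := ((b - a) / 2).
Local Notation J := (\int[mu]_y (hV y)%:E)%E.

Let r0 : 0 < r. Proof. by rewrite divr_gt0 // subr_gt0. Qed.

Let mab : measurable (`[a, b]%classic : set R). Proof. exact: measurable_itv. Qed.

Lemma integral_interval_support (f : R -> \bar R) : measurable_fun setT f -> (forall x, 0 <= f x)%E ->
  (\int[mu]_x f x = \int[mu]_(x in `[a, b]%classic) f x)%E.
Proof.
move=> mf f0; rewrite -{1}(setUv `[a, b]%classic) ge0_integral_setU //.
- rewrite [X in (_ + X)%E](_ : _ = 0%E) ?adde0 //.
  apply: null_set_integral => //.
  + by apply: measurableC.
  + by apply: measurable_funTS.
- exact: measurableC.
- by rewrite setUv.
- by apply/disj_setPS => y [].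
Qed.

Lemma integral_add_cst (f : R -> \bar R) (k : R) : measurable_fun setT f -> (forall x, 0 <= f x)%E ->
  0 <= k -> (\int[mu]_x (f x + k%:E) = \int[mu]_x f x + k%:E)%E.
Proof.
move=> mf f0 k0; rewrite ge0_integralD //; congr (_ + _)%E.
transitivity (k%:E * mu setT)%E; first exact: integral_cst.
by rewrite probability_setT mule1.
Qed.

(** [M] has no sign, so [|M|] is added to both sides in order to integrate nonnegative functions
    only. *)
Lemma integral_le_cst_add (f : R -> \bar R) (g : R -> R) (M : R) :
  measurable_fun setT f -> (forall x, 0 <= f x)%E ->
  measurable_fun setT (EFin \o g) -> (forall x, 0 <= g x) ->
  (forall x, a <= x <= b -> (f x <= (M + g x)%:E)%E) ->
  (\int[mu]_x f x <= M%:E + \int[mu]_x (g x)%:E)%E.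
Proof.
move=> mf f0 mg g0 fg.
have mfk : measurable_fun setT (fun x => f x + `|M|%:E)%E by apply: emeasurable_funD.
have mgk : measurable_fun setT (fun x => (g x)%:E + (M + `|M|)%:E)%E by apply: emeasurable_funD.
have Mk0 : 0 <= M + `|M| by rewrite -lerBlDl sub0r ler_normr lexx orbT.
have e1 : (\int[mu]_x (f x + `|M|%:E) = \int[mu]_x f x + `|M|%:E)%E.
  exact: integral_add_cst.
have e2 : (\int[mu]_x ((g x)%:E + (M + `|M|)%:E) = \int[mu]_x (g x)%:E + (M + `|M|)%:E)%E.
  by apply: integral_add_cst => // x; rewrite lee_fin.
have le : (\int[mu]_x (f x + `|M|%:E) <= \int[mu]_x ((g x)%:E + (M + `|M|)%:E))%E.
  rewrite integral_interval_support //; last by move=> x; rewrite adde_ge0.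
  rewrite [leRHS]integral_interval_support //; last by move=> x; rewrite adde_ge0 // lee_fin.
  apply: ge0_le_integral => //.
  - by move=> x _; rewrite adde_ge0.
  - exact: measurable_funTS.
  - exact: measurable_funTS.
  - move=> x; rewrite /= in_itv /= => xab.
    have -> : ((g x)%:E + (M + `|M|)%:E = (M + g x)%:E + `|M|%:E)%E by rewrite -!EFinD; congr EFin; ring.
    by rewrite leeD2r // fg.
move: le; rewrite e1 e2 EFinD addeA leeD2rE // addeC.
by [].
Qed.

Lemma cst_add_le_integral (f : R -> \bar R) (g : R -> R) (M : R) :
  measurable_fun setT f -> (forall x, 0 <= f x)%E ->
  measurable_fun setT (EFin \o g) -> (forall x, 0 <= g x) ->
  (forall x, a <= x <= b -> ((M + g x)%:E <= f x)%E) ->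
  (M%:E + \int[mu]_x (g x)%:E <= \int[mu]_x f x)%E.
Proof.
move=> mf f0 mg g0 fg.
have mfk : measurable_fun setT (fun x => f x + `|M|%:E)%E by apply: emeasurable_funD.
have mgk : measurable_fun setT (fun x => (g x)%:E + (M + `|M|)%:E)%E by apply: emeasurable_funD.
have Mk0 : 0 <= M + `|M| by rewrite -lerBlDl sub0r ler_normr lexx orbT.
have e1 : (\int[mu]_x (f x + `|M|%:E) = \int[mu]_x f x + `|M|%:E)%E.
  exact: integral_add_cst.
have e2 : (\int[mu]_x ((g x)%:E + (M + `|M|)%:E) = \int[mu]_x (g x)%:E + (M + `|M|)%:E)%E.
  by apply: integral_add_cst => // x; rewrite lee_fin.
have le : (\int[mu]_x ((g x)%:E + (M + `|M|)%:E) <= \int[mu]_x (f x + `|M|%:E))%E.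
  rewrite integral_interval_support //; last by move=> x; rewrite adde_ge0 // lee_fin.
  rewrite [leRHS]integral_interval_support //; last by move=> x; rewrite adde_ge0.
  apply: ge0_le_integral => //.
  - by move=> x _; rewrite adde_ge0 // lee_fin.
  - exact: measurable_funTS.
  - exact: measurable_funTS.
  - move=> x; rewrite /= in_itv /= => xab.
    have -> : ((g x)%:E + (M + `|M|)%:E = (M + g x)%:E + `|M|%:E)%E by rewrite -!EFinD; congr EFin; ring.
    by rewrite leeD2r // fg.
move: le; rewrite e1 e2 EFinD addeA leeD2rE // addeC.
by [].
Qed.

Let Ef : (en mu mu < +oo)%E. Proof. exact: equilibrium_en_fin. Qed.

Let Efin : en mu mu \is a fin_num. Proof. by rewrite ge0_fin_numE // enK_ge0. Qed.

Lemma integral_potK_arcsine c' r' : (\int[arcsine c' r']_x pot mu x = \int[mu]_y pot (arcsine c' r') y)%E.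
Proof. exact: fubini_kerK. Qed.

Lemma en_le_pot_arcsine c' r' : 0 < r' -> (en mu mu <= \int[mu]_y pot (arcsine c' r') y)%E.
Proof.
move=> r'0; rewrite -integral_potK_arcsine.
exact: (equilibrium_potK cV VB eqm Ef (en_arcsine c' r'0)).
Qed.

Lemma pot_le_MSF c' r' : 0 < r' ->
  (forall x, `|x - c'| <= r' -> (pot mu x <= en mu mu)%E) ->
  (\int[mu]_y pot (arcsine c' r') y <= en mu mu)%E.
Proof.
move=> r'0 h; rewrite -integral_potK_arcsine integral_arcsine; last 2 first.
- exact: measurable_potK.
- by move=> x; exact: potK_ge0.
have -> : en mu mu = ((pi^-1)%:E * \int[leb]_(th in `[0%R, pi]) (fine (en mu mu))%:E)%E.
  rewrite int_cst_pi -EFinM mulrA mulVf ?gt_eqF ?pi_gt0 // mul1r fineK //.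
rewrite lee_pmul2l //; last by rewrite lte_fin invr_gt0 pi_gt0.
apply: ge0_le_integral => //.
- by move=> x _; exact: potK_ge0.
- apply: measurable_funTS; apply: measurableT_comp; first exact: measurable_potK.
  apply: measurable_funD => //; apply: measurable_funM => //.
  by apply: continuous_measurable_fun; exact: continuous_cos.
- move=> th _; rewrite fineK //; apply: h; rewrite addrC addKr normrM gtr0_norm //.
  by rewrite ler_piMr ?(ltW r'0) // ler_norml cos_geN1 cos_le1.
Qed.

Lemma norm_center x : (`|x - c| <= r) = (a <= x <= b).
Proof. by rewrite ler_norml; apply/idP/idP => /andP[h1 h2]; apply/andP; split; lra. Qed.

Lemma MSF_le_en c' r' : 0 < r' -> (forall x, a <= x <= b -> `|x - c'| <= r') ->
  (forall x, `|x - c'| <= r' -> (pot mu x <= en mu mu)%E) ->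
  ((MSF c' r')%:E + J <= en mu mu)%E.
Proof.
move=> r'0 sub h; apply: le_trans (pot_le_MSF r'0 h).
apply: cst_add_le_integral.
- exact: measurable_potK.
- by move=> x; exact: potK_ge0.
- exact: measurable_hV.
- exact: hV_ge0.
- by move=> x /sub xr; rewrite pot_arcsine_in.
Qed.

Lemma MSF_own_le : ((MSF c r)%:E + J <= en mu mu)%E.
Proof.
apply: MSF_le_en => // [x|x]; first by rewrite norm_center.
rewrite norm_center => xab; apply: (potK_le_support cV VB eqm Ef Ef) => //.
by rewrite supp /= in_itv.
Qed.

Lemma J_fin : J \is a fin_num.
Proof.
rewrite ge0_fin_numE; last by apply: integral_ge0 => x _; rewrite lee_fin hV_ge0.
have := le_lt_trans MSF_own_le Ef; by case: (J) => [j| |] //; rewrite ltey.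
Qed.

(** By Tonelli, the first variation in the direction of an arcsine measure bounds the energy by the
    [mu]-mean of the arcsine potential, which is at most [MSF + hV] everywhere and lower by at least
    [m] on [S]. *)
Lemma en_le_MSF (S : set R) (m : R) c' r' : 0 < r' -> measurable S -> 0 <= m ->
  (forall y, S y -> r' < `|y - c'| /\ m <= Num.sqrt (1 - r' / `|y - c'|)) ->
  (en mu mu + m%:E * mu S <= (MSF c' r')%:E + J)%E.
Proof.
move=> r'0 mS m0 hS.
have mI : measurable_fun setT (fun y : R => m%:E * (\1_S y)%:E)%E.
  by apply: emeasurable_funM => //; apply/measurable_EFinP; exact: measurable_indic.
apply: (@le_trans _ _ (\int[mu]_y (pot (arcsine c' r') y + m%:E * (\1_S y)%:E))%E).
  rewrite ge0_integralD //.
  - apply: leeD; first exact: en_le_pot_arcsine.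
    rewrite ge0_integralZl //; last by apply/measurable_EFinP; exact: measurable_indic.
    by rewrite integral_indic // setIT.
  - by move=> x _; exact: potK_ge0.
  - exact: measurable_potK.
  - by move=> x _; rewrite -EFinM lee_fin mulr_ge0.
apply: integral_le_cst_add.
- by apply: emeasurable_funD => //; exact: measurable_potK.
- by move=> x; rewrite adde_ge0 ?potK_ge0 // -EFinM lee_fin mulr_ge0.
- exact: measurable_hV.
- exact: hV_ge0.
- move=> y _; rewrite indicE; case: (boolP (y \in S)) => [/set_mem/hS [h1 h2]|_].
    rewrite mule1; apply: le_trans (pot_arcsine_out r'0 h1).
    by rewrite leeD2l // lee_fin.
  by rewrite mule0 adde0 pot_arcsine_le.
Qed.

(** [MSF_own_le] and [en_le_MSF] sandwich the energy, and the finite terms [J] cancel. An empty [S]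
    gives minimality, a window near an endpoint gives growth, a neighbourhood of a missed point of
    the support gives inclusion. *)
Lemma MSF_ge_mass (S : set R) (m : R) c' r' : 0 < r' -> measurable S -> 0 <= m ->
  (forall y, S y -> r' < `|y - c'| /\ m <= Num.sqrt (1 - r' / `|y - c'|)) ->
  MSF c r + m * fine (mu S) <= MSF c' r'.
Proof.
move=> r'0 mS m0 hS.
have h1 := MSF_own_le; have h2 := en_le_MSF r'0 mS m0 hS.
move: h1 h2; rewrite -(fineK J_fin) -(fineK Efin) -(@fineK _ (mu S)) ?fin_num_measure //.
by rewrite -EFinM -!EFinD !lee_fin; lra.
Qed.

Lemma MSF_min c' r' : 0 < r' -> MSF c r <= MSF c' r'.
Proof.
move=> r'0; have := @MSF_ge_mass set0 0 c' r' r'0 measurable0 (lexx _).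
by rewrite measure0 mulr0 addr0; apply => y.
Qed.

(** The arcsine measure of another minimizing interval has cross energy with [mu] at most the energy
    of [mu], so [potK_le_support] applies on its support, the full interval. *)
Lemma minimizer_pot_le c' r' : 0 < r' -> MSF c' r' <= MSF c r ->
  forall x, `|x - c'| <= r' -> (pot mu x <= en mu mu)%E.
Proof.
move=> r'0 hm x xr.
apply: (potK_le_support cV VB eqm Ef (en_arcsine c' r'0)).
  rewrite /enK -/(potK V B mu) integral_potK_arcsine; apply: le_trans MSF_own_le.
  apply: (@le_trans _ _ ((MSF c' r')%:E + J)%E); last by rewrite leeD2r // lee_fin.
  apply: integral_le_cst_add => //.
  - exact: measurable_potK.
  - by move=> y; exact: potK_ge0.
  - exact: measurable_hV.
  - exact: hV_ge0.
  - by move=> y _; exact: pot_arcsine_le.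
by move=> e e0; exact: arcsine_itv_gt0.
Qed.

Lemma minimizer_sub c' r' x : 0 < r' -> MSF c' r' <= MSF c r -> a <= x <= b -> `|x - c'| <= r'.
Proof.
move=> r'0 hm xab; rewrite leNgt; apply/negP => hx.
pose e := (`|x - c'| - r') / 2.
have e0 : 0 < e by rewrite /e divr_gt0 // subr_gt0.
have mus : (0 < mu `](x - e)%R, (x + e)%R[%classic)%E.
  suff : msupport mu x by apply.
  by rewrite supp /= in_itv.
pose m := Num.sqrt (1 - r' / (r' + e)).
have m0 : 0 < m.
  by rewrite sqrtr_gt0 subr_gt0 ltr_pdivrMr ?addr_gt0 // mul1r ltrDl.
have key := @MSF_ge_mass `](x - e)%R, (x + e)%R[%classic m c' r' r'0 (measurable_itv _) (ltW m0).
have : MSF c r < MSF c r; last by rewrite ltxx.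
apply: lt_le_trans hm; apply: lt_le_trans (key _).
  by rewrite ltrDl mulr_gt0 // fine_gt0 // mus ltey_eq fin_num_measure.
move=> y; rewrite /= in_itv /= => ye.
have hy : r' + e < `|y - c'|.
  have h1 : `|x - c'| <= `|x - y| + `|y - c'|.
    by apply: le_trans (ler_normD _ _); rewrite addrA subrK.
  have h2 : `|x - y| < e by rewrite ltr_norml; lra.
  by move: h1 h2; rewrite /e; lra.
split; first by apply: lt_trans hy; rewrite ltrDl.
apply: ler_wsqrtr; rewrite lerD2l lerN2 ler_pM2l // lef_pV2 ?posrE ?(ltW hy) //.
  by apply: lt_trans hy; rewrite addr_gt0.
by rewrite addr_gt0.
Qed.

(** The equilibrium potential is at most the energy on the larger interval, hence on the
    intermediate one, which also contains the support: [MSF_le_en] applies to it. *)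
Lemma minimizer_between c' r' c2 r2 : 0 < r' -> 0 < r2 -> MSF c' r' <= MSF c r ->
  (forall x, a <= x <= b -> `|x - c2| <= r2) -> (forall x, `|x - c2| <= r2 -> `|x - c'| <= r') ->
  MSF c2 r2 <= MSF c r.
Proof.
move=> r'0 r20 hm sub1 sub2.
have h1 : ((MSF c2 r2)%:E + J <= en mu mu)%E.
  by apply: MSF_le_en => // x /sub2; exact: minimizer_pot_le.
have h2 := @en_le_MSF set0 0 c r r0 measurable0 (lexx _) (fun y (h : set0 y) => match h with end).
move: h1 h2; rewrite measure0 mule0 adde0 => h1 h2.
by move: (le_trans h1 h2); rewrite leeD2rE ?J_fin // lee_fin.
Qed.

(** Another minimizer contains [[a, b]], so the intervals on the segment joining the two pairs
    (centre, half-length) lie in between and are minimizers too; some are arbitrarily close to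
    [(c, r)], against strict local minimality. *)
Lemma minimizer_unique c' r' : 0 < r' -> MSF c' r' <= MSF c r ->
  (exists2 d, 0 < d & forall x y, `|x| < d -> `|y| < d -> (x != 0) || (y != 0) ->
     MSF c r < MSF (c + x) (r + y)) -> c' = c /\ r' = r.
Proof.
move=> r'0 hm [d d0 hd].
have hs := minimizer_sub r'0 hm.
have := hs a; rewrite lexx (ltW ab) /= ler_norml => /(_ isT) ha.
have := hs b; rewrite lexx (ltW ab) /= ler_norml => /(_ isT) hb.
have [//|ne] := pselect (c' = c /\ r' = r).
pose s := Num.min 1 (d / 2 / (1 + `|c' - c| + `|r' - r|)).
have D0 : 0 < 1 + `|c' - c| + `|r' - r| by rewrite -addrA ltr_wpDr // addr_ge0.
have s0 : 0 < s by rewrite lt_min ltr01 /= !divr_gt0.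
have s1 : s <= 1 by rewrite ge_min lexx.
have sd z : `|z| <= `|c' - c| + `|r' - r| -> `|s * z| < d.
  move=> hz; rewrite normrM (gtr0_norm s0).
  have : s * (1 + `|c' - c| + `|r' - r|) <= d / 2.
    by rewrite -ler_pdivlMr // ge_min lexx orbT.
  have := ler_wpM2l (ltW s0) hz.
  move: d0; lra.
have lt : MSF c r < MSF (c + s * (c' - c)) (r + s * (r' - r)).
  apply: hd.
  - by apply: sd; rewrite lerDl.
  - by apply: sd; rewrite lerDr.
  - rewrite !mulf_eq0 !(gt_eqF s0) /= !subr_eq0 -negb_and; apply/negP => /andP[/eqP h1 /eqP h2].
    exact: ne.
suff : MSF (c + s * (c' - c)) (r + s * (r' - r)) <= MSF c r by rewrite leNgt lt.
have ss : 0 <= 1 - s by rewrite subr_ge0.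
case/andP: ha => ha1 ha2; case/andP: hb => hb1 hb2.
have p1 : 0 <= s * (a - c' + r') by rewrite mulr_ge0 ?(ltW s0) //; lra.
have p2 : 0 <= s * (c' + r' - b) by rewrite mulr_ge0 ?(ltW s0) //; lra.
have p3 : 0 <= (1 - s) * (a - c' + r') by rewrite mulr_ge0 //; lra.
have p4 : 0 <= (1 - s) * (c' + r' - b) by rewrite mulr_ge0 //; lra.
apply: (minimizer_between r'0 _ hm).
- have : 0 < (1 - s) * r + s * r'.
    have [->|sn] := eqVneq s 1; first by rewrite subrr mul0r mul1r add0r.
    by rewrite ltr_pwDl // ?mulr_ge0 ?(ltW r'0) ?(ltW s0) // mulr_gt0 // subr_gt0 lt_neqAle sn.
  by congr (0 < _); ring.
- move=> x /andP[x1 x2]; rewrite ler_norml; apply/andP; split; lra.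
- move=> x; rewrite !ler_norml => /andP[x1 x2]; apply/andP; split; lra.
Qed.

End interval_support.

(** * Quadratic growth for inward moves *)

Section growth.
Variables (mu : probability R R) (a b : R) (h : R -> R).
Hypothesis eqm : is_equilibrium_measure V mu.
Hypothesis shape : one_cut_shape mu a b h.
Hypothesis ha : h a != 0.
Hypothesis hb : h b != 0.
Local Notation c := ((a + b) / 2).
Local Notation r := ((b - a) / 2).

Lemma MSF_growth : exists k rho : R, [/\ 0 < k, 0 < rho, rho < r & forall x y, `|x| < rho -> `|y| < rho ->
  (y <= x -> MSF c r + k * (x - y) ^+ 2 <= MSF (c + x) (r + y)) /\
  (x + y <= 0 -> MSF c r + k * (x + y) ^+ 2 <= MSF (c + x) (r + y))].
Proof.
have ab := one_cut_lt shape; have supp := one_cut_support shape; have out := one_cut_outside shape.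
have [k [d [k0 [d0 hk]]]] := endpoint_mass shape ha hb.
have r0 : 0 < r by rewrite divr_gt0 // subr_gt0.
pose rho := Num.min (d / 4) (r / 2).
have rho0 : 0 < rho by rewrite lt_min; apply/andP; split; rewrite divr_gt0.
have rhod : rho <= d / 4 by rewrite ge_min lexx.
have rhor : rho <= r / 2 by rewrite ge_min lexx orbT.
have R0 : 0 < 8 * r by rewrite mulr_gt0.
(* A lower bound for the gap on the window, where [D - r' >= t / 2] and [D <= 4 * r]. Times a mass
   of order [sqrt t * t], it yields [t ^+ 2]. *)
pose m t : R := Num.sqrt (t / (8 * r)).
have mE t : 0 < t -> m t * (k * (Num.sqrt t * t)) = k * Num.sqrt (8 * r)^-1 * t ^+ 2.
  move=> t0; rewrite /m sqrtrM ?(ltW t0) //.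
  have tt : Num.sqrt t * Num.sqrt t = t by rewrite -expr2 sqr_sqrtr // ltW.
  transitivity (k * Num.sqrt (8 * r)^-1 * (Num.sqrt t * Num.sqrt t * t)); first by ring.
  by rewrite tt expr2.
have mm t r' D : 0 < t -> t < d -> t < r * 2 -> 0 < r' -> r' < 2 * r -> r' + t / 2 <= D -> D <= r' + t ->
    m t <= Num.sqrt (1 - r' / D).
  move=> t0 td tr r'0 r'r D1 D2; apply: ler_wsqrtr.
  have D0 : 0 < D by lra.
  have -> : 1 - r' / D = (D - r') / D by field; rewrite gt_eqF.
  rewrite ler_pdivrMr // mulrAC ler_pdivlMr //.
  have : (t / 2) * (8 * r) <= (D - r') * (8 * r) by rewrite ler_pM2r //; lra.
  have : t * D <= t * (4 * r) by rewrite ler_pM2l //; lra.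
  lra.
exists (k * Num.sqrt (8 * r)^-1), rho; split => //.
- by rewrite mulr_gt0 // sqrtr_gt0 invr_gt0.
- lra.
move=> x y; rewrite !ltr_norml => /andP[x1 x2] /andP[y1 y2].
have r'0 : 0 < r + y by lra.
split=> [|].
- rewrite le_eqVlt => /orP[/eqP ->|yx].
    by rewrite subrr expr0n mulr0 addr0; apply: (MSF_min eqm ab supp out); lra.
  have [t tE] : exists t, t = x - y by exists (x - y).
  rewrite -tE; have t0 : 0 < t by rewrite tE subr_gt0.
  have [td tr] : t < d /\ t < r * 2 by split; lra.
  rewrite -mE //; have [hm _] := hk t (introT andP (conj t0 td)).
  apply: le_trans (MSF_ge_mass eqm ab supp out (S := `[a + t / 4, a + t / 2]%classic) (m := m t) r'0 _ _ _).
  + by rewrite lerD2l ler_wpM2l // sqrtr_ge0.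
  + exact: measurable_itv.
  + exact: sqrtr_ge0.
  + move=> z; rewrite /= in_itv /= => /andP[z1 z2].
    have -> : `|z - (c + x)| = c + x - z by rewrite distrC ger0_norm //; lra.
    split; first lra.
    by apply: mm => //; lra.
- rewrite le_eqVlt => /orP[/eqP ->|yx].
    by rewrite expr0n mulr0 addr0; apply: (MSF_min eqm ab supp out).
  have [t tE] : exists t, t = - (x + y) by exists (- (x + y)).
  have -> : (x + y) ^+ 2 = t ^+ 2 by rewrite tE sqrrN.
  have t0 : 0 < t by rewrite tE oppr_gt0.
  have [td tr] : t < d /\ t < r * 2 by split; lra.
  rewrite -mE //; have [_ hm] := hk t (introT andP (conj t0 td)).
  apply: le_trans (MSF_ge_mass eqm ab supp out (S := `[b - t / 2, b - t / 4]%classic) (m := m t) r'0 _ _ _).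
  + by rewrite lerD2l ler_wpM2l // sqrtr_ge0.
  + exact: measurable_itv.
  + exact: sqrtr_ge0.
  + move=> z; rewrite /= in_itv /= => /andP[z1 z2].
    have -> : `|z - (c + x)| = z - (c + x) by rewrite ger0_norm //; lra.
    split; first lra.
    by apply: mm => //; lra.
Qed.

End growth.

End functional.

(** * Uniqueness of the equilibrium measure *)

Section positive_definite.
Local Open Scope ereal_scope.
Context d (W : measurableType d) (R : realType) (m : {sigma_finite_measure set W -> \bar R}).
Variable phi : W * R -> R.
Hypothesis mphi : measurable_fun setT phi.
Hypothesis phi0 : forall p, (0 <= phi p)%R.
Implicit Types mu nu : probability R R.

(** The Gram kernel of the functions [phi (., x)] in L2. Its energy at [mu] is the squared norm of
    [moment mu], whence positive definiteness. *)
Definition gram x y : \bar R := \int[m]_w (phi (w, x) * phi (w, y))%:E.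
Definition moment mu w : \bar R := \int[mu]_x (phi (w, x))%:E.

Lemma moment_ge0 mu w : 0 <= moment mu w.
Proof. by apply: integral_ge0 => x _; rewrite lee_fin. Qed.

Lemma measurable_moment mu : measurable_fun setT (moment mu).
Proof.
apply: (@measurable_fun_fubini_tonelli_F _ _ _ _ _ mu (fun p => (phi p)%:E)).
  by apply/measurable_EFinP.
by move=> p; rewrite lee_fin.
Qed.

Lemma measurable_phi_sect w : measurable_fun setT (fun x => (phi (w, x))%:E).
Proof. by apply/measurable_EFinP; apply: (measurableT_comp mphi); exact: measurable_fun_pair. Qed.

Lemma measurable_gram : measurable_fun setT (fun p : R * R => gram p.1 p.2).
Proof.
apply: (@measurable_fun_fubini_tonelli_F _ _ _ _ _ m
  (fun q : (R * R) * W => (phi (q.2, q.1.1) * phi (q.2, q.1.2))%:E)).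
  apply/measurable_EFinP; apply: measurable_funM; apply: (measurableT_comp mphi);
    apply: measurable_fun_pair => //; exact: measurableT_comp.
by move=> q; rewrite lee_fin mulr_ge0.
Qed.

Lemma gram_ge0 x y : 0 <= gram x y.
Proof. by apply: integral_ge0 => w _; rewrite lee_fin mulr_ge0. Qed.

Lemma measurable_gram_sect x : measurable_fun setT (gram x).
Proof. exact: (measurableT_comp measurable_gram (measurable_pair1 x)). Qed.

Lemma measurable_int_gram nu : measurable_fun setT (fun x => \int[nu]_y gram x y).
Proof.
apply: (@measurable_fun_fubini_tonelli_F _ _ _ _ _ nu (fun q : R * R => gram q.1 q.2)).
  exact: measurable_gram.
by move=> q; exact: gram_ge0.
Qed.

Lemma gram_moment mu nu :
  \int[mu]_x \int[nu]_y gram x y = \int[m]_w (moment mu w * moment nu w).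
Proof.
have st1 x : \int[nu]_y gram x y = \int[m]_w ((phi (w, x))%:E * moment nu w).
  rewrite /gram.
  have := @fubini_tonelli _ _ _ _ _ nu m (fun p : R * W => (phi (p.2, x) * phi (p.2, p.1))%:E).
  move=> /= ->.
  - apply: eq_integral => w _; rewrite /moment -ge0_integralZl_EFin //.
    + by move=> y _; rewrite lee_fin.
    + exact: measurable_phi_sect.
  - apply/measurable_EFinP; apply: measurable_funM; apply: (measurableT_comp mphi);
      exact: measurable_fun_pair.
  - by move=> p; rewrite lee_fin mulr_ge0.
under eq_integral do rewrite st1.
have := @fubini_tonelli _ _ _ _ _ mu m (fun p : R * W => (phi (p.2, p.1))%:E * moment nu p.2).
move=> /= ->.
- apply: eq_integral => w _; rewrite ge0_integralZr //.
  + exact: measurable_phi_sect.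
  + by move=> y _; rewrite lee_fin.
  + exact: moment_ge0.
- apply: emeasurable_funM; last by apply: (measurableT_comp (measurable_moment nu)).
  apply/measurable_EFinP; apply: (measurableT_comp mphi); exact: measurable_fun_pair.
- by move=> p; rewrite mule_ge0 ?lee_fin // moment_ge0.
Qed.

Lemma lee_2mul (a b : \bar R) : 0 <= a -> 0 <= b -> a * b + a * b <= a * a + b * b.
Proof.
case: a => [a| |] //; case: b => [b| |] // a0 b0.
- by rewrite -!EFinM -!EFinD lee_fin; have := sqr_ge0 (a - b)%R; lra.
- by rewrite mulyy addey ?leey // -EFinM.
- by rewrite mulyy addye ?leey // -EFinM.
Qed.

Lemma moment_mul_ge0 mu nu : 0 <= \int[m]_w (moment mu w * moment nu w).
Proof. by apply: integral_ge0 => w _; rewrite mule_ge0 // moment_ge0. Qed.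

Lemma gram_cross_le mu nu :
  \int[m]_w (moment mu w * moment nu w) + \int[m]_w (moment mu w * moment nu w) <=
  \int[m]_w (moment mu w * moment mu w) + \int[m]_w (moment nu w * moment nu w).
Proof.
have mM a b : measurable_fun setT (fun w => moment a w * moment b w).
  by apply: emeasurable_funM; exact: measurable_moment.
have M0 a b w : 0 <= moment a w * moment b w by rewrite mule_ge0 // moment_ge0.
rewrite -!ge0_integralD //; apply: ge0_le_integral => //.
- by move=> w _; rewrite adde_ge0.
- exact: emeasurable_funD.
- exact: emeasurable_funD.
- by move=> w _; apply: lee_2mul; exact: moment_ge0.
Qed.

(** Equality in the integrated form of [2 a b <= a^2 + b^2]: the squared difference of the moments
    has integral zero. *)
Lemma gram_cross_eq mu nu : (forall a w, moment a w \is a fin_num) ->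
  \int[m]_w (moment mu w * moment nu w) < +oo ->
  \int[m]_w (moment mu w * moment mu w) + \int[m]_w (moment nu w * moment nu w) <=
  \int[m]_w (moment mu w * moment nu w) + \int[m]_w (moment mu w * moment nu w) ->
  {ae m, forall w, moment mu w = moment nu w}.
Proof.
move=> Mf Cf le.
have mM a b : measurable_fun setT (fun w => moment a w * moment b w).
  by apply: emeasurable_funM; exact: measurable_moment.
have M0 a b w : 0 <= moment a w * moment b w by rewrite mule_ge0 // moment_ge0.
pose f w := (moment mu w - moment nu w) * (moment mu w - moment nu w).
have f0 w : 0 <= f w.
  rewrite /f -(fineK (Mf mu w)) -(fineK (Mf nu w)) -EFinB -EFinM lee_fin -expr2; exact: sqr_ge0.
have mB : measurable_fun setT (fun w => moment mu w - moment nu w).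
  by apply: emeasurable_funB; exact: measurable_moment.
have mf : measurable_fun setT f by apply: emeasurable_funM.
have fE : \int[m]_w f w + (\int[m]_w (moment mu w * moment nu w) + \int[m]_w (moment mu w * moment nu w)) =
  \int[m]_w (moment mu w * moment mu w) + \int[m]_w (moment nu w * moment nu w).
  rewrite -!ge0_integralD //.
  - apply: eq_integral => w _; rewrite /f -(fineK (Mf mu w)) -(fineK (Mf nu w)).
    by rewrite -EFinB -!EFinM -!EFinD; congr EFin; ring.
  - by move=> w _; rewrite adde_ge0.
  - exact: emeasurable_funD.
have CC : \int[m]_w (moment mu w * moment nu w) \is a fin_num.
  by rewrite ge0_fin_numE // moment_mul_ge0.
have If : \int[m]_w f w = 0.
  apply/eqP; rewrite eq_le integral_ge0 ?andbT //.
  move: le; rewrite -fE -(fineK CC) -EFinD => le.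
  by have := le; rewrite -[leRHS]add0e leeD2rE.
have : ae_eq m setT f (cst 0).
  apply/ae_eq_integral_abs => //; rewrite -If; apply: eq_integral => w _; exact: gee0_abs.
apply: filterS => w /(_ I); rewrite /f -(fineK (Mf mu w)) -(fineK (Mf nu w)) -EFinB -EFinM => -[].
by move=> /eqP; rewrite mulf_eq0 orbb subr_eq0 => /eqP ->.
Qed.

End positive_definite.

Section product.
Context d1 d2 (T1 : measurableType d1) (T2 : measurableType d2) (R : realType)
  (m1 : {sigma_finite_measure set T1 -> \bar R}) (m2 : {sigma_finite_measure set T2 -> \bar R}).

(** The product measure with its sigma-finite structure attached, the form in which [gram] accepts
    it. *)
Definition sfproduct : {sigma_finite_measure set (T1 * T2)%type -> \bar R} :=
  HB.pack (m1 \x m2)%E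
    (lebesgue_integral_fubini.measure_function_Measure_isSigmaFinite__to__measure_function_isSFinite m1 m2)
    (lebesgue_integral_fubini.measure_function_Measure_isSigmaFinite__to__measure_function_isSigmaFinite m1 m2).

End product.

(** * The logarithm as a superposition of windows *)

Section log_kernel.
Context (R : realType).
Notation leb := (@lebesgue_measure R).

(** For [d = |x - y|] in []0, S]], [- ln d + ln S] is the integral of [(s - d) / s ^+ 2] over
    [[d, S]] plus [(S - d) / S], and [s - d] is the length of the set of [u] whose window []u, u +
    s[] contains both points. So on bounded sets the logarithmic kernel is, up to a constant, a sum
    of Gram kernels. *)
Definition window (s u x : R) : R := if (u < x) && (x < u + s) then 1 else 0.

Lemma measurable_window3 : measurable_fun setT (fun p : (measurableTypeR R * measurableTypeR R) * R => window p.1.1 p.1.2 p.2).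
Proof.
apply: measurable_fun_ifT => //; apply: measurable_and; apply: measurable_fun_ltr => //.
- exact: measurableT_comp.
- by apply: measurable_funD; exact: measurableT_comp.
Qed.

Lemma measurable_window s : measurable_fun setT (fun p : measurableTypeR R * R => window s p.1 p.2).
Proof.
apply: measurable_fun_ifT => //; apply: measurable_and; apply: measurable_fun_ltr => //.
by apply: measurable_funD.
Qed.

Lemma window_ge0 s u x : 0 <= window s u x.
Proof. by rewrite /window; case: ifP. Qed.

Lemma int_window s x y :
  (\int[leb]_u (window s u x * window s u y)%:E = (Num.max 0 (s - `|x - y|))%:E)%E.
Proof.
pose I := `](Num.max x y - s), (Num.min x y)[%classic : set R.
have e u : window s u x * window s u y = \1_I u.
  rewrite /window indicE; case: (boolP (u \in I)) => [/set_mem|/negP h].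
    rewrite /I /= in_itv /= lt_min ltrBlDr gt_max => /andP[/andP[h1 h2] /andP[h3 h4]].
    by rewrite h1 h2 h3 h4 mulr1.
  case: ifP => [/andP[h1 h2]|]; last by rewrite mul0r.
  case: ifP => [/andP[h3 h4]|]; last by rewrite mulr0.
  exfalso; apply: h; apply: mem_set.
  by rewrite /I /= in_itv /= lt_min ltrBlDr gt_max h1 h2 h3 h4.
under eq_integral do rewrite e.
transitivity (leb I).
  by rewrite integral_indic; [rewrite setIT|exact: measurableT|exact: measurable_itv].
rewrite /I lebesgue_measure_itv /= lte_fin.
have -> : Num.max x y - s < Num.min x y = (0 < s - `|x - y|).
  rewrite ltrBlDr -subr_gt0; congr (0 < _).
  by case: (leP x y) => h; [rewrite ler0_norm|rewrite gtr0_norm]; lra.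
case: ltP => h; last by rewrite -[RHS]/(EFin _) // ; congr EFin.
by congr EFin; move: h; case: (leP x y) => h; [rewrite ler0_norm|rewrite gtr0_norm]; lra.
Qed.

Definition scale (S s : R) : R := if (0 < s) && (s <= S) then s^-1 else 0.

Lemma scale_ge0 S s : 0 <= scale S s.
Proof. by rewrite /scale; case: ifP => // /andP[s0 _]; rewrite invr_ge0 ltW. Qed.

Lemma measurable_scale S : measurable_fun setT (scale S : measurableTypeR R -> R).
Proof.
have -> : scale S = fun s => if (0 < s) && (s <= S) then expR (- ln s) else 0.
  apply/funext => s; rewrite /scale; case: ifP => // /andP[s0 _].
  by rewrite expRN lnK.
apply: measurable_fun_ifT => //.
- by apply: measurable_and; [exact: measurable_fun_ltr|exact: measurable_fun_ler].
- by apply: (measurableT_comp (@measurable_expR R)); apply: measurable_funN; exact: measurable_ln.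
Qed.

(** The index [(s, u)] is the size and position of a window; the weight [s^-1] enters squared in the
    kernel. *)
Definition phi1 S (p : (measurableTypeR R * measurableTypeR R) * R) : R :=
  scale S p.1.1 * window p.1.1 p.1.2 p.2.

Definition phi2 (S : R) (p : measurableTypeR R * R) : R := Num.sqrt S^-1 * window S p.1 p.2.

Lemma measurable_phi1 S : measurable_fun setT (phi1 S).
Proof.
apply: measurable_funM; last exact: measurable_window3.
apply: (measurableT_comp (measurable_scale S)); exact: measurableT_comp.
Qed.

Lemma measurable_phi2 S : measurable_fun setT (phi2 S).
Proof. by apply: measurable_funM => //; exact: measurable_window. Qed.

Lemma phi1_ge0 S p : 0 <= phi1 S p.
Proof. by rewrite mulr_ge0 ?scale_ge0 ?window_ge0. Qed.

Lemma phi2_ge0 S p : 0 <= phi2 S p.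
Proof. by rewrite mulr_ge0 ?sqrtr_ge0 ?window_ge0. Qed.

Definition leb2 := sfproduct leb leb.

Notation G1 S := (gram leb2 (phi1 S)).
Notation G2 S := (gram leb (phi2 S)).

Lemma gram2E S x y : 0 < S -> `|x - y| <= S -> G2 S x y = ((S - `|x - y|) / S)%:E.
Proof.
move=> S0 xy; rewrite /gram /phi2 /=.
have e u : ((Num.sqrt S^-1 * window S u x * (Num.sqrt S^-1 * window S u y))%:E =
    (S^-1)%:E * (window S u x * window S u y)%:E)%E.
  rewrite -EFinM; congr EFin.
  have qq : Num.sqrt S^-1 * Num.sqrt S^-1 = S^-1 by rewrite -expr2 sqr_sqrtr // invr_ge0 ltW.
  by rewrite -[in RHS]qq; move: (Num.sqrt _) => q; ring.
under eq_integral do rewrite e.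
rewrite ge0_integralZl_EFin //.
- by rewrite int_window max_r ?subr_ge0 // -EFinM mulrC.
- by move=> u _; rewrite lee_fin mulr_ge0 ?window_ge0.
- apply/measurable_EFinP; apply: measurable_funM;
    exact: (measurableT_comp (measurable_window S) (measurable_pair2 _)).
- by rewrite invr_ge0 ltW.
Qed.

Let tail S d (s : R) : R := scale S s * scale S s * Num.max 0 (s - d).

Lemma gram1E S x y : (G1 S x y = \int[leb]_s (tail S `|x - y| s)%:E)%E.
Proof.
rewrite /gram /leb2 /sfproduct fubini_tonelli1 /=.
- apply: eq_integral => s _; rewrite /fubini_F /phi1 /=.
  have e u : ((scale S s * window s u x * (scale S s * window s u y))%:E =
      (scale S s * scale S s)%:E * (window s u x * window s u y)%:E)%E.
    by rewrite -EFinM; congr EFin; ring.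
  under eq_integral do rewrite e.
  rewrite ge0_integralZl_EFin //.
  + by rewrite int_window -EFinM.
  + by move=> u _; rewrite lee_fin mulr_ge0 ?window_ge0.
  + apply/measurable_EFinP; apply: measurable_funM;
      exact: (measurableT_comp (measurable_window s) (measurable_pair2 _)).
  + by rewrite mulr_ge0 // scale_ge0.
- apply/measurable_EFinP; apply: measurable_funM;
    exact: (measurableT_comp (measurable_phi1 S) (measurable_pair2 _)).
- by move=> p; rewrite lee_fin mulr_ge0 // phi1_ge0.
Qed.

Lemma measurable_tail S d : measurable_fun setT (fun s : measurableTypeR R => (tail S d s)%:E).
Proof.
apply/measurable_EFinP; apply: measurable_funM.
  by apply: measurable_funM; exact: measurable_scale.
by apply: measurable_maxr => //; exact: measurable_funB.
Qed.

Lemma tail_ge0 S d s : 0 <= tail S d s.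
Proof. by rewrite mulr_ge0 ?mulr_ge0 ?scale_ge0 // le_max lexx. Qed.

Lemma int_tail S d : 0 < d <= S ->
  (\int[leb]_s (tail S d s)%:E = (ln S - ln d + d / S - 1)%:E)%E.
Proof.
move=> /andP[d0 dS]; have S0 := lt_le_trans d0 dS.
have -> : (\int[leb]_s (tail S d s)%:E = \int[leb]_(s in `[d, S]) ((s - d) / s ^+ 2)%:E)%E.
  rewrite [RHS]integral_mkcond; apply: eq_integral => s _.
  rewrite patchE; case: (boolP (s \in _)) => [/set_mem|/negP h].
    rewrite /= in_itv /= => /andP[h1 h2]; rewrite /tail /scale h2 (lt_le_trans d0 h1) /=.
    by rewrite max_r ?subr_ge0 // expr2 invfM mulrC.
  rewrite /tail /scale; have [sS|Ss] := leP s S; last by rewrite andbF !mul0r.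
  rewrite max_l ?mulr0 // subr_le0 leNgt; apply/negP => ds; apply: h; apply: mem_set.
  by rewrite /= in_itv /= sS (ltW ds).
have [dS'|Sd] := ltP d S; last first.
  have -> : d = S by apply/eqP; rewrite eq_le dS.
  by rewrite set_itv1 integral_set1 subrr add0r mulfV ?gt_eqF // subrr.
have hc x : d <= x <= S -> {for x, continuous (fun s : R => (s - d) / s ^+ 2)}.
  move=> /andP[dx _]; have x0 : x != 0 by rewrite gt_eqF // (lt_le_trans d0).
  apply: cvgM; first by apply: cvgB; [exact: cvg_id|exact: cvg_cst].
  apply: cvgV; first by rewrite expf_neq0.
  exact: exprn_continuous.
have hd x : d <= x <= S -> is_derive x (1 : R) (fun s : R => ln s + d * s^-1) ((x - d) / x ^+ 2).
  move=> /andP[dx _]; have x0 : 0 < x by rewrite (lt_le_trans d0).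
  have h1 : is_derive x (1 : R) (@ln R) x^-1 by exact: is_derive1_ln.
  have xn : x != 0 by rewrite gt_eqF.
  have h2 : is_derive x (1 : R) (fun s : R => s^-1) (- x ^- 2 *: (1:R)) by exact: is_deriveV.
  have h3 := is_deriveD h1 (is_deriveZ d h2).
  apply: is_derive_eq h3 _; rewrite /GRing.scale /=; field; exact: xn.
rewrite (FTC_is_derive_in dS' hc hd).
by congr EFin; rewrite mulfV ?gt_eqF //; ring.
Qed.

(** The integrand at distance 0 dominates the one at any [d > 0], whose integral grows like
    [- ln d]. *)
Lemma int_tail0 S : 0 < S -> (\int[leb]_s (tail S 0 s)%:E = +oo)%E.
Proof.
move=> S0; apply/eq_infty => A.
pose d := S * expR (- (`|A| + 1)).
have e1 : expR (- (`|A| + 1)) <= 1 :> R by rewrite -expR0 ler_expR oppr_le0 addr_ge0.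
have d0 : 0 < d by rewrite mulr_gt0 // expR_gt0.
have dS : d <= S by rewrite ler_piMr // ltW.
apply: (@le_trans _ _ (\int[leb]_s (tail S d s)%:E)%E).
  rewrite int_tail ?d0 // lee_fin /d lnM ?posrE ?expR_gt0 // expRK.
  have : 0 <= S * expR (- (`|A| + 1)) / S by rewrite divr_ge0 ?(ltW S0) // (ltW d0).
  have := ler_norm A; lra.
apply: ge0_le_integral => //.
- by move=> s _; rewrite lee_fin tail_ge0.
- exact: measurable_tail.
- exact: measurable_tail.
- move=> s _; rewrite lee_fin ler_wpM2l ?mulr_ge0 ?scale_ge0 //.
  by rewrite ge_max !le_max lexx /= lerD2l oppr0 oppr_le0 (ltW d0) orbT.
Qed.

Lemma nlog_gram S x y : 0 < S -> `|x - y| <= S ->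
  (nlog (x - y) + (ln S)%:E = G1 S x y + G2 S x y)%E.
Proof.
move=> S0 xy; rewrite gram2E // gram1E /nlog.
have [e|ne] := eqVneq (x - y) 0.
  by rewrite e normr0 int_tail0 // addye.
rewrite int_tail ?normr_gt0 ?ne // -!EFinD; congr EFin; field.
by rewrite gt_eqF.
Qed.

End log_kernel.

(** * Two equilibrium measures have the same support *)

Section uniqueness.
Context (R : realType) (V : R -> R) (B : R).
Hypothesis cV : continuous V.
Hypothesis VB : forall x, 4 * ln (1 + `|x|) - B <= V x.
Hypothesis B0 : 0 <= B.
Notation leb := (@lebesgue_measure R).
Notation K := (kerK V B).
Notation pot := (potK V B).
Notation en := (enK V B).
Notation hv := (hV V B).
Implicit Types (mu nu : probability R R).

(** Outside [[- L, L]] the potential is at least [ln (1 + L)], more than the energy; inside it is on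
    average at least the energy, by [equilibrium_potK_on]. As its mean is the energy, no mass
    remains outside. *)
Lemma equilibrium_tight mu L : is_equilibrium_measure V mu -> 0 <= L ->
  fine (en mu mu) < ln (1 + L) -> mu (~` `[(- L)%R, L]%classic) = 0%E.
Proof.
move=> eq L0 EL.
have Ef := equilibrium_en_fin cV VB eq.
have Efin : en mu mu \is a fin_num by rewrite ge0_fin_numE // enK_ge0.
pose N := `[(- L)%R, L]%classic : set R.
have mN : measurable N by exact: measurable_itv.
have h1 : ((ln (1 + L))%:E * mu (~` N) <= \int[mu]_(y in ~` N) pot mu y)%E.
  rewrite -(@integral_cst _ _ _ mu) //; last exact: measurableC.
  apply: ge0_le_integral => //.
  - exact: measurableC.
  - by move=> y _; rewrite lee_fin ln_ge0 // lerDl.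
  - by apply: measurable_funTS; exact: measurable_potK.
  - move=> y yN.
    have Ly : L <= `|y|.
      rewrite leNgt; apply/negP => h; apply: yN; rewrite /N /= in_itv /=.
      by rewrite -ler_norml ltW.
    have hk x : ((ln (1 + L))%:E <= K y x)%E.
      apply: le_trans (kerK_ge VB y x); rewrite lee_fin.
      have q : ln (1 + L) <= ln (1 + `|y|) by rewrite ler_ln ?posrE ?lerD2l // ltr_wpDr.
      by apply: le_trans q _; rewrite lerDl ln_ge0 // lerDl.
    rewrite /potK -[leLHS]mule1 -(probability_setT mu) -(@integral_cst _ _ _ mu) //.
    apply: ge0_le_integral => //.
    + by move=> x _; rewrite lee_fin ln_ge0 // lerDl.
    + exact: measurable_kerKl.
have h2 := equilibrium_potK_on cV VB eq Ef Ef mN.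
have split : en mu mu = (\int[mu]_(y in N) pot mu y + \int[mu]_(y in ~` N) pot mu y)%E.
  rewrite /enK -/(potK V B mu) -{1}(setUv N) ge0_integral_setU //.
  - exact: measurableC.
  - by apply: measurable_funTS; exact: measurable_potK.
  - by move=> y _; exact: potK_ge0.
  - by apply/disj_setPS => y [].
have Nf : mu N \is a fin_num by exact: fin_num_measure.
have Cf : mu (~` N) = (1 - fine (mu N))%:E by rewrite probability_setC // EFinB fineK.
have : (en mu mu * mu N + (ln (1 + L))%:E * mu (~` N) <= en mu mu)%E.
  by rewrite [leRHS]split; exact: leeD.
rewrite Cf -{1 2}(fineK Efin) -(fineK Nf) -!EFinM -EFinD lee_fin.
have n1 : 0 <= 1 - fine (mu N) by rewrite -lee_fin -Cf.
move=> h; congr EFin; apply/eqP; rewrite eq_le n1 andbT.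
have pos : 0 < ln (1 + L) - fine (en mu mu) by rewrite subr_gt0.
rewrite -(ler_pM2l pos) mulr0; move: h; rewrite /= ; lra.
Qed.

Lemma integral_tight (mu : probability R R) L (f : R -> \bar R) :
  mu (~` `[(- L)%R, L]%classic) = 0%E -> measurable_fun setT f -> (forall x, 0 <= f x)%E ->
  (\int[mu]_x f x = \int[mu]_(x in `[(- L)%R, L]%classic) f x)%E.
Proof. by move=> out mf f0; apply: integral_interval_support. Qed.

(** [p] and [q] are the external field terms, which cancel between [Em + En] and [C + C]; [a], [c],
    [e] come from the first Gram kernel and [b], [d], [f] from the second. *)
Lemma cross_terms_le (Em En C a b c d e f p q : \bar R) (k : R) :
  Em \is a fin_num -> En \is a fin_num -> C \is a fin_num ->
  a \is a fin_num -> b \is a fin_num -> c \is a fin_num -> d \is a fin_num ->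
  e \is a fin_num -> f \is a fin_num -> p \is a fin_num -> q \is a fin_num ->
  (Em + k%:E = a + b + (p + p) -> En + k%:E = c + d + (q + q) -> C + k%:E = e + f + (q + p) ->
  e + e <= c + a -> Em <= C -> En <= Em -> d + b <= f + f)%E.
Proof.
case: Em => [Em| |] // _; case: En => [En| |] // _; case: C => [C| |] // _.
case: a => [a| |] // _; case: b => [b| |] // _; case: c => [c| |] // _; case: d => [d| |] // _.
case: e => [e| |] // _; case: f => [f| |] // _; case: p => [p| |] // _; case: q => [q| |] // _.
rewrite -!EFinD !lee_fin => -[e1] [e2] [e3]; clear -e1 e2 e3; lra.
Qed.

(** * The energy in terms of window masses *)

Section decomposition.
Variable L : R.
Hypothesis L1 : 1 <= L.
Local Notation S := (4 * L).
Local Notation phia := (phi1 S).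
Local Notation phib := (phi2 S).
Local Notation G1 := (gram (leb2 R) phia).
Local Notation G2 := (gram leb phib).
Local Notation T1 mu nu := (\int[leb2 R]_w (moment phia mu w * moment phia nu w))%E.
Local Notation T2 mu nu := (\int[leb]_w (moment phib mu w * moment phib nu w))%E.
Local Notation J mu := (\int[mu]_x (hv x)%:E)%E.

Let S0 : 0 < S. Proof. move: L1; lra. Qed.
Let k0 : 0 <= B + ln S. Proof. by rewrite addr_ge0 // ln_ge0 //; move: L1; lra. Qed.
Let k0e : (0 <= (B + ln S)%:E)%E. Proof. by rewrite lee_fin. Qed.

Let m1 := measurable_phi1 S.
Let m2 := measurable_phi2 S.
Let p1 := phi1_ge0 S.
Let p2 := phi2_ge0 S.

Lemma kerK_decomp x y : - L <= x <= L -> - L <= y <= L ->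
  (K x y + (B + ln S)%:E = (G1 x y + G2 x y) + ((hv y)%:E + (hv x)%:E))%E.
Proof.
move=> xL yL; rewrite -nlog_gram //; last by move: L1 xL yL; rewrite ler_norml; lra.
rewrite /kerK energy_kernelE -!addeA; congr (_ + _)%E.
by rewrite -!EFinD; congr EFin; rewrite /hV; field.
Qed.

Let J_ge0 mu : (0 <= J mu)%E.
Proof. by apply: integral_ge0 => x _; rewrite lee_fin hV_ge0. Qed.

Lemma pot_decomp nu x : nu (~` `[(- L)%R, L]%classic) = 0%E -> - L <= x <= L ->
  (pot nu x + (B + ln S)%:E =
    \int[nu]_y G1 x y + \int[nu]_y G2 x y + (J nu + (hv x)%:E))%E.
Proof.
move=> out xL.
have mg1 := measurable_gram_sect (leb2 R) m1 p1 x.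
have mg2 := measurable_gram_sect leb m2 p2 x.
have g10 y := gram_ge0 (leb2 R) p1 x y.
have g20 y := gram_ge0 leb p2 x y.
have mh := measurable_hV B cV.
have hv0 y : (0 <= (hv y)%:E)%E by rewrite lee_fin hV_ge0.
have mk : measurable_fun setT (K x) by exact: measurable_kerKl.
have k0' y : (0 <= K x y)%E by exact: kerK_ge0.
have e1 : (pot nu x + (B + ln S)%:E = \int[nu]_y (K x y + (B + ln S)%:E))%E.
  by rewrite (integral_add_cst nu mk k0' k0).
have e2 : (\int[nu]_y ((hv y)%:E + (hv x)%:E) = J nu + (hv x)%:E)%E.
  by rewrite (integral_add_cst nu mh hv0 (hV_ge0 VB B0 x)).
have mhx : measurable_fun setT (fun y => (hv y)%:E + (hv x)%:E)%E by apply: emeasurable_funD.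
have hx0 y : (0 <= (hv y)%:E + (hv x)%:E)%E by rewrite adde_ge0.
have mgg : measurable_fun setT (fun y => G1 x y + G2 x y)%E by apply: emeasurable_funD.
rewrite e1 (integral_tight out); last 2 first.
- by apply: emeasurable_funD.
- by move=> y; rewrite adde_ge0.
rewrite -e2 -[in RHS]ge0_integralD // -[RHS]ge0_integralD //; last by move=> y _; rewrite adde_ge0.
rewrite [RHS](integral_tight out); last 2 first.
- by apply: emeasurable_funD.
- by move=> y; apply: adde_ge0; [exact: adde_ge0|exact: hx0].
by apply: eq_integral => y /set_mem /=; rewrite in_itv /= => yL; exact: kerK_decomp.
Qed.

Lemma en_decomp mu nu : mu (~` `[(- L)%R, L]%classic) = 0%E -> nu (~` `[(- L)%R, L]%classic) = 0%E ->
  (en mu nu + (B + ln S)%:E = T1 mu nu + T2 mu nu + (J mu + J nu))%E.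
Proof.
move=> outm outn.
rewrite -!(gram_moment _ m1 p1) -!(gram_moment _ m2 p2).
have mg1 := measurable_int_gram (leb2 R) m1 p1 nu.
have mg2 := measurable_int_gram leb m2 p2 nu.
have g10 x : (0 <= \int[nu]_y G1 x y)%E by apply: integral_ge0 => y _; exact: gram_ge0.
have g20 x : (0 <= \int[nu]_y G2 x y)%E by apply: integral_ge0 => y _; exact: gram_ge0.
have mh := measurable_hV B cV.
have hv0 y : (0 <= (hv y)%:E)%E by rewrite lee_fin hV_ge0.
have mp : measurable_fun setT (pot nu) by exact: measurable_potK.
have p0 x : (0 <= pot nu x)%E by exact: potK_ge0.
have e1 : (en mu nu + (B + ln S)%:E = \int[mu]_x (pot nu x + (B + ln S)%:E))%E.
  by rewrite (integral_add_cst mu mp p0 k0).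
have cJ : (\int[mu]_x J nu = J nu)%E.
  transitivity (J nu * mu setT)%E; first exact: integral_cst.
  by rewrite probability_setT mule1.
have e2 : (\int[mu]_x (J nu + (hv x)%:E) = J mu + J nu)%E.
  by rewrite ge0_integralD // cJ addeC.
have mhx : measurable_fun setT (fun y => J nu + (hv y)%:E)%E by apply: emeasurable_funD.
have mgg : measurable_fun setT (fun x => \int[nu]_y G1 x y + \int[nu]_y G2 x y)%E by apply: emeasurable_funD.
rewrite e1 (integral_tight outm); last 2 first.
- by apply: emeasurable_funD.
- by move=> y; rewrite adde_ge0.
rewrite -e2 -[in RHS]ge0_integralD // -[RHS]ge0_integralD //; last 2 first.
- by move=> y _; rewrite adde_ge0.
- by move=> y _; rewrite adde_ge0.
rewrite [RHS](integral_tight outm); last 2 first.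
- by apply: emeasurable_funD.
- by move=> y; apply: adde_ge0; [exact: adde_ge0|apply: adde_ge0; [exact: J_ge0|exact: hv0]].
by apply: eq_integral => y /set_mem /=; rewrite in_itv /= => yL; exact: pot_decomp.
Qed.

Lemma moment2E mu u : moment phib mu u = ((Num.sqrt S^-1)%:E * mu `]u, (u + S)%R[%classic)%E.
Proof.
rewrite /moment /phi2 /=.
have e x : ((Num.sqrt S^-1 * window S u x)%:E =
    (Num.sqrt S^-1)%:E * (\1_(`]u, (u + S)%R[%classic : set R) x)%:E)%E.
  rewrite -EFinM; congr (_ * _)%:E; rewrite /window indicE; case: (boolP (x \in _)) => [/set_mem|/negP h].
    by rewrite /= in_itv /= => ->.
  by case: ifP => // h2; exfalso; apply: h; apply: mem_set; rewrite /= in_itv.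
under eq_integral do rewrite e.
rewrite ge0_integralZl_EFin ?sqrtr_ge0 //.
- by rewrite integral_indic; [rewrite setIT|exact: measurableT|exact: measurable_itv].
- by apply/measurable_EFinP; exact: measurable_indic (measurable_itv _).
Qed.

(** The first variation bounds the sum of the two energies by twice the cross energy, positive
    definiteness gives the reverse. Given the inequality of the first Gram kernel, the second must
    reach equality, and its moments are the masses of windows of size [S]. *)
Lemma equilibrium_windows mu nu : is_equilibrium_measure V mu -> is_equilibrium_measure V nu ->
  mu (~` `[(- L)%R, L]%classic) = 0%E -> nu (~` `[(- L)%R, L]%classic) = 0%E ->
  {ae leb, forall u, mu `]u, (u + S)%R[%classic = nu `]u, (u + S)%R[%classic}.
Proof.
move=> eqm eqn outm outn.
have Em := equilibrium_en_fin cV VB eqm.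
have En := equilibrium_en_fin cV VB eqn.
have cross := equilibrium_potK cV VB eqm Em En.
have mn : (en nu nu <= en mu mu)%E by exact: (equilibrium_enK cV VB mu eqn).
have d1 := en_decomp outm outm; have d2 := en_decomp outn outn; have d3 := en_decomp outn outm.
have t0 a b : (0 <= T1 a b)%E by exact: moment_mul_ge0.
have t0' a b : (0 <= T2 a b)%E by exact: moment_mul_ge0.
have fin (a : probability R R) : a (~` `[(- L)%R, L]%classic) = 0%E -> (en a a < +oo)%E ->
   [/\ T1 a a \is a fin_num, T2 a a \is a fin_num & J a \is a fin_num].
  move=> outa Ea; have := en_decomp outa outa.
  have Ef : en a a \is a fin_num by rewrite ge0_fin_numE // enK_ge0.
  rewrite -(fineK Ef) -EFinD => h.
  have : (T1 a a + T2 a a + (J a + J a))%E \is a fin_num by rewrite -h.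
  by rewrite !fin_numD => /andP[/andP[-> ->] /andP[->]].
have [f1 f2 f3] := fin _ outm Em.
have [f4 f5 f6] := fin _ outn En.
have c1 := gram_cross_le (leb2 R) m1 p1 nu mu.
have c2 := gram_cross_le leb m2 p2 nu mu.
have fc (x y z : \bar R) : (0 <= x -> x + x <= y + z -> y \is a fin_num -> z \is a fin_num -> x \is a fin_num)%E.
  move=> x0 h fy fz; rewrite ge0_fin_numE //.
  have : (y + z < +oo)%E by rewrite ltey_eq fin_numD fy fz.
  by move=> /(le_lt_trans h); move: x0; clear; case: x => [x| |] //= _ _; rewrite ltry.
have f7 := fc _ _ _ (t0 nu mu) c1 f4 f1.
have f8 := fc _ _ _ (t0' nu mu) c2 f5 f2.
have Efm : en mu mu \is a fin_num by rewrite ge0_fin_numE // enK_ge0.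
have Efn : en nu nu \is a fin_num by rewrite ge0_fin_numE // enK_ge0.
have Efc : en nu mu \is a fin_num.
  have := d3; rewrite -(fineK f7) -(fineK f8) -(fineK f3) -(fineK f6) -!EFinD.
  by case: (en nu mu) => //.
have mom_fin a w : moment phib a w \is a fin_num.
  by rewrite moment2E fin_numM // fin_num_measure //; exact: measurable_itv.
have key : (T2 nu nu + T2 mu mu <= T2 nu mu + T2 nu mu)%E.
  exact: (cross_terms_le Efm Efn Efc f1 f2 f4 f5 f7 f8 f3 f6 d1 d2 d3 c1 cross mn).
have fin8 : (T2 nu mu < +oo)%E by rewrite ltey_eq f8.
have := gram_cross_eq m2 p2 mom_fin fin8 key.
apply: filterS => u; rewrite !moment2E => h.
have s0 : 0 < Num.sqrt S^-1 by rewrite sqrtr_gt0 invr_gt0.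
have ff (a : probability R R) : a `]u, (u + S)%R[%classic \is a fin_num by rewrite fin_num_measure //; exact: measurable_itv.
move: h; rewrite -(fineK (ff mu)) -(fineK (ff nu)) -!EFinM => -[/mulfI] h.
by rewrite h // gt_eqF.
Qed.

End decomposition.

Lemma ae_itv_ex (P : R -> Prop) (u v : R) : u < v -> {ae leb, forall x, P x} -> exists2 x, u < x < v & P x.
Proof.
move=> uv [N [mN N0 hN]]; apply: contrapT => no.
have sub : `]u, v[%classic `<=` N.
  by move=> x; rewrite /= in_itv /= => xuv; apply: hN => /= Px; apply: no; exists x.
have : (leb `]u, v[%classic <= leb N)%E by apply: le_measure; rewrite ?inE //; exact: measurable_itv.
by rewrite N0 lebesgue_measure_itv /= lte_fin uv -EFinB lee_fin subr_le0 leNgt uv.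
Qed.

(** As [S = 4 * L], a window whose right end is near [x] starts to the left of [- L] and acts as a
    half-line. Two windows ending just before and just after [x] differ by a small interval around
    [x], to which both measures give the same mass. *)
Lemma equilibrium_support_sub mu nu : is_equilibrium_measure V mu -> is_equilibrium_measure V nu ->
  msupport mu `<=` msupport nu.
Proof.
move=> eqm eqn x xs e e0.
(* [ln (1 + L)] exceeds both energies, for [equilibrium_tight], and [L] leaves room around [x]. *)
pose L := expR (Num.max (Num.max (fine (en mu mu)) (fine (en nu nu))) (`|x| + 1)).
set A := Num.max _ _ in L.
have Ax : `|x| + 1 <= A by rewrite /A !le_max lexx !orbT.
have A1 : 1 <= A by apply: le_trans Ax; rewrite lerDr.
have LA : A + 1 <= L by rewrite addrC; exact: expR_ge1Dx.
have L1 : 1 <= L by lra.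
have xL : `|x| < L.
  by move: Ax LA; lra.
have lnA : A < ln (1 + L).
  by rewrite -{1}(expRK A) -/L ltr_ln ?posrE; lra.
have outm : mu (~` `[(- L)%R, L]%classic) = 0%E.
  apply: equilibrium_tight => //; first lra.
  by apply: le_lt_trans lnA; rewrite /A !le_max lexx.
have outn : nu (~` `[(- L)%R, L]%classic) = 0%E.
  apply: equilibrium_tight => //; first lra.
  by apply: le_lt_trans lnA; rewrite /A !le_max lexx orbT.
have W := equilibrium_windows L1 eqm eqn outm outn.
pose e' := Num.min e 1.
have e'0 : 0 < e' by rewrite lt_min e0 ltr01.
have [e'e e'1] : e' <= e /\ e' <= 1 by rewrite !ge_min !lexx orbT.
move: xL; rewrite ltr_norml => /andP[xL1 xL2].
have [u1 /andP[u11 u12] h1] := ae_itv_ex (u := x - e' - 4 * L) (v := x - e' / 2 - 4 * L) (ltac:(lra)) W.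
have [u2 /andP[u21 u22] h2] := ae_itv_ex (u := x + e' / 2 - 4 * L) (v := x + e' - 4 * L) (ltac:(lra)) W.
have decomp (a : probability R R) : a (~` `[(- L)%R, L]%classic) = 0%E ->
    a `]u2, (u2 + 4 * L)%R[%classic = (a `]u1, (u1 + 4 * L)%R[%classic + a `[(u1 + 4 * L)%R, (u2 + 4 * L)%R[%classic)%E.
  move=> outa.
  have nul : a `]u1, u2]%classic = 0%E.
    apply/eqP; rewrite eq_le measure_ge0 andbT -outa; apply: le_measure; rewrite ?inE.
    - exact: measurable_itv.
    - by apply: measurableC; exact: measurable_itv.
    - by move=> z; rewrite /= !in_itv /= => /andP[z1 z2]; apply/negP; rewrite negb_and -!ltNge; apply/orP; left; lra.
  have a1 : a `]u1, (u2 + 4 * L)%R[%classic = (a `]u1, u2]%classic + a `]u2, (u2 + 4 * L)%R[%classic)%E.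
    rewrite -measureU; [|exact: measurable_itv|exact: measurable_itv|].
      congr (a _); apply/seteqP; split => z /=; rewrite !in_itv /=.
        by move=> /andP[z1 z2]; rewrite z1 z2 andbT; case: (leP z u2) => h; [left|right].
      by move=> [/andP[z1 z2]|/andP[z1 z2]]; clear -z1 z2 u12 u21 e'0 L1; apply/andP; split; lra.
    by apply/seteqP; split => z //=; rewrite !in_itv /= => -[/andP[z1 z2] /andP[z3 z4]]; clear -z1 z2 z3 z4; lra.
  have a2 : a `]u1, (u2 + 4 * L)%R[%classic =
      (a `]u1, (u1 + 4 * L)%R[%classic + a `[(u1 + 4 * L)%R, (u2 + 4 * L)%R[%classic)%E.
    rewrite -measureU; [|exact: measurable_itv|exact: measurable_itv|].
      congr (a _); apply/seteqP; split => z /=; rewrite !in_itv /=.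
        by move=> /andP[z1 z2]; rewrite z1 z2 andbT; case: (ltP z (u1 + 4 * L)) => h; [left|right].
      by move=> [/andP[z1 z2]|/andP[z1 z2]]; clear -z1 z2 u12 u21 e'0 L1; apply/andP; split; lra.
    by apply/seteqP; split => z //=; rewrite !in_itv /= => -[/andP[z1 z2] /andP[z3 z4]]; clear -z1 z2 z3 z4; lra.
  by rewrite -a2 a1 nul add0e.
have eqI : mu `[(u1 + 4 * L)%R, (u2 + 4 * L)%R[%classic = nu `[(u1 + 4 * L)%R, (u2 + 4 * L)%R[%classic.
  have ff (a : probability R R) y : a `]y, (y + 4 * L)%R[%classic \is a fin_num.
    by rewrite fin_num_measure //; exact: measurable_itv.
  have ff2 (a : probability R R) : a `[(u1 + 4 * L)%R, (u2 + 4 * L)%R[%classic \is a fin_num.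
    by rewrite fin_num_measure //; exact: measurable_itv.
  have := decomp mu outm; have := decomp nu outn; rewrite h1 h2 => ->.
  rewrite -(fineK (ff nu u1)) -(fineK (ff2 mu)) -(fineK (ff2 nu)) -!EFinD => -[/addrI ->].
  by [].
apply: lt_le_trans (_ : nu `[(u1 + 4 * L)%R, (u2 + 4 * L)%R[%classic <= _)%E.
  rewrite -eqI; apply: lt_le_trans (xs (e' / 2) _) _; first lra.
  apply: le_measure; rewrite ?inE; [exact: measurable_itv|exact: measurable_itv|].
  by move=> z; rewrite /= !in_itv /= => /andP[z1 z2]; clear -z1 z2 u12 u21; apply/andP; split; lra.
apply: le_measure; rewrite ?inE; [exact: measurable_itv|exact: measurable_itv|].
by move=> z; rewrite /= !in_itv /= => /andP[z1 z2]; clear -z1 z2 u11 u22 e'e; apply/andP; split; lra.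
Qed.

Lemma equilibrium_support_unique mu nu : is_equilibrium_measure V mu -> is_equilibrium_measure V nu ->
  msupport mu = msupport nu.
Proof. by move=> h1 h2; apply/seteqP; split; exact: equilibrium_support_sub. Qed.

End uniqueness.

(** * Local expansions of the functional *)

Section compactness.
Context (R : realType).

(** Monotonicity in [n] lets finitely many local indices be replaced by their maximum. A single [n]
    can encode a radius [n.+1%:R^-1] and a bound [n%:R] at once. *)
Lemma compact_uniform (P : nat -> R -> Prop) (a b : R) :
  (forall n m y, (n <= m)%N -> P n y -> P m y) ->
  (forall x, a <= x <= b -> exists n, exists2 d, 0 < d & forall y, `|y - x| < d -> P n y) ->
  exists n, forall y, a <= y <= b -> P n y.
Proof.
move=> mono loc.
have /compact_near_coveringP nc := @segment_compact R a b.
have [|n _ hn] := nc nat \oo P _; last first.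
  by exists n => y yab; apply: (hn n (leqnn n)); rewrite /= in_itv.
move=> x; rewrite /= in_itv /= => /loc[n [d d0 hd]].
exists (ball x d, [set m | (n <= m)%N]) => /=.
  by split; [exact: nbhsx_ballx|exists n].
move=> [y m] /= [yx nm]; apply: mono nm _; apply: hd.
by move: yx; rewrite /ball /= distrC.
Qed.

Lemma compact_uniform2 (P : nat -> R -> R -> Prop) (a b c d : R) :
  (forall n m x y, (n <= m)%N -> P n x y -> P m x y) ->
  (forall x y, a <= x <= b -> c <= y <= d -> exists n, exists2 e, 0 < e &
      forall x' y', `|x' - x| < e -> `|y' - y| < e -> P n x' y') ->
  exists n, forall x y, a <= x <= b -> c <= y <= d -> P n x y.
Proof.
move=> mono loc.
suff [n hn] : exists n, forall x, a <= x <= b -> forall y, c <= y <= d -> P n x y.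
  by exists n => x y xab yab; exact: hn.
apply: compact_uniform => [n m x nm h y ycd|x xab]; first exact: mono nm (h y ycd).
have [n hn] : exists n, forall y, c <= y <= d -> forall x', `|x' - x| < n.+1%:R^-1 -> P n x' y.
  apply: compact_uniform => [n m y nm h x' x'x|y ycd].
    apply: (mono n m _ _ nm); apply: h; apply: lt_le_trans x'x _.
    by rewrite lef_pV2 ?posrE ?ltr0n // ler_nat.
  have [n [e e0 h]] := loc x y xab ycd.
  have [k _ hk] := near_infty_natSinv_lt (PosNum e0).
  exists (maxn n k); exists e => // y' y'y x' x'x.
  apply: (mono n); first exact: leq_maxl.
  by apply: h => //; apply: lt_trans x'x _; apply: hk; rewrite /= leq_maxr.
exists n; exists n.+1%:R^-1; first by rewrite invr_gt0 ltr0n.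
by move=> x' x'x y ycd; exact: hn.
Qed.

Lemma uniform_continuity (f : R -> R) (a b e : R) : continuous f -> 0 < e ->
  exists2 d, 0 < d & forall x y, a <= x <= b -> `|y - x| < d -> `|f y - f x| < e.
Proof.
move=> cf e0.
have [n hn] : exists n, forall x, a <= x <= b -> forall y, `|y - x| < n.+1%:R^-1 -> `|f y - f x| < e.
  apply: compact_uniform => [n m x nm h y yx|x _].
    apply: h; apply: lt_le_trans yx _.
    by rewrite lef_pV2 ?posrE ?ltr0n // ler_nat.
  have e2 : 0 < e / 2 by rewrite divr_gt0.
  have := cf x => /cvgrPdist_lt /(_ _ e2) /nbhs_ballP[d /= d0 hd].
  have d2 : 0 < d / 2 by rewrite divr_gt0.
  have [k _ hk] := near_infty_natSinv_lt (PosNum d2).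
  exists k, (d / 2) => // y yx z zy.
  have h1 : `|f x - f y| < e / 2 by apply: hd; rewrite /ball /= distrC; lra.
  have h2 : `|f x - f z| < e / 2.
    apply: hd; rewrite /ball /=; have zk : `|z - y| < d / 2 by apply: lt_trans zy _; exact: hk k (leqnn k).
    have := ler_distD y x z; rewrite (distrC x y) (distrC y z); lra.
  have := ler_distD (f x) (f z) (f y); rewrite (distrC (f z) (f x)); lra.
by exists n.+1%:R^-1 => [|x y xab yx]; [rewrite invr_gt0 ltr0n|exact: hn].
Qed.

(** Presents a mean over the angle as a limit of finite averages, the form to which [tser_lim]
    applies. The mean value theorem on each cell compares the sum with the increments of an
    antiderivative. *)
Lemma riemann_average (f : R -> R) : continuous f ->
  \sum_(k < K.+1) K.+1%:R^-1 * f (pi * k%:R / K.+1%:R) @[K --> \oo] -->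
  pi^-1 * fine (\int[lebesgue_measure]_(x in `[0%R, pi]) (f x)%:E)%E.
Proof.
move=> cf; have p0 := pi_gt0 R.
have [Phi dPhi] := antiderivative (-1) cf.
have dP (x : R) : 0 <= x -> is_derive x (1 : R) Phi (f x) by move=> x0; apply: dPhi; lra.
have dPi (x : R) : 0 <= x <= pi -> is_derive x (1 : R) Phi (f x) by move=> /andP[x0 _]; exact: dP.
rewrite (FTC_is_derive p0 cf dPi) /=.
apply/cvgrPdist_lt => e e0; have e2 : 0 < e / 2 by rewrite divr_gt0.
have [d d0 hd] := uniform_continuity 0 pi cf e2.
have dp : 0 < d / pi by rewrite divr_gt0.
have [n _ hn] := near_infty_natSinv_lt (PosNum dp).
exists n => // K /= nK.
pose w : R := pi / K.+1%:R.
have K0 : 0 < K.+1%:R :> R by rewrite ltr0n.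
have w0 : 0 < w by rewrite divr_gt0.
have wd : w < d.
  have := hn K nK; rewrite /= => h; rewrite /w mulrC -ltr_pdivlMr //.
have node k : pi * k%:R / K.+1%:R = w * k%:R :> R by rewrite /w mulrAC.
have cell k : (k <= K)%N -> exists2 x, `|x - w * k%:R| < d & Phi (w * k.+1%:R) - Phi (w * k%:R) = f x * w.
  move=> kK; have wk : w * k%:R < w * k.+1%:R by rewrite ltr_pM2l // ltr_nat.
  have wS : w * k.+1%:R = w * k%:R + w by rewrite -natr1 mulrDr mulr1.
  have wk0 : 0 <= w * k%:R by rewrite mulr_ge0 // ltW.
  have [||x] := @MVT R Phi f _ _ wk.
  - by move=> x; rewrite in_itv /= => /andP[h1 h2]; apply: dP; lra.
  - apply: continuous_in_subspaceT => x; rewrite inE /= in_itv /= => /andP[h1 _].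
    apply: differentiable_continuous; apply/derivable1_diffP.
    by have [] := dP x (le_trans wk0 h1).
  - rewrite in_itv /= => /andP[h1 h2] ->; exists x.
      rewrite ltr_norml; move: h2; rewrite wS; lra.
    by rewrite wS addrC addKr.
have tele : Phi pi - Phi 0 = \sum_(k < K.+1) (Phi (w * k.+1%:R) - Phi (w * k%:R)).
  rewrite -(big_mkord xpredT (fun k => Phi (w * k.+1%:R) - Phi (w * k%:R))).
  by rewrite telescope_sumr // mulr0 /w divfK // gt_eqF.
rewrite /= tele mulr_sumr -sumrB.
apply: (@le_lt_trans _ _ (\sum_(k < K.+1) K.+1%:R^-1 * (e / 2))); last first.
  by rewrite sumr_const card_ord -mulrnAl -[_ *+ K.+1]mulr_natl mulfV ?gt_eqF // mul1r; lra.
apply: le_trans (ler_norm_sum _ _ _) _; apply: ler_sum => k _.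
have kK : (k <= K)%N by rewrite -ltnS.
have [x xw ->] := cell k kK.
have -> : pi^-1 * (f x * w) - K.+1%:R^-1 * f (pi * k%:R / K.+1%:R) = K.+1%:R^-1 * (f x - f (w * k%:R)).
  have piw : pi^-1 * w = K.+1%:R^-1 by rewrite /w mulKf // gt_eqF.
  by rewrite node mulrBr mulrCA piw [f x * _]mulrC.
rewrite normrM gtr0_norm ?invr_gt0 // ler_wpM2l ?invr_ge0 ?(ltW K0) //.
apply/ltW/hd => //; rewrite mulr_ge0 ?(ltW w0) //=.
rewrite /w -mulrA ler_piMr ?(ltW p0) // mulrC ler_pdivrMr // mul1r ler_nat.
exact: leq_trans kK (leqnSn K).
Qed.

End compactness.

(** * Continuity of series and expansion of the logarithm *)

Section local_series.
Context (R : realType).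

Lemma tser_lip rho M (D : set R) g x y t s : 0 < rho -> tser rho M D g -> D 0 -> D t ->
  `|x| <= s -> `|y| <= s -> `|t| <= s -> s < rho -> `|g x y t - g 0 0 0| <= M / rho * s.
Proof.
move=> r0 [f [fM fg]] D0 Dt xs ys ts sr.
have s0 : 0 <= s by apply: le_trans xs.
have box1 (h : idx -> R) : \sum_(i <- tbox 1) h i = h (0%N, 0%N, 0%N).
  by rewrite sum_tbox !big_ord1.
have h0 : g 0 0 0 = f (0%N, 0%N, 0%N).
  have l0 := fg 0 0 0; rewrite normr0 in l0.
  have e0 i : `|tmono (0 : R) 0 0 i| <= 0 ^+ tdeg i by apply: tmono_le; rewrite normr0.
  have sr0 : (0 : R) <= 0 <= rho by rewrite lexx ltW.
  have := psum_tail_lim tbox_uniq tbox_sub tbox_deg 1 r0 sr0 fM e0 (l0 r0 r0 r0 D0).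
  rewrite mul0r expr1 mulr0 /psum box1 /tmono !expr0 !mulr1 normr_le0 subr_eq0 => /eqP.
  by [].
have lx := fg x y t (le_lt_trans xs sr) (le_lt_trans ys sr) (le_lt_trans ts sr) Dt.
have ex i : `|tmono x y t i| <= s ^+ tdeg i by exact: tmono_le.
have srx : 0 <= s <= rho by rewrite s0 ltW.
have := psum_tail_lim tbox_uniq tbox_sub tbox_deg 1 r0 srx fM ex lx.
by rewrite expr1 /psum box1 /tmono !expr0 !mulr1 h0 mulrAC mulrA.
Qed.

Lemma tser_continuous rho M (D : set R) g e : 0 < rho -> tser rho M D g -> D 0 -> 0 < e ->
  exists2 d, 0 < d & forall x y t, D t -> `|x| < d -> `|y| < d -> `|t| < d -> `|g x y t - g 0 0 0| < e.
Proof.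
move=> r0 h D0 e0.
have M0 : 0 <= M by have [f [fM _]] := h; exact: wbound_ge0 (ltW r0) fM.
have q0 : 0 < M / rho + 1 by rewrite ltr_wpDl // divr_ge0 // ltW.
pose d := Num.min (rho / 2) (e / (M / rho + 1) / 2).
have d0 : 0 < d by rewrite lt_min; apply/andP; split; rewrite !divr_gt0.
have dr : d <= rho / 2 by rewrite ge_min lexx.
have de : d <= e / (M / rho + 1) / 2 by rewrite ge_min lexx orbT.
exists d => // x y t Dt xd yd td.
have dr' : d < rho by lra.
apply: le_lt_trans (tser_lip r0 h D0 Dt (ltW xd) (ltW yd) (ltW td) dr') _.
have : (M / rho + 1) * d <= e / 2.
  by rewrite mulrC -ler_pdivlMr //; apply: le_trans de _; rewrite mulrAC.
lra.
Qed.

Lemma is_derive_log_sum N (z : R) :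
  is_derive z 1 (fun z : R => \sum_(k < N) - (k.+1%:R)^-1 * (- z) ^+ k.+1) (\sum_(k < N) (- z) ^+ k).
Proof.
pose h (k : 'I_N) : R -> R := (- (k.+1%:R)^-1) \*: ((-%R : R -> R) ^+ k.+1).
have e : (fun z : R => \sum_(k < N) - (k.+1%:R)^-1 * (- z) ^+ k.+1) = \sum_(k < N) h k.
  apply/funext => y; rewrite fct_sumE; apply: eq_bigr => k _.
  by rewrite /h /= exprfctE.
rewrite e; apply: is_derive_sum => k.
have d := is_deriveZ (- (k.+1%:R)^-1) (is_deriveX k.+1 (is_deriveNid z (1 : R))).
apply: is_derive_eq d _; rewrite /GRing.scale /=.
have kn : k.+1%:R != 0 :> R by rewrite pnatr_eq0.
move: kn; move: (k.+1%:R : R) => m kn; field; exact: kn.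
Qed.

Lemma geometric_partial (z : R) N : 1 + z != 0 ->
  (1 + z)^-1 - \sum_(k < N) (- z) ^+ k = (- z) ^+ N / (1 + z).
Proof.
move=> z1; elim: N => [|N IH]; first by rewrite big_ord0 subr0 expr0 mul1r.
rewrite big_ord_recr /= opprD addrA IH exprS; field; exact: z1.
Qed.

(** The remainder vanishes at 0 and has derivative [(- y) ^+ N / (1 + y)], to which the mean value
    theorem is applied. *)
Lemma ln_partial_sum (z : R) N : `|z| <= 1 / 2 ->
  `|ln (1 + z) - \sum_(k < N) - (k.+1%:R)^-1 * (- z) ^+ k.+1| <= (1 / 2) ^+ N.
Proof.
move=> zh.
pose f (z : R) := ln (1 + z) - \sum_(k < N) - (k.+1%:R)^-1 * (- z) ^+ k.+1.
have f0 : f 0 = 0.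
  rewrite /f addr0 ln1 big1 ?subrr // => k _; by rewrite oppr0 exprS mul0r mulr0.
have df (y : R) : `|y| <= 1 / 2 -> is_derive y 1 f ((- y) ^+ N / (1 + y)).
  move=> yh; have y1 : 0 < 1 + y by move: yh; rewrite ler_norml; lra.
  rewrite -geometric_partial ?gt_eqF //.
  have d1 : is_derive y 1 (fun z : R => 1 + z) 1.
    by have := is_deriveD (is_derive_cst (1 : R) y (1 : R)) (is_derive_id y (1 : R)); rewrite add0r.
  have d2 := is_derive1_comp (is_derive1_ln y1) d1; rewrite mulr1 in d2.
  exact: is_deriveB d2 (is_derive_log_sum N y).
have key (u v : R) : u <= v -> `|u| <= 1 / 2 -> `|v| <= 1 / 2 -> u = 0 \/ v = 0 -> `|f v - f u| <= (1 / 2) ^+ N.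
  move=> uv uh vh uv0.
  have inb x : u <= x <= v -> `|x| <= 1 / 2.
    by move: uh vh; rewrite !ler_norml => /andP[h1 h2] /andP[h3 h4] /andP[h5 h6]; apply/andP; split; lra.
  have [||x xuv ->] := @MVT_segment R f (fun y => (- y) ^+ N / (1 + y)) u v uv.
  - by move=> x; rewrite in_itv /= => /andP[h1 h2]; apply: df; apply: inb; rewrite !ltW.
  - apply: continuous_in_subspaceT => x; rewrite inE /= in_itv /= => /inb/df d.
    by apply: differentiable_continuous; apply/derivable1_diffP; case: d.
  - move: xuv; rewrite in_itv /= => /inb xh.
    have x1 : 1 / 2 <= 1 + x by move: xh; rewrite ler_norml; lra.
    have x10 : 0 < 1 + x by lra.
    rewrite !normrM normrX normrN normfV (gtr0_norm x10) -mulrA.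
    have h1 : `|x| ^+ N <= (1 / 2) ^+ N by rewrite lerXn2r // nnegrE; lra.
    have h2 : (1 + x)^-1 * `|v - u| <= 1.
      rewrite mulrC ler_pdivrMr // mul1r; apply: le_trans x1.
      by case: uv0 => ->; rewrite ?subr0 ?sub0r ?normrN.
    rewrite -[leRHS]mulr1; apply: ler_pM => //.
    by rewrite mulr_ge0 // invr_ge0 ltW.
have h0 : `|0 : R| <= 1 / 2 by rewrite normr0; lra.
have -> : ln (1 + z) - \sum_(k < N) - (k.+1%:R)^-1 * (- z) ^+ k.+1 = f z - f 0 by rewrite f0 subr0.
have [z0|z0] := leP 0 z; first by apply: key => //; left.
by rewrite distrC; apply: key => //; [exact: ltW|right].
Qed.

Lemma tser_cst rho (c : R) D : 0 <= rho -> tser rho `|c| D (fun _ _ _ => c).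
Proof.
move=> r0; have := tser_trinom c 0 0 0 0 D r0; rewrite !expr0 !mulr1.
by apply: tser_ext => x y t _ _ _ _; rewrite !expr0 !mulr1.
Qed.

Lemma tser_monom rho (i : idx) (D : set R) : 0 <= rho -> tser rho (rho ^+ tdeg i) D (fun x y t => tmono x y t i).
Proof.
move=> r0; exists (fun j => (j == i)%:R); split; first exact: delta_bound.
by move=> x y t _ _ _ _; exact: psum_delta.
Qed.

(** At radius [r0 / 4] the terms of the series of [ln (1 + y / r0)] are at most powers of 1/4, of
    total at most 1. *)
Lemma tser_ln (r0 : R) D : 0 < r0 -> tser (r0 / 4) (`|ln (r0 / 2)| + 1) D (fun x y t => ln ((r0 + y) / 2)).
Proof.
move=> r00; have q0 : 0 < r0 / 4 by rewrite divr_gt0.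
pose c k : R := - (k.+1%:R)^-1 * (- r0^-1) ^+ k.+1.
have log1 : tser (r0 / 4) 1 D (fun x y t => ln (1 + y / r0)).
  pose gK N (x y t : R) := \sum_(k <- index_iota 0 N) c k * tmono x y t (0%N, k.+1, 0%N).
  have bound N : \sum_(k <- index_iota 0 N) (1 / 4) ^+ k.+1 <= 1 :> R.
    suff : \sum_(k <- index_iota 0 N) (1 / 4) ^+ k.+1 <= (1 - (1 / 4) ^+ N) / 3 :> R.
      move=> h; apply: le_trans h _; have : 0 <= (1 / 4) ^+ N :> R by apply: exprn_ge0; lra.
      lra.
    elim: N => [|N IH]; first by rewrite big_geq // expr0 subrr mul0r.
    rewrite big_nat_recr //= exprS; move: IH; set u := (1 / 4) ^+ N; lra.
  apply: (@tser_lim R _ _ _ gK) => //.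
    move=> N; have := tser_sum (index_iota 0 N) (ltW q0) (fun k =>
      tser_scale (c k) (ltW q0) (tser_monom (0%N, k.+1, 0%N) D (ltW q0))).
    apply: tser_weaken; first by rewrite lexx ltW.
    apply: le_trans (bound N); apply: ler_sum => k _.
    rewrite /c /tdeg /= add0n addn0 normrM normrN normrX normrN -mulrA -exprMn.
    have -> : `|r0^-1| * (r0 / 4) = 1 / 4.
      by rewrite gtr0_norm ?invr_gt0 // mulrA mulVf ?gt_eqF.
    rewrite ler_piMl //; try by apply: exprn_ge0; lra.
    by rewrite gtr0_norm ?invr_gt0 ?ltr0n // invf_le1 ?ltr0n // ler1n.
  move=> x y t _ yr _ _.
  have yh : `|y / r0| <= 1 / 2.
    rewrite normrM normfV (gtr0_norm r00) ler_pdivrMr //; move: yr; lra.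
  have e N : gK N x y t = \sum_(k < N) - (k.+1%:R)^-1 * (- (y / r0)) ^+ k.+1.
    rewrite /gK big_mkord; apply: eq_bigr => k _.
    rewrite /c /tmono /= !expr0 mul1r mulr1 -mulrA -exprMn; congr (_ * _ ^+ _).
    by rewrite mulNr mulrC.
  apply/cvgrPdist_lt => eps eps0.
  have h2 : `|1 / 2 : R| < 1 by rewrite gtr0_norm; lra.
  have /cvgrPdist_lt /(_ _ eps0) := cvg_expr h2.
  apply: filterS => N /=; rewrite sub0r normrN => h.
  rewrite e; apply: le_lt_trans (ln_partial_sum N yh) _.
  by rewrite ger0_norm // in h; apply: exprn_ge0; lra.
have := tser_add (ltW q0) (tser_cst (ln (r0 / 2)) D (ltW q0)) log1.
apply: tser_ext => x y t _ yr _ _.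
have y1 : 0 < 1 + y / r0.
  have : `|y / r0| < 1 by rewrite normrM normfV (gtr0_norm r00) ltr_pdivrMr //; move: yr; lra.
  rewrite ltr_norml; lra.
rewrite -lnM ?posrE ?divr_gt0 //; congr ln; field; rewrite gt_eqF //.
Qed.

End local_series.

(** * Analyticity of the functional in centre, half-length and parameter *)

Section family.
Context (R : realType) (V : R -> R -> R) (t0 : R).

Definition real_series_at x0 s := exists r M : R, 0 < r /\ exists c : nat -> nat -> R,
  (forall N, \sum_(m < N) \sum_(n < N) `|c m n| * r ^+ (m + n) <= M) /\
  forall x t, `|x - x0| < r -> 0 <= t <= t0 -> `|t - s| < r ->
    \sum_(m < N) \sum_(n < N) c m n * (x - x0) ^+ m * (t - s) ^+ n @[N --> \oo] --> V x t.

Lemma Re_mulr_real (z : R[i]) (w : R) : complex.Re (z * w%:C%C) = complex.Re z * w.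
Proof. by case: z => a b /=; rewrite mulr0 subr0. Qed.

(** At a real centre and real arguments, taking real parts of the coefficients commutes with the
    partial sums and does not increase the norm. *)
Lemma joint_analytic_real (Om : set R[i]) (W : R[i] -> R -> R[i]) x0 s :
  (forall x : R, Om x%:C%C) -> joint_analytic_on W Om t0 ->
  (forall x t : R, 0 <= t <= t0 -> W x%:C%C t = (V x t)%:C%C) ->
  0 <= s <= t0 -> real_series_at x0 s.
Proof.
move=> OmR ja WV st.
have [r [r0 [c [[M cM] hc]]]] := ja x0%:C%C s (OmR x0) st.
exists r, M; split => //; exists (fun m n => complex.Re (c m n)); split.
  move=> N; rewrite -lecR; apply: le_trans (cM N).
  rewrite !rmorph_sum; apply: ler_sum => m _; rewrite rmorph_sum; apply: ler_sum => n _.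
  rewrite rmorphM rmorphXn /= ler_wpM2r ?normc_ge_Re // exprn_ge0 // lecR; exact: ltW.
move=> x t xr tt ts.
have xr' : `|x%:C%C - x0%:C%C| < r%:C%C by rewrite -rmorphB /= normc_def /= expr0n addr0 sqrtr_sqr ltcR.
have := hc x%:C%C t (OmR x) xr' tt ts; rewrite WV // => cv.
apply/cvgrPdist_lt => e e0.
have [N0 hN] := cv e e0; exists N0 => // N /= NN.
have := hN N NN; set u := (X in `|X - _|) => h.
have -> : \sum_(m < N) \sum_(n < N) complex.Re (c m n) * (x - x0) ^+ m * (t - s) ^+ n = complex.Re u.
  rewrite /u raddf_sum; apply: eq_bigr => m _; rewrite raddf_sum; apply: eq_bigr => n _.
  by rewrite -rmorphB /= -!rmorphXn /= !Re_mulr_real.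
rewrite distrC -ltcR; apply: le_lt_trans h.
have -> : complex.Re u - V x t = complex.Re (u - (V x t)%:C%C) by rewrite raddfB.
exact: normc_ge_Re.
Qed.

Hypothesis series : forall x0 s, 0 <= s <= t0 -> real_series_at x0 s.

Definition shiftD s : set R := [set tau | 0 <= s + tau <= t0].

Lemma V_tser_local x0 s : 0 <= s <= t0 -> exists rho M : R, 0 < rho /\
  forall x e, `|x - x0| < rho -> `|e| <= 1 ->
    tser rho M (shiftD s) (fun u v tau => V (x + u + v * e) (s + tau)).
Proof.
move=> st; have [r [M [r0 [c [cM hc]]]]] := series x0 st.
have q0 : 0 < r / 4 by rewrite divr_gt0.
exists (r / 4), M; split => // x e xx e1.
pose gK N (u v tau : R) := \sum_(m <- index_iota 0 N) \sum_(n <- index_iota 0 N)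
   c m n * ((x - x0) + u + v * e) ^+ m * tau ^+ n.
apply: (@tser_lim R _ _ _ gK) => //.
  move=> N; have := tser_sum (index_iota 0 N) (ltW q0) (fun m =>
    tser_sum (index_iota 0 N) (ltW q0) (fun n =>
     tser_trinom (c m n) (x - x0) e m n (shiftD s) (ltW q0))).
  apply: tser_weaken; first by rewrite lexx ltW.
  apply: le_trans (cM N); rewrite big_mkord; apply: ler_sum => m _.
  rewrite big_mkord; apply: ler_sum => n _; rewrite exprD mulrA.
  have w : `|x - x0| + r / 4 + r / 4 * `|e| <= r.
    have : r / 4 * `|e| <= r / 4 by rewrite ler_piMr // ltW.
    lra.
  have w0 : 0 <= `|x - x0| + r / 4 + r / 4 * `|e| by rewrite !addr_ge0 // ?mulr_ge0 // ltW.
  apply: ler_pM => //.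
  - by rewrite mulr_ge0 // exprn_ge0.
  - by rewrite exprn_ge0 // ltW.
  - by rewrite ler_wpM2l // lerXn2r // nnegrE ltW.
  - by rewrite lerXn2r // ?nnegrE ?ltW //; lra.
move=> u v tau ur vr taur D.
have -> : (fun N => gK N u v tau) = (fun N => \sum_(m < N) \sum_(n < N)
    c m n * (x + u + v * e - x0) ^+ m * (s + tau - s) ^+ n).
  apply/funext => N; rewrite /gK big_mkord; apply: eq_bigr => m _; rewrite big_mkord.
  by apply: eq_bigr => n _; congr (_ * _ ^+ _ * _ ^+ _); ring.
apply: hc => //.
- have -> : x + u + v * e - x0 = (x - x0) + u + v * e by ring.
  have h1 := ler_normD (x - x0 + u) (v * e); have h2 := ler_normD (x - x0) u.
  have h3 : `|v * e| <= `|v| by rewrite normrM ler_piMr.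
  lra.
- by rewrite addrC addKr; lra.
Qed.

Lemma V_tser_segment s a b : 0 <= s <= t0 -> exists rho M : R, 0 < rho /\
  forall x e, a <= x <= b -> `|e| <= 1 ->
    tser rho M (shiftD s) (fun u v tau => V (x + u + v * e) (s + tau)).
Proof.
move=> st.
have [n hn] : exists n, forall x, a <= x <= b -> forall e, `|e| <= 1 ->
    tser (n.+1%:R^-1) n%:R (shiftD s) (fun u v tau => V (x + u + v * e) (s + tau)).
  apply: compact_uniform => [n m x nm h e e1|x0 _].
    apply: tser_weaken (h e e1); last by rewrite ler_nat.
    by rewrite invr_ge0 ler0n /= lef_pV2 ?posrE ?ltr0n // ler_nat.
  have [rho [M [r0 h]]] := V_tser_local x0 st.
  have [k _ hk] := near_infty_natSinv_lt (PosNum r0).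
  have [l hl] : exists l : nat, M <= l%:R.
    exists (Num.trunc `|M|).+1; apply: le_trans (ler_norm M) _.
    by apply: ltW; rewrite truncnS_gt.
  exists (maxn k l), rho => // x xx e e1.
  apply: tser_weaken (h x e xx e1).
    rewrite invr_ge0 ler0n /=; apply: ltW; apply: hk; exact: leq_maxl.
  by apply: le_trans hl _; rewrite ler_nat leq_maxr.
exists n.+1%:R^-1, n%:R; split; first by rewrite invr_gt0 ltr0n.
by move=> x e xab e1; exact: hn.
Qed.

Lemma V_continuous_at x0 s e : 0 <= s <= t0 -> 0 < e -> exists2 d, 0 < d &
  forall x t, 0 <= t <= t0 -> `|x - x0| < d -> `|t - s| < d -> `|V x t - V x0 s| < e.
Proof.
move=> st e0; have [rho [M [r0 h]]] := V_tser_local x0 st.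
have {h} h : tser rho M (shiftD s) (fun u v tau => V (x0 + u + v * 0) (s + tau)).
  by apply: h; rewrite ?subrr normr0.
have D0 : shiftD s 0 by rewrite /shiftD /= addr0.
have [d d0 hd] := tser_continuous r0 h D0 e0.
exists d => // x t tt xd td.
have Dt : shiftD s (t - s) by rewrite /shiftD /= addrC subrK.
have := hd (x - x0) 0 (t - s) Dt xd; rewrite normr0 => /(_ d0 td).
by rewrite mulr0 !addr0 [x0 + _]addrC subrK [s + _]addrC subrK.
Qed.

Lemma V_continuous t : 0 <= t <= t0 -> continuous (fun x => V x t).
Proof.
move=> tt x; apply/cvgrPdist_lt => e e0.
have [d d0 h] := V_continuous_at x tt e0.
apply/nbhs_ballP; exists d => // y; rewrite /ball /= => xy.
by rewrite distrC; apply: h => //; [rewrite distrC|rewrite subrr normr0].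
Qed.

Lemma V_bounded a b : exists A : R, 0 <= A /\ forall x t, a <= x <= b -> 0 <= t <= t0 -> `|V x t| <= A.
Proof.
have [n hn] : exists n, forall x t, a <= x <= b -> 0 <= t <= t0 -> 0 <= t <= t0 -> `|V x t| <= n%:R.
  apply: compact_uniform2 => [n m x t nm h /h|x s _ st].
    by move=> /le_trans; apply; rewrite ler_nat.
  have [d d0 h] := V_continuous_at x st ltr01.
  exists (Num.trunc (`|V x s| + 1)).+1, d => // x' t' x'x t't t'0.
  have := h x' t' t'0 x'x t't => k.
  have := ler_normD (V x' t' - V x s) (V x s); rewrite subrK.
  have : `|V x s| + 1 < (Num.trunc (`|V x s| + 1)).+1%:R by rewrite truncnS_gt.
  lra.
by exists n%:R; split => // x t xab tt; exact: hn.
Qed.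

(** A Riemann sum is an average of expansions with common [rho] and [M], so it obeys the same bound,
    which passes to the mean. *)
Lemma Vmean_tser c0 r0 s : 0 <= s <= t0 -> exists rho M : R, 0 < rho /\
  tser rho M (shiftD s) (fun x y tau => Vmean (fun z => V z (s + tau)) (c0 + x) (r0 + y)).
Proof.
move=> st; have [rho [M [rho0 h]]] := V_tser_segment (c0 - `|r0|) (c0 + `|r0|) st.
exists rho, M; split => //.
pose th K (k : nat) : R := pi * k%:R / K.+1%:R.
pose gK K (x y tau : R) := \sum_(k <- index_iota 0 K.+1) K.+1%:R^-1 *
  V (c0 + r0 * cos (th K k) + x + y * cos (th K k)) (s + tau).
apply: (@tser_lim R _ _ _ gK) => //.
  move=> K; have c1 k : `|cos (th K k)| <= 1 by rewrite ler_norml cos_geN1 cos_le1.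
  have inS k : c0 - `|r0| <= c0 + r0 * cos (th K k) <= c0 + `|r0|.
    have : `|r0 * cos (th K k)| <= `|r0| by rewrite normrM ler_piMr.
    by rewrite ler_norml => /andP[h1 h2]; apply/andP; split; lra.
  have := tser_sum (index_iota 0 K.+1) (ltW rho0) (fun k =>
    tser_scale K.+1%:R^-1 (ltW rho0) (h _ _ (inS k) (c1 k))).
  apply: tser_weaken; first by rewrite lexx ltW.
  rewrite big_mkord sumr_const card_ord gtr0_norm ?invr_gt0 ?ltr0n //.
  by rewrite -mulrnAl -[_ *+ K.+1]mulr_natl mulfV ?pnatr_eq0 // mul1r.
move=> x y tau xr yr taur D.
have cv : continuous (fun th => V (c0 + x + (r0 + y) * cos th) (s + tau)).
  by apply: (@continuous_Vcos _ (fun z => V z (s + tau))); exact: V_continuous.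
have -> : (fun K => gK K x y tau) = (fun K => \sum_(k < K.+1) K.+1%:R^-1 *
    V (c0 + x + (r0 + y) * cos (pi * k%:R / K.+1%:R)) (s + tau)).
  apply/funext => K; rewrite /gK big_mkord; apply: eq_bigr => k _; congr (_ * V _ _).
  by rewrite /th; ring.
exact: riemann_average cv.
Qed.

Lemma MSF_tser c0 r0 s : 0 < r0 -> 0 <= s <= t0 -> exists rho M : R, [/\ 0 < rho, rho <= r0 / 4 &
  tser rho M (shiftD s) (fun x y tau => MSF (fun z => V z (s + tau)) (c0 + x) (r0 + y))].
Proof.
move=> r00 st; have [rho [M [rho0 h]]] := Vmean_tser c0 r0 st.
have q0 : 0 < r0 / 4 by rewrite divr_gt0.
pose rho' := Num.min rho (r0 / 4).
have rho'0 : 0 < rho' by rewrite lt_min rho0.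
have h1 : tser rho' M (shiftD s) (fun x y tau => Vmean (fun z => V z (s + tau)) (c0 + x) (r0 + y)).
  by apply: tser_weaken h => //; rewrite (ltW rho'0) ge_min lexx.
have h2 : tser rho' (`|ln (r0 / 2)| + 1) (shiftD s) (fun x y t => ln ((r0 + y) / 2)).
  by apply: tser_weaken (tser_ln _ r00) => //; rewrite (ltW rho'0) ge_min lexx orbT.
have := tser_add (ltW rho'0) (tser_scale (2^-1) (ltW rho'0) h1) (tser_scale (-1) (ltW rho'0) h2).
set M' := (_ + _) => h3; exists rho', M'; split => //; first by rewrite ge_min lexx orbT.
apply: tser_ext h3 => x y t _ _ _ _; rewrite /MSF; ring.
Qed.

Lemma MSF_continuous_at c0 r0 s e : 0 < r0 -> 0 <= s <= t0 -> 0 < e -> exists2 d, 0 < d &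
  forall c r t, 0 <= t <= t0 -> `|c - c0| < d -> `|r - r0| < d -> `|t - s| < d ->
    `|MSF (fun z => V z t) c r - MSF (fun z => V z s) c0 r0| < e.
Proof.
move=> r00 st e0; have [rho [M [rho0 _ h]]] := MSF_tser c0 r00 st.
have D0 : shiftD s 0 by rewrite /shiftD /= addr0.
have [d d0 hd] := tser_continuous rho0 h D0 e0.
exists d => // c r t tt cd rd td.
have Dt : shiftD s (t - s) by rewrite /shiftD /= addrC subrK.
have := hd (c - c0) (r - r0) (t - s) Dt cd rd td.
by rewrite !addr0 [c0 + _]addrC subrK [r0 + _]addrC subrK [s + _]addrC subrK.
Qed.

Hypothesis growth_p : (fun x => inf [set V x t | t in `[0, t0]] / ln `|x|) x @[x --> +oo] --> +oo.
Hypothesis growth_n : (fun x => inf [set V x t | t in `[0, t0]] / ln `|x|) x @[x --> -oo] --> +oo.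

Lemma V_lower : exists B : R, 0 <= B /\ forall t, 0 <= t <= t0 -> forall x, 4 * ln (1 + `|x|) - B <= V x t.
Proof.
(* The threshold 8 is twice the 4 of the conclusion, since [ln (1 + |x|) <= 2 * ln |x|] when
   [|x| >= 2]. *)
have [X [X2 hX]] : exists X : R, 2 <= X /\ forall x, X < `|x| -> 8 <= inf [set V x t | t in `[0, t0]] / ln `|x|.
  have /cvgryPge /(_ 8) [X1 [X1r h1]] := growth_p.
  have /cvgryPge /(_ 8) [X2 [X2r h2]] := growth_n.
  exists (2 + `|X1| + `|X2|); split; first by have := normr_ge0 X1; have := normr_ge0 X2; lra.
  move=> x; have := ler_norm X1; have := ler_norm (- X2); rewrite normrN => n2 n1.
  have := normr_ge0 X1; have := normr_ge0 X2 => p2 p1.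
  have [x0|x0] := leP 0 x.
    by have ax := ger0_norm x0; rewrite {1}ax => hx; apply: h1; lra.
  by have ax := ltr0_norm x0; rewrite {1}ax => hx; apply: h2; lra.
have [A [A0 hA]] := V_bounded (- X) X.
exists (A + 4 * ln (1 + X)); split.
  by rewrite addr_ge0 // mulr_ge0 // ln_ge0 // lerDl; lra.
move=> t tt x; have [xX|xX] := leP `|x| X.
  have := hA x t; rewrite -ler_norml => /(_ xX tt); rewrite ler_norml => /andP[h _].
  have : ln (1 + `|x|) <= ln (1 + X) by rewrite ler_ln ?posrE ?lerD2l //; have := normr_ge0 x; lra.
  lra.
have L0 : 0 < ln `|x| by rewrite ln_gt0 //; lra.
have := hX x xX; rewrite ler_pdivlMr // => h.
(* [inf] is 0 by convention on a set without infimum, which contradicts the lower bound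
   [8 * ln |x|]; so here it is a genuine lower bound of the values. *)
have hinf : has_inf [set V x t | t in `[0, t0]].
  apply: contrapT => no; move: h; rewrite inf_out // => h; lra.
have h2 : inf [set V x t | t in `[0, t0]] <= V x t.
  by apply: ge_inf; [case: hinf|exists t => //; rewrite /= in_itv].
have h3 : ln (1 + `|x|) <= 2 * ln `|x|.
  have -> : 2 * ln `|x| = ln (`|x| ^+ 2) by rewrite lnXn ?mulr_natl //; lra.
  rewrite ler_ln ?posrE ?exprn_gt0 //; [|lra].
  rewrite expr2; have : 2 * `|x| <= `|x| * `|x| by rewrite ler_wpM2r //; lra.
  lra.
have : 0 <= ln (1 + X) by rewrite ln_ge0 // lerDl; lra.
lra.
Qed.

End family.

(** * Analytic dependence of the endpoints *)

Section gluing.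
Context (R : realType).

Lemma psum_nmonoE (a : nat -> R) t : psum nbox a (nmono t) = fun N => \sum_(k < N) a k * t ^+ k.
Proof. by apply/funext => N; rewrite psum_nat. Qed.

Lemma series_recenter (a : nat -> R) (sigma M z : R) : nbound a sigma M -> `|z| < sigma ->
  exists b : nat -> R, forall u l : R, `|u| < sigma - `|z| ->
    psum nbox a (nmono (z + u)) N @[N --> \oo] --> l -> psum nbox b (nmono u) N @[N --> \oo] --> l.
Proof.
move=> aM zs; have r0 : 0 < sigma - `|z| by rewrite subr_gt0.
pose p K : {poly R} := \sum_(k <- index_iota 0 K) a k *: ('X + z *: 1) ^+ k.
have pM K : nbound (fun n => (p K)`_n) (sigma - `|z|) M.
  have := nbound_poly_sum (index_iota 0 K) (ltW r0) (fun k =>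
    nbound_poly_scale (a k) (ltW r0) (nbound_poly_exp k (ltW r0)
      (nbound_poly_add (ltW r0) (nbound_polyX (ltW r0))
        (nbound_poly_scale z (ltW r0) (nbound_poly1 (sigma - `|z|)))))).
  move=> h N; apply: le_trans (h N) _; apply: le_trans (aM K); apply: ler_sum => k _.
  by rewrite mulr1 subrK.
have [b [_ hb]] := poly_limit_series r0 pM.
exists b => u l ur au; apply: hb => //.
have -> : (fun K => (p K).[u]) = (fun N => psum nbox a (nmono (z + u)) N) => //.
apply/funext => K; rewrite /p horner_sum; apply: eq_bigr => k _.
by rewrite hornerZ horner_exp hornerD hornerX hornerZ hornerC mulr1 addrC.
Qed.

Lemma nbound_cvg (a : nat -> R) sigma M t : nbound a sigma M -> `|t| < sigma ->
  psum nbox a (nmono t) N @[N --> \oo] --> limn (psum nbox a (nmono t)).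
Proof.
move=> aM ts.
suff : cvgn (series (fun k => a k * t ^+ k)) by rewrite seriesEord psum_nmonoE.
apply: normed_cvg; apply: nondecreasing_is_cvgn.
  by apply: nondecreasing_series => k _; rewrite normr_ge0.
exists M => _ [N _ <-]; apply: le_trans (aM N).
rewrite /nbox /series /=; apply: ler_sum => k _; rewrite normrM normrX ler_wpM2l //.
by rewrite lerXn2r // ?nnegrE ?ltW // (le_lt_trans _ ts).
Qed.

(** Beyond the ends of [[0, t0]] the function is defined as the sum of the one-sided series at that
    end; recentring makes it analytic there, and at the end itself one series represents both
    sides. *)
Lemma analytic_extension (f : R -> R) (t0 : R) : 0 <= t0 ->
  (forall s, 0 <= s <= t0 -> exists sigma M a, [/\ 0 < sigma, nbound a sigma M &
    forall t, 0 <= t <= t0 -> `|t - s| < sigma -> psum nbox a (nmono (t - s)) N @[N --> \oo] --> f t]) ->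
  exists g c d, [/\ c < 0, t0 < d, real_analytic_on g `]c, d[%classic & forall t, 0 <= t <= t0 -> g t = f t].
Proof.
move=> t00 loc.
have [s0 [M0 [a0 [s00 b0 h0]]]] := loc 0 (introT andP (conj (lexx 0) t00)).
(* When [t0 = 0] the two ends coincide, and the same series must be used on both sides. *)
have [s1 [M1 [a1 [s10 b1 h1 e1]]]] : exists s1 M1 a1, [/\ 0 < s1, nbound a1 s1 M1,
    (forall t, 0 <= t <= t0 -> `|t - t0| < s1 -> psum nbox a1 (nmono (t - t0)) N @[N --> \oo] --> f t) &
    (t0 = 0 -> s1 = s0 /\ a1 = a0)].
  have [e|ne] := eqVneq t0 0; first by exists s0, M0, a0; split => // t tt; rewrite {1 2}e; exact: h0.
  have [s1 [M1 [a1 [? ? ?]]]] := loc t0 (introT andP (conj t00 (lexx t0))).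
  by exists s1, M1, a1; split => // e; rewrite e eqxx in ne.
pose g t := if t < 0 then limn (psum nbox a0 (nmono t)) else
  if t0 < t then limn (psum nbox a1 (nmono (t - t0))) else f t.
have Z0 t : `|t| < s0 -> t <= t0 \/ t0 = 0 -> psum nbox a0 (nmono t) N @[N --> \oo] --> g t.
  move=> ts tt; rewrite /g; case: ltP => [t_lt0|t_ge0]; first exact: nbound_cvg b0 ts.
  case: ltP => [tt0|t_let0].
    case: tt => [|e]; first by rewrite leNgt tt0.
    have [_ ->] := e1 e; rewrite e subr0; exact: nbound_cvg b0 ts.
  by have := h0 t; rewrite subr0 t_ge0 t_let0 => /(_ isT ts).
have Z1 t : `|t - t0| < s1 -> 0 <= t \/ t0 = 0 -> psum nbox a1 (nmono (t - t0)) N @[N --> \oo] --> g t.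
  move=> ts tt; rewrite /g; case: ltP => [t_lt0|t_ge0].
    case: tt => [|e]; first by rewrite leNgt t_lt0.
    have [es ea] := e1 e; rewrite ea e subr0; apply: nbound_cvg b0 _.
    by move: ts; rewrite e subr0 es.
  case: ltP => [tt0|t_let0]; first exact: nbound_cvg b1 ts.
  by apply: h1 => //; rewrite t_ge0.
exists g, (- s0), (t0 + s1); split.
- by rewrite oppr_lt0.
- by rewrite ltrDl.
- move=> x0; rewrite /= in_itv /= => /andP[x0l x0r].
  suff [r [b [r0 hb]]] : exists r b, 0 < r /\ forall x, `|x - x0| < r ->
      psum nbox b (nmono (x - x0)) N @[N --> \oo] --> g x.
    exists r; split => //; exists b => x _ xr; have := hb x xr.
    by rewrite psum_nmonoE.
  have [x0n|x0p] := ltP x0 0.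
    have xs : `|x0| < s0 by rewrite ltr0_norm //; lra.
    have [b hb] := series_recenter b0 xs.
    exists (Num.min (s0 - `|x0|) (- x0)), b; split; first by rewrite lt_min subr_gt0 xs oppr_gt0.
    move=> x; rewrite lt_min => /andP[h2 h3]; apply: hb => //.
    rewrite addrC subrK; move: h2 h3; rewrite (ltr0_norm x0n) !ltr_norml => h2 h3.
    by apply: Z0; [rewrite ltr_norml; lra|left; lra].
  have [x0t|x0t] := ltP t0 x0.
    have x0p' : 0 < x0 - t0 by rewrite subr_gt0.
    have xs : `|x0 - t0| < s1 by rewrite gtr0_norm //; lra.
    have [b hb] := series_recenter b1 xs.
    exists (Num.min (s1 - `|x0 - t0|) (x0 - t0)), b; split; first by rewrite lt_min !subr_gt0 xs.
    move=> x; rewrite lt_min => /andP[h2 h3]; apply: hb => //.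
    have -> : x0 - t0 + (x - x0) = x - t0 by ring.
    move: h2 h3; rewrite (gtr0_norm x0p') !ltr_norml => h2 h3.
    by apply: Z1; [rewrite ltr_norml; lra|left; lra].
  have [e|ne] := eqVneq t0 0.
    have -> : x0 = 0 by apply/eqP; rewrite eq_le x0p andbT -e.
    by exists s0, a0; split => // x; rewrite subr0 => h; apply: Z0 => //; right.
  have t0p : 0 < t0 by rewrite lt_neqAle eq_sym ne.
  have [e0|n0] := eqVneq x0 0.
    exists (Num.min s0 t0), a0; split; first by rewrite lt_min s00.
    move=> x; rewrite e0 subr0 lt_min => /andP[h2 h3]; apply: Z0 => //; left.
    by move: h3; rewrite ltr_norml; lra.
  have [et|nt] := eqVneq x0 t0.
    exists (Num.min s1 t0), a1; split; first by rewrite lt_min s10.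
    move=> x; rewrite et lt_min => /andP[h2 h3]; apply: Z1 => //; left.
    by move: h3; rewrite ltr_norml; lra.
  have x00 : 0 < x0 by rewrite lt_neqAle eq_sym n0.
  have x01 : x0 < t0 by rewrite lt_neqAle nt.
  have [s2 [M2 [a2 [s20 b2 h2]]]] := loc x0 (introT andP (conj x0p x0t)).
  exists (Num.min s2 (Num.min x0 (t0 - x0))), a2; split; first by rewrite !lt_min s20 x00 subr_gt0.
  move=> x; rewrite !lt_min => /andP[h3 /andP[]]; rewrite !ltr_norml => /andP[h4 h5] /andP[h6 h7].
  have xx : 0 <= x <= t0 by apply/andP; split; lra.
  have -> : g x = f x by rewrite /g; case/andP: xx => x1 x2; rewrite ltNge x1 /= ltNge x2.
  exact: h2.
- by move=> t /andP[h2 h3]; rewrite /g ltNge h2 /= ltNge h3.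
Qed.

(** Turns the series of the displacements of centre and half-length into that of an endpoint; [e]
    restores the value at the base point. *)
Lemma series_combination (a b : nat -> R) (sigma M1 M2 p q e : R) : 0 < sigma ->
  nbound a sigma M1 -> nbound b sigma M2 ->
  nbound (fun k => p * a k + q * b k + (k == 0%N)%:R * e) sigma (`|p| * M1 + `|q| * M2 + `|e|) /\
  forall t x y, psum nbox a (nmono t) N @[N --> \oo] --> x -> psum nbox b (nmono t) N @[N --> \oo] --> y ->
    psum nbox (fun k => p * a k + q * b k + (k == 0%N)%:R * e) (nmono t) N @[N --> \oo] --> p * x + q * y + e.
Proof.
move=> s0 aM bM.
have pick (h : nat -> R) N : \sum_(k < N.+1) (nat_of_ord k == 0%N)%:R * h k = h 0%N.
  by rewrite big_ord_recl /= mul1r big1 ?addr0 // => k _; rewrite mul0r.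
split.
  move=> N; apply: (@le_trans _ _ (\sum_(i <- nbox N.+1) `|p * a i + q * b i + (i == 0%N)%:R * e| * sigma ^+ i)).
    by rewrite /nbox !big_mkord big_ord_recr /= lerDl mulr_ge0 // exprn_ge0 // ltW.
  apply: (@le_trans _ _ (`|p| * (\sum_(i <- nbox N.+1) `|a i| * sigma ^+ i) +
     `|q| * (\sum_(i <- nbox N.+1) `|b i| * sigma ^+ i) +
     \sum_(i < N.+1) (nat_of_ord i == 0%N)%:R * (`|e| * sigma ^+ i))).
    rewrite /nbox !big_mkord !mulr_sumr -!big_split /=; apply: ler_sum => k _.
    rewrite !mulrA -!mulrDl ler_wpM2r ?exprn_ge0 ?(ltW s0) //.
    apply: le_trans (ler_normD _ _) _; rewrite [`|_ * e|]normrM normr_nat lerD2r.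
    by apply: le_trans (ler_normD _ _) _; rewrite !normrM.
  rewrite (pick (fun i => `|e| * sigma ^+ i)) expr0 mulr1.
  by rewrite lerD2r lerD // ler_wpM2l.
move=> t x y ax bx.
rewrite -(cvg_shiftS (psum nbox _ (nmono t))) /=.
have -> : (fun N => psum nbox (fun k => p * a k + q * b k + (k == 0%N)%:R * e) (nmono t) N.+1) =
  (fun N => p * psum nbox a (nmono t) N.+1 + q * psum nbox b (nmono t) N.+1 + e).
  apply/funext => N; rewrite !psum_nat.
  have {2}-> : e = \sum_(k < N.+1) (nat_of_ord k == 0%N)%:R * (e * nmono t k).
    by rewrite (pick (fun k => e * nmono t k)) /nmono expr0 mulr1.
  rewrite !mulr_sumr -!big_split /=; apply: eq_bigr => k _; ring.
apply: cvgD; last exact: cvg_cst.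
apply: cvgD; apply: cvgM; try exact: cvg_cst.
- by rewrite (cvg_shiftS (psum nbox a (nmono t))).
- by rewrite (cvg_shiftS (psum nbox b (nmono t))).
Qed.

Lemma real_analytic_on_sub (f : R -> R) (A B : set R) : A `<=` B -> real_analytic_on f B -> real_analytic_on f A.
Proof.
move=> AB fB x0 /AB/fB[r [r0 [c hc]]]; exists r; split => //; exists c => x /AB; exact: hc.
Qed.

End gluing.

(** * Bounds on the functional, the energy and the support *)

Section potential_bounds.
Context (R : realType) (V : R -> R) (B : R).
Hypothesis cV : continuous V.
Hypothesis VB : forall x, 4 * ln (1 + `|x|) - B <= V x.
Hypothesis B0 : 0 <= B.
Notation leb := (@lebesgue_measure R).

Lemma node_in (c r th : R) : 0 < r -> `|c + r * cos th - c| <= r.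
Proof.
move=> r0; rewrite addrC addKr normrM gtr0_norm //.
by rewrite ler_piMr ?(ltW r0) // ler_norml cos_geN1 cos_le1.
Qed.

Lemma Vmean_le c r A : 0 < r -> (forall x, `|x - c| <= r -> V x <= A) -> Vmean V c r <= A.
Proof.
move=> r0 h; have l := riemann_average (@continuous_Vcos _ _ cV c r).
rewrite /Vmean -(cvg_lim _ l) //; apply: limr_le; first by apply/cvg_ex; eexists; exact: l.
apply: nearW => K; apply: (@le_trans _ _ (\sum_(k < K.+1) K.+1%:R^-1 * A)).
  by apply: ler_sum => k _; rewrite ler_wpM2l ?invr_ge0 ?ler0n // h // node_in.
by rewrite sumr_const card_ord -mulrnAl -[_ *+ K.+1]mulr_natl mulfV ?pnatr_eq0 // mul1r.
Qed.

Lemma Vmean_ge c r A : 0 < r -> (forall x, `|x - c| <= r -> A <= V x) -> A <= Vmean V c r.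
Proof.
move=> r0 h; have l := riemann_average (@continuous_Vcos _ _ cV c r).
rewrite /Vmean -(cvg_lim _ l) //; apply: limr_ge; first by apply/cvg_ex; eexists; exact: l.
apply: nearW => K; apply: (@le_trans _ _ (\sum_(k < K.+1) K.+1%:R^-1 * A)).
  by rewrite sumr_const card_ord -mulrnAl -[_ *+ K.+1]mulr_natl mulfV ?pnatr_eq0 // mul1r.
by apply: ler_sum => k _; rewrite ler_wpM2l ?invr_ge0 ?ler0n // h // node_in.
Qed.

Lemma MSF_le c r A : 0 < r -> (forall x, `|x - c| <= r -> V x <= A) -> MSF V c r <= A / 2 - ln (r / 2).
Proof. by move=> r0 /(Vmean_le r0) h; rewrite /MSF lerD2r ler_pM2r // invr_gt0. Qed.

Lemma MSF_ge c r : 0 < r -> - B / 2 - ln (r / 2) <= MSF V c r.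
Proof.
move=> r0; rewrite /MSF lerD2r ler_pM2r ?invr_gt0 //; apply: Vmean_ge => // x _.
apply: le_trans (VB x); rewrite lerDr mulr_ge0 // ln_ge0 // lerDl //.
Qed.

Lemma en_arcsine_le c r A : 0 < r -> (forall x, `|x - c| <= r -> V x <= A) ->
  (enK V B (arcsine c r) (arcsine c r) <= (A - ln (r / 2) + B)%:E)%E.
Proof.
move=> r0 h; have -> : enK V B (arcsine c r) (arcsine c r) = (\int[arcsine c r]_x potK V B (arcsine c r) x)%E by [].
rewrite integral_arcsine; last 2 first.
- exact: measurable_potK.
- by move=> x; exact: potK_ge0.
set C := A - ln (r / 2) + B.
have C0 th : (potK V B (arcsine c r) (c + r * cos th)%R <= C%:E)%E.
  rewrite (pot_arcsine_in cV VB r0 (node_in _ _ r0)) lee_fin /hV /C.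
  have := MSF_le r0 h; have := h _ (node_in c th r0); lra.
have -> : C%:E = ((pi^-1)%:E * \int[leb]_(th in `[0%R, pi]) C%:E)%E.
  by rewrite int_cst_pi -EFinM mulrA mulVf ?gt_eqF ?pi_gt0 // mul1r.
rewrite lee_pmul2l //; last by rewrite lte_fin invr_gt0 pi_gt0.
apply: ge0_le_integral => //.
- by move=> x _; exact: potK_ge0.
- apply: measurable_funTS; apply: measurableT_comp; first exact: measurable_potK.
  apply: measurable_funD => //; apply: measurable_funM => //.
  by apply: continuous_measurable_fun; exact: continuous_cos.
Qed.

Lemma support_tight (mu : probability R R) L x :
  mu (~` `[(- L)%R, L]%classic) = 0%E -> msupport mu x -> - L <= x <= L.
Proof.
move=> out xs; apply: contrapT => xL.
have [e e0 he] : exists2 e, 0 < e & forall y, x - e < y < x + e -> ~ (- L <= y <= L).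
  have [h|h] := ltP x (- L).
    by exists (- L - x); [rewrite subr_gt0|move=> y /andP[h1 h2] /andP[h3 h4]; clear out; lra].
  have h2 : L < x by rewrite ltNge; apply/negP => h3; apply: xL; rewrite h h3.
  by exists (x - L); [rewrite subr_gt0|move=> y /andP[h1 h3] /andP[h4 h5]; clear out; lra].
have := xs e e0; rewrite ltNge => /negP; apply.
rewrite -out; apply: le_measure; rewrite ?inE.
- exact: measurable_itv.
- by apply: measurableC; exact: measurable_itv.
- by move=> y; rewrite /= !in_itv /= => /he.
Qed.

End potential_bounds.

(** * Endpoints along the family *)

Section endpoints.
Context (R : realType) (V : R -> R -> R) (t0 B : R).
Hypothesis t00 : 0 <= t0.
Hypothesis series : forall x0 s, 0 <= s <= t0 -> real_series_at V t0 x0 s.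
Hypothesis B0 : 0 <= B.
Hypothesis VB : forall t, 0 <= t <= t0 -> forall x, 4 * ln (1 + `|x|) - B <= V x t.
Variables (mu : R -> probability R R) (a b : R -> R) (h : R -> R -> R).
Hypothesis cut : forall t, 0 <= t <= t0 ->
  [/\ is_equilibrium_measure (fun x => V x t) (mu t), one_cut_shape (mu t) (a t) (b t) (h t),
      h t (a t) != 0 & h t (b t) != 0].
Local Notation F t := (MSF (fun x => V x t)).
Local Notation c t := ((a t + b t) / 2).
Local Notation r t := ((b t - a t) / 2).

Let cV t : 0 <= t <= t0 -> continuous (fun x => V x t).
Proof. exact: V_continuous. Qed.

Let r_gt0 t : 0 <= t <= t0 -> 0 < r t.
Proof. by move=> /cut[_ /one_cut_lt ab _ _]; rewrite divr_gt0 // subr_gt0. Qed.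

Lemma F_min t c' r' : 0 <= t <= t0 -> 0 < r' -> F t (c t) (r t) <= F t c' r'.
Proof.
move=> tt r'0; have [eqm sh _ _] := cut tt.
exact: (MSF_min (cV tt) (VB tt) B0 eqm (one_cut_lt sh) (one_cut_support sh) (one_cut_outside sh)).
Qed.

(** The energy is at most that of the arcsine measure of [[-1, 1]], bounded uniformly in [t], which
    confines the support by [equilibrium_tight]. The half-length stays away from 0 because the term
    [- ln (r / 2)] would otherwise push the functional above its value at [[-1, 1]]. *)
Lemma endpoints_bounded : exists L eps : R, [/\ 0 < eps, 0 < L &
  forall t, 0 <= t <= t0 -> - L <= c t <= L /\ eps <= r t <= L].
Proof.
have [A [A0 hA]] := V_bounded series (-1) 1.
have hA1 t : 0 <= t <= t0 -> forall x, `|x - 0| <= 1 -> V x t <= A.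
  move=> tt x; rewrite subr0 ler_norml => x1; apply: le_trans (ler_norm _) _; exact: hA.
pose Q := A - ln (1 / 2) + B; pose L := expR Q.
pose Q2 := A / 2 - ln (1 / 2) + B / 2.
exists L, (2 * expR (- Q2)); split; [by rewrite mulr_gt0 // expR_gt0|exact: expR_gt0|].
move=> t tt; have [eqm sh _ _] := cut tt; have ab := one_cut_lt sh.
have L0 : 0 < L by exact: expR_gt0.
have out : mu t (~` `[(- L)%R, L]%classic) = 0%E.
  apply: (equilibrium_tight (cV tt) (VB tt) eqm); first exact: ltW.
  have E0 := enK_ge0 (VB tt) (mu t) (mu t).
  have E1 := le_trans (equilibrium_enK (cV tt) (VB tt) (arcsine 0 1) eqm)
    (en_arcsine_le (cV tt) (VB tt) ltr01 (hA1 t tt)).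
  have E2 : fine (enK (fun x => V x t) B (mu t) (mu t)) <= Q.
    rewrite -lee_fin fineK //; rewrite ge0_fin_numE //; exact: le_lt_trans E1 (ltry _).
  apply: le_lt_trans E2 _; rewrite -{1}(expRK Q) -/L ltr_ln ?posrE ?ltrDr //.
  by rewrite addr_gt0.
have inL x : a t <= x <= b t -> - L <= x <= L.
  move=> xab; apply: (support_tight out); by rewrite (one_cut_support sh) /= in_itv.
have := inL (a t); rewrite lexx (ltW ab) => /(_ isT) /andP[h1 h2].
have := inL (b t); rewrite lexx (ltW ab) => /(_ isT) /andP[h3 h4].
split; first by apply/andP; split; lra.
apply/andP; split; last lra.
have rt0 := r_gt0 tt.
have := F_min 0 tt ltr01; have := MSF_le (cV tt) ltr01 (hA1 t tt).
have := MSF_ge (cV tt) (VB tt) (c t) rt0 => k1 k2 k3.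
have : - Q2 <= ln (r t / 2) by move: (le_trans k1 (le_trans k3 k2)); rewrite /Q2; lra.
move=> k; have : expR (- Q2) <= expR (ln (r t / 2)) by rewrite ler_expR.
rewrite lnK ?posrE ?divr_gt0 //; lra.
Qed.

Lemma local_minimizer s : 0 <= s <= t0 ->
  (forall c' r', 0 < r' -> F s c' r' <= F s (c s) (r s) -> c' = c s /\ r' = r s) /\
  exists sigma d M al be, [/\ 0 < sigma, 0 < d, nbound al sigma M, nbound be sigma M &
    forall t, 0 <= t <= t0 -> `|t - s| < sigma -> `|c t - c s| <= d -> `|r t - r s| <= d ->
      psum nbox al (nmono (t - s)) N @[N --> \oo] --> c t - c s /\
      psum nbox be (nmono (t - s)) N @[N --> \oo] --> r t - r s].
Proof.
move=> st; have [eqm sh ha hb] := cut st; have rs0 := r_gt0 st.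
have [rho [M [rho0 rhor Fser]]] := MSF_tser series (c s) rs0 st.
have [k [rho1 [k0 rho10 rho1r gr]]] := MSF_growth (cV st) (VB st) B0 eqm sh ha hb.
pose g x y tau := F (s + tau) (c s + x) (r s + y).
have g0 : g 0 0 0 = F s (c s) (r s) by rewrite /g !addr0.
have gE x y : g x y 0 = F s (c s + x) (r s + y) by rewrite /g addr0.
pose rho2 := Num.min rho rho1.
have rho20 : 0 < rho2 by rewrite lt_min rho0.
have rho2r : 0 < rho2 <= rho by rewrite rho20 ge_min lexx.
have rho21 : rho2 <= rho1 by rewrite ge_min lexx orbT.
have D0 : shiftD t0 s 0 by rewrite /shiftD /= addr0.
have [|||[d d0 hd] [sigma [d' [M' [al [be [sg0 d'0 alM beM hs]]]]]]] :=
   @minimizer_series R rho M (shiftD t0 s) g k rho2 rho0 k0 rho2r D0 Fser.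
- move=> x y xr yr; rewrite g0 gE; apply: F_min => //.
  by move: yr; rewrite ltr_norml; lra.
- move=> x y xr yr yx; rewrite g0 gE.
  by have [h1 _] := gr x y (lt_le_trans xr rho21) (lt_le_trans yr rho21); exact: h1.
- move=> x y xr yr yx; rewrite g0 gE.
  by have [_ h1] := gr x y (lt_le_trans xr rho21) (lt_le_trans yr rho21); exact: h1.
split.
  move=> c' r' r'0 hm.
  apply: (minimizer_unique (cV st) (VB st) B0 eqm (one_cut_lt sh) (one_cut_support sh) (one_cut_outside sh) r'0 hm).
  exists d => // x y xd yd xy; have := hd x y xd yd xy; rewrite g0 gE; exact.
exists sigma, d', M', al, be; split => // t tt ts cd rd.
apply: hs => //; first by rewrite /shiftD /= addrC subrK.
have rt0 := r_gt0 tt.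
exists (r t) => // x' y' _ yr; rewrite /g.
have e1 : s + (t - s) = t by ring.
have e2 : c s + (c t - c s) = c t by ring.
have e3 : r s + (r t - r s) = r t by ring.
rewrite e1 e2 e3; apply: F_min => //.
by move: yr; rewrite ltr_norml; lra.
Qed.

(** Compactness on [[- L, L] x [eps, L]]: away from [(c s, r s)] the functional at [s] is strictly
    larger by uniqueness, and remains so uniformly for [t] near [s], so the minimizer at [t] cannot
    lie there. *)
Lemma minimizer_continuous s d : 0 <= s <= t0 -> 0 < d -> exists2 eta, 0 < eta &
  forall t, 0 <= t <= t0 -> `|t - s| < eta -> `|c t - c s| < d /\ `|r t - r s| < d.
Proof.
move=> st d0; have [uniq _] := local_minimizer st.
have [L [eps [eps0 L0 hL]]] := endpoints_bounded.
pose P n c' r' := forall t, 0 <= t <= t0 -> `|t - s| < n.+1%:R^-1 ->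
  (d <= `|c' - c s|) || (d <= `|r' - r s|) -> F t (c s) (r s) < F t c' r'.
have [n hn] : exists n, forall c' r', - L <= c' <= L -> eps <= r' <= L -> P n c' r'.
  apply: compact_uniform2 => [n m c' r' nm hP t tt ts|c' r' _ /andP[r'e _]].
    apply: hP => //; apply: lt_le_trans ts _.
    by rewrite lef_pV2 ?posrE ?ltr0n // ler_nat.
  have r'0 : 0 < r' by exact: lt_le_trans r'e.
  have [far|near] := boolP ((d <= `|c' - c s|) || (d <= `|r' - r s|)).
    have gap : F s (c s) (r s) < F s c' r'.
      rewrite ltNge; apply/negP => /(uniq _ _ r'0)[ec er].
      by move: far; rewrite ec er !subrr normr0 leNgt d0.
    (* Half the gap: each of the two values compared moves by less than this. *)
    pose e := (F s c' r' - F s (c s) (r s)) / 2.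
    have e0 : 0 < e by rewrite divr_gt0 // subr_gt0.
    have [d1 d10 h1] := MSF_continuous_at series c' r'0 st e0.
    have [d2 d20 h2] := MSF_continuous_at series (c s) (r_gt0 st) st e0.
    pose dm := Num.min d1 d2; have dm0 : 0 < dm by rewrite lt_min d10.
    have [k _ hk] := near_infty_natSinv_lt (PosNum dm0).
    exists k, d1 => // x y xd yd t tt ts _.
    have tm : `|t - s| < dm by apply: lt_trans ts _; exact: hk k (leqnn k).
    have [t1 t2] : `|t - s| < d1 /\ `|t - s| < d2 by move: tm; rewrite lt_min => /andP.
    have := h1 x y t tt xd yd t1; have := h2 (c s) (r s) t tt.
    rewrite !subrr normr0 => /(_ d20 d20 t2); rewrite !ltr_norml /e; lra.
  move: near; rewrite negb_or -!ltNge => /andP[n1 n2].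
  exists 0%N, (Num.min (d - `|c' - c s|) (d - `|r' - r s|)); first by rewrite lt_min !subr_gt0 n1.
  move=> x y; rewrite !lt_min => /andP[x1 _] /andP[_ y1] t _ _ far; exfalso; move: far.
  have k1 : `|x - c s| < d by have := ler_distD c' x (c s); lra.
  have k2 : `|y - r s| < d by have := ler_distD r' y (r s); lra.
  by rewrite !leNgt k1 k2.
exists n.+1%:R^-1; first by rewrite invr_gt0 ltr0n.
move=> t tt ts; have [cL rL] := hL t tt.
have := hn _ _ cL rL t tt ts; have [far|near] := boolP (_ || _).
  by move=> /(_ isT); rewrite ltNge F_min // r_gt0.
by move=> _; move: near; rewrite negb_or -!ltNge => /andP.
Qed.

(** [p = -1] gives the left endpoint and [p = 1] the right one. Continuity brings the minimizer
    within the distance [d] at which the series of [local_minimizer] represent it. *)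
Lemma endpoint_series (p : R) (s : R) : `|p| = 1 -> 0 <= s <= t0 ->
  exists sigma M al, [/\ 0 < sigma, nbound al sigma M &
    forall t, 0 <= t <= t0 -> `|t - s| < sigma ->
      psum nbox al (nmono (t - s)) N @[N --> \oo] --> c t + p * r t].
Proof.
move=> p1 st; have [_ [sigma [d [M [al [be [sg0 d0 alM beM hs]]]]]]] := local_minimizer st.
have [eta eta0 he] := minimizer_continuous st d0.
have [bnd lim] := series_combination 1 p (c s + p * r s) sg0 alM beM.
pose sg := Num.min sigma eta; have sg10 : 0 < sg by rewrite lt_min sg0.
exists sg; eexists; exists (fun k => 1 * al k + p * be k + (k == 0%N)%:R * (c s + p * r s)); split => //.
  move=> N; apply: le_trans (bnd N); apply: ler_sum => k _; rewrite ler_wpM2l //.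
  have sgs : sg <= sigma by rewrite /sg ge_min lexx.
  by rewrite lerXn2r // nnegrE ltW.
move=> t tt; rewrite lt_min => /andP[t1 t2].
have [k1 k2] := he t tt t2.
have [l1 l2] := hs t tt t1 (ltW k1) (ltW k2).
have -> : c t + p * r t = 1 * (c t - c s) + p * (r t - r s) + (c s + p * r s) by ring.
exact: lim.
Qed.

Lemma endpoints_analytic : exists (al be : R -> R) (c d : R), c < 0 /\ t0 < d /\
  real_analytic_on al `]c, d[%classic /\ real_analytic_on be `]c, d[%classic /\
  forall t, 0 <= t <= t0 -> al t = a t /\ be t = b t.
Proof.
have n1 : `|-1 : R| = 1 by rewrite normrN normr1.
have [al [c1 [d1 [c10 d10 al_an alE]]]] := analytic_extension t00 (fun s => endpoint_series n1 (s := s)).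
have [be [c2 [d2 [c20 d20 be_an beE]]]] := analytic_extension t00 (fun s => endpoint_series (normr1 R) (s := s)).
exists al, be, (Num.max c1 c2), (Num.min d1 d2).
split; first by rewrite gt_max c10.
split; first by rewrite lt_min d10.
split.
  apply: real_analytic_on_sub al_an => x; rewrite /= !in_itv /= gt_max lt_min.
  by move=> /andP[/andP[-> _] /andP[-> _]].
split.
  apply: real_analytic_on_sub be_an => x; rewrite /= !in_itv /= gt_max lt_min.
  by move=> /andP[/andP[_ ->] /andP[_ ->]].
by move=> t tt; rewrite alE // beE //; split; field.
Qed.

End endpoints.

Theorem theorem8p1 (R : realType) (V : R -> R -> R) (t0 : R) :
  (* (a) *)
  (exists (Om : set R[i]) (W : R[i] -> R -> R[i]),
      c_domain Om /\ (forall x : R, Om x%:C%C) /\ joint_analytic_on W Om t0 /\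
      (forall x t : R, 0 <= t <= t0 -> W x%:C%C t = (V x t)%:C%C)) ->
  (* (b) *)
  ((fun x => inf [set V x t | t in `[0, t0]] / ln `|x|) x @[x --> +oo] --> +oo) ->
  ((fun x => inf [set V x t | t in `[0, t0]] / ln `|x|) x @[x --> -oo] --> +oo) ->
  (* (c) *)
  (forall t : R, 0 < t <= t0 -> one_cut_regular (fun x => V x t)) ->
  (* (d) *)
  one_cut_singular (fun x => V x 0) ->
  (exists (mu : probability R R) (a b : R) (h : R -> R),
      is_equilibrium_measure (fun x => V x 0) mu /\ one_cut_shape mu a b h /\
      h a != 0 /\ h b != 0) ->
  (* conclusion *)
  exists (a b : R -> R) (c d : R),
    c < 0 /\ t0 < d /\
    real_analytic_on a `]c, d[%classic /\ real_analytic_on b `]c, d[%classic /\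
    forall t : R, 0 <= t <= t0 ->
      forall mu : probability R R, is_equilibrium_measure (fun x => V x t) mu ->
        msupport mu = `[(a t), (b t)]%classic.
Proof.
move=> [Om [W [_ [OmR [ja WV]]]]] gp gn reg _ sing.
(* For [t0 < 0] the parameter interval is empty and constant functions will do. *)
have [t00|t00] := leP 0 t0; last first.
  exists (fun _ => 0), (fun _ => 0), (-1), 1; rewrite ltrN10 (lt_trans t00 ltr01).
  have an0 : real_analytic_on (fun _ : R => 0) `](-1), 1[%classic.
    move=> x0 _; exists 1; split; first exact: ltr01.
    exists (fun _ => 0) => x _ _; apply: cvg_near_cst; apply: nearW => N.
    by rewrite big1 // => k _; rewrite mul0r.
  by do 4![split => //] => t /andP[h1 h2]; have := le_trans h1 h2; rewrite leNgt t00.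
have series x0 s : 0 <= s <= t0 -> real_series_at V t0 x0 s by exact: joint_analytic_real OmR ja WV.
have [B [B0 VB]] := V_lower series gp gn.
(* Equilibrium data for each [t], with a dummy value outside [[0, t0]]. Nonzero endpoint values of
   [h] come from its positivity for [t > 0] and from (d) at [t = 0]. *)
have cut t : exists q : probability R R * R * R * (R -> R), 0 <= t <= t0 ->
    [/\ is_equilibrium_measure (fun x => V x t) q.1.1.1, one_cut_shape q.1.1.1 q.1.1.2 q.1.2 q.2,
      q.2 q.1.1.2 != 0 & q.2 q.1.2 != 0].
  have [tt|ntt] := boolP (0 <= t <= t0); last by exists (arcsine 0 1, 0, 0, id).
  have [tp|tn] := ltP 0 t.
    have [mu [a [b [h [eqm [sh [hpos _]]]]]]] := reg t (introT andP (conj tp (proj2 (andP tt)))).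
    have ab := one_cut_lt sh.
    exists (mu, a, b, h) => _; split => //=; rewrite gt_eqF // hpos // lexx (ltW ab) //.
  have -> : t = 0 by apply/eqP; rewrite eq_le tn; case/andP: tt.
  by have [mu [a [b [h [eqm [sh [ha hb]]]]]]] := sing; exists (mu, a, b, h).
have [q hq] := choice cut.
have [al [be [c [d [c0 [td [ala [bea abE]]]]]]]] :=
  endpoints_analytic t00 series B0 VB (mu := fun t => (q t).1.1.1) (a := fun t => (q t).1.1.2)
    (b := fun t => (q t).1.2) (h := fun t => (q t).2) hq.
exists al, be, c, d; do 4![split => //] => t tt mu eqm.
have [-> ->] := abE t tt; have [eqt sht _ _] := hq t tt.
(* The conclusion concerns every equilibrium measure; its support is that of the chosen one. *)
rewrite -(one_cut_support sht).
exact: (equilibrium_support_unique (V_continuous series tt) (VB t tt) B0 eqm eqt).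
Qed.
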